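(* For every integer $k\ge 2$, the set $\mathcal{IC}_\infty(C^k(S))$ of functions $f\in C^k(S)$ such that the corresponding family $F_{r,a}:x\mapsto x+2\pi r+a f(x) \pmod{2\pi}$ has infinite infinitesimal cyclicity is Haar prevalent in $C^k(S)$.
   Context: Let $S=\mathbb{R}/2\pi\mathbb{Z}$. $C^k(S)$ is the Banach space of real-valued $2\pi$-periodic $C^k$ functions with the usual $C^k$ norm. Let $X$ be a complete separable normed linear space. A Borel subset $E$ of $X$ is called a Haar null set if there is a Borel probability measure $\mu$ on $X$ such that $\mu(x+E)=0$ for all $x\in X$. The complement of a Haar null set is called Haar prevalent. For a function $f$ on $S$, the corresponding family is $F_{r,a}:S\to S$, $x\mapsto x+2\pi r+a f(x) \pmod{2\pi}$, where $r\in\mathbb{R}$ and $a$ ranges over a small interval $[-a_0,a_0]$ on which these maps are circle diffeomorphisms. For a circle diffeomorphism $g$, $N(g)$ is the number of attracting periodic trajectories of $g$ and $\rho(g)$ is the rotation number of $g$ (normalized so that $x\mapsto x+2\pi r$ has rotation number $r$). Define $$B(F,\rho_0)=\limsup_{a_1\to 0+}\ \sup_{\rho(F_{r,a})=\rho_0,\ |a|<a_1} N(F_{r,a}).$$ The family $F$ has finite infinitesimal cyclicity if $B(F,\rho)$ is uniformly bounded over all $\rho\in\mathbb{R}$; otherwise it has infinite infinitesimal cyclicity. *)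

(* Defs.v *)
From HB Require Import structures.
From mathcomp Require Import all_boot all_order all_algebra.
From mathcomp Require Import all_classical all_reals all_analysis.

Set Implicit Arguments.
Unset Strict Implicit.
Unset Printing Implicit Defensive.

Import Order.TTheory GRing.Theory Num.Theory.
Import numFieldNormedType.Exports.

Local Open Scope classical_set_scope.
Local Open Scope ring_scope.

Section Circle.
Context (R : realType).

Definition congr_2pi (x y : R) : bool := (x - y) / (pi *+ 2) \is a Num.int.

Lemma congr_2pi_refl : reflexive congr_2pi.
Proof. by move=> x; rewrite /congr_2pi subrr mul0r rpred0. Qed.

Lemma congr_2pi_sym : symmetric congr_2pi.
Proof. by move=> x y; rewrite /congr_2pi -opprB mulNr rpredN. Qed.

Lemma congr_2pi_trans : transitive congr_2pi.
Proof.
move=> y x z xy yz; rewrite /congr_2pi.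
by rewrite -(subrK y x) -addrA mulrDl rpredD.
Qed.

Canonical congr_2pi_equiv :=
  EquivRel congr_2pi congr_2pi_refl congr_2pi_sym congr_2pi_trans.

Definition circle : Type :=
  quotient_topology {eq_quot congr_2pi}%qT.

HB.instance Definition _ := Quotient.on circle.
HB.instance Definition _ := Topological.on circle.

End Circle.

Section PeriodicTrajectories.
Context {T : topologicalType}.

Definition trajectory (g : T -> T) (x : T) : set T :=
  range (fun n => iter n g x).

Definition periodic_trajectory (g : T -> T) (O : set T) : Prop :=
  exists x, (exists2 q, (0 < q)%N & iter q g x = x) /\ O = trajectory g x.

(* Asymptotic stability: Lyapunov stability of O together with convergence to O
   of all trajectories starting near O.  Without the first clause the fixed
   point of a circle map with a single semistable fixed point would count. *)
Definition attracting (g : T -> T) (O : set T) : Prop :=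
  (forall U, set_nbhs O U ->
    exists2 V, set_nbhs O V & forall n x, V x -> U (iter n g x)) /\
  (exists2 W, set_nbhs O W &
    forall x, W x -> forall U, set_nbhs O U ->
      \forall n \near \oo, U (iter n g x)).

Definition num_attracting (R : realType) (g : T -> T) : \bar R :=
  counting [set O | periodic_trajectory g O /\ attracting g O].

End PeriodicTrajectories.

Section CircleFamily.
Context (R : realType).
Implicit Types (f : R -> R) (r a : R).
Local Open Scope quotient_scope.

Definition family_lift f r a : R -> R := fun x => x + pi *+ 2 * r + a * f x.

Definition circle_family f r a : circle R -> circle R :=
  fun x => \pi_(circle R) (family_lift f r a (repr x)).

Lemma periodicZ f (m : int) x : periodic f (pi *+ 2) ->
  f (x + (pi *+ 2) *~ m) = f x.
Proof.
move=> pf; case: m => n; first exact: periodicn.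
by rewrite NegzE mulrNz -[LHS](periodicn pf n.+1) addrNK.
Qed.

Lemma circle_family_pi f r a y : periodic f (pi *+ 2) ->
  circle_family f r a (\pi_(circle R) y) =
  \pi_(circle R) (family_lift f r a y).
Proof.
move=> pf; rewrite /circle_family; set x := repr _.
have pi2 : (pi : R) *+ 2 != 0 by rewrite mulrn_eq0 /= gt_eqF// pi_gt0.
have : congr_2pi x y by apply/eqmodP; rewrite /x reprK.
move=> /intrP[m xy].
have {xy} -> : x = y + (pi *+ 2) *~ m.
  by rewrite -mulrzr mulrC -xy divfK// addrC subrK.
apply/eqmodP; rewrite /= /congr_2pi /family_lift periodicZ//.
apply/intrP; exists m; apply: (canLR (mulfK pi2)); rewrite mulrzl.
rewrite opprD addrACA subrr addr0 opprD addrACA subrr addr0.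
by rewrite addrAC subrr add0r.
Qed.

(* For G the lift of an orientation-preserving circle diffeomorphism the limit
   exists and does not depend on the starting point, taken to be 0 here.  It is a
   real number rather than a class mod 1; r and r + 1 give the same circle map,
   so the cyclicity below is the same under either reading of rho. *)
Definition rotation_number (G : R -> R) : R :=
  limn (fun n => iter n G 0 / (pi *+ 2 * n%:R)).

(* For C^1 functions f all the maps with |a| small are diffeomorphisms, so
   no restriction |a| <= a0 is needed in the upper limit.  The supremum is over
   a nonempty set (take a = 0 and r = rho0). *)
Definition cyclicity f (rho0 : R) : \bar R :=
  limf_esup (fun a1 : R =>
    ereal_sup [set num_attracting R (circle_family f ra.1 ra.2) |
      ra in [set ra : R * R |
        rotation_number (family_lift f ra.1 ra.2) = rho0 /\ `|ra.2| < a1]])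
    0^'+.

Definition finite_infinitesimal_cyclicity f : Prop :=
  exists M : R, forall rho0 : R, (cyclicity f rho0 <= M%:E)%E.

Definition infinite_infinitesimal_cyclicity f : Prop :=
  ~ finite_infinitesimal_cyclicity f.

End CircleFamily.

Section CkFunctions.
Context (R : realType) (k : nat).
Implicit Types f g : R -> R.

Definition is_Ck f : Prop :=
  (forall j, (j < k)%N -> forall x, derivable (derive1n j f) x 1) /\
  continuous (derive1n k f).

Definition Ck_circle_pred : {pred R -> R} :=
  mem [set f | periodic f (pi *+ 2) /\ is_Ck f].

Lemma Ck_continuous f j : is_Ck f -> (j <= k)%N -> continuous (derive1n j f).
Proof.
move=> [df cf]; rewrite leq_eqVlt => /predU1P[->//|jk] x.
by apply/differentiable_continuous/derivable1_diffP; exact: df.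
Qed.

Lemma derive1n_lin a f g j : is_Ck f -> is_Ck g -> (j <= k)%N ->
  derive1n j (a *: f + g) = a *: derive1n j f + derive1n j g.
Proof.
move=> [df _] [dg _]; elim: j => [//|j IH jk].
rewrite !derive1nS IH 1?ltnW//; apply/funext => x.
rewrite derive1E deriveD; [|apply: derivableZ; exact: df|exact: dg].
rewrite deriveZ; last exact: df.
by rewrite -!derive1E.
Qed.

Lemma periodic_derive1n f j : periodic f (pi *+ 2) ->
  periodic (derive1n j f) (pi *+ 2).
Proof.
move=> pf; elim: j => [//|j IH] x; rewrite derive1nS /derive1.
under eq_fun do rewrite addrA !IH.
by [].
Qed.

Lemma Ck_submod_closed : submod_closed Ck_circle_pred.
Proof.
have cst_der j : derive1n j (0 : R -> R) = 0.
  elim: j => [//|j IH]; rewrite derive1nS IH; apply/funext => x.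
  exact: derive1_cst.
split.
  rewrite inE /=; split=> //; split=> [j _ x|]; rewrite cst_der.
    exact: derivable_cst.
  exact: cst_continuous.
move=> a f g; rewrite !inE /= => -[pf Cf] [pg Cg]; split.
  move=> x; have := pf x; have := pg x => gx fx.
  by change (a * f (x + pi *+ 2) + g (x + pi *+ 2) = a * f x + g x);
     rewrite fx gx.
split=> [j jk x|].
  rewrite (derive1n_lin _ Cf Cg) 1?ltnW//.
  apply: derivableD; last exact: (proj1 Cg).
  by apply: derivableZ; exact: (proj1 Cf).
rewrite (derive1n_lin _ Cf Cg)// => x.
apply: continuousD; last exact: (proj2 Cg).
by apply: continuousM; [exact: cst_continuous|exact: (proj2 Cf)].
Qed.

HB.instance Definition _ :=
  GRing.isSubmodClosed.Build _ _ Ck_circle_pred Ck_submod_closed.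

Record Ck_circle := CkCircle {
  Ck_fun :> R -> R;
  _ : Ck_fun \in Ck_circle_pred }.

HB.instance Definition _ := [isSub for Ck_fun].
HB.instance Definition _ := [Choice of Ck_circle by <:].
HB.instance Definition _ := [SubChoice_isSubLmodule of Ck_circle by <:].

Definition sup_norm f : R := sup (range (fun x => `|f x|)).

Definition Ck_norm (f : Ck_circle) : R :=
  \sum_(j < k.+1) sup_norm (derive1n j f).

Lemma Ck_circleP (f : Ck_circle) : periodic f (pi *+ 2) /\ is_Ck f.
Proof. by have := valP f; rewrite inE. Qed.

Lemma has_sup_norm f : periodic f (pi *+ 2) -> continuous f ->
  has_sup (range (fun x => `|f x|)).
Proof.
move=> pf cf; split; first by exists `|f 0|, 0.
have pi2 : 0 < (pi : R) *+ 2 by rewrite mulrn_wgt0// pi_gt0.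
have cnf : {within `[0, pi *+ 2], continuous (fun x => `|f x|)}.
  apply: continuous_subspaceT => x.
  exact: (continuous_comp (cf x) (@norm_continuous _ _ (f x))).
have [c _ cmax] := EVT_max (ltW pi2) cnf.
exists `|f c| => _ [x _ <-].
pose m := Num.floor (x / (pi *+ 2)).
have <- : f (x - (pi *+ 2) *~ m) = f x by rewrite -mulrNz periodicZ.
apply: cmax; rewrite in_itv /= subr_ge0 -mulrzr.
rewrite mulrC -ler_pdivlMr// floor_le_tmp /= lerBlDr.
rewrite -[X in _ <= X + _]mul1r -mulrDl -ler_pdivrMr// addrC.
by rewrite -intrD1 ltW// floorD1_gt.
Qed.

Lemma sup_norm_ub f x : has_sup (range (fun x => `|f x|)) ->
  `|f x| <= sup_norm f.
Proof. by move=> [_ ubf]; apply: ub_le_sup => //; exists x. Qed.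

Lemma Ck_has_sup (f : Ck_circle) (j : 'I_k.+1) :
  has_sup (range (fun x => `|derive1n j f x|)).
Proof.
have [pf Cf] := Ck_circleP f; apply: has_sup_norm.
  exact: periodic_derive1n.
by apply: Ck_continuous => //; rewrite -ltnS.
Qed.

Lemma sup_norm_le f M : (forall x, `|f x| <= M) -> sup_norm f <= M.
Proof.
move=> fM; apply: ge_sup; first by exists `|f 0|, 0.
by move=> _ [x _ <-].
Qed.

Lemma Ck_derD (f g : Ck_circle) (j : 'I_k.+1) :
  derive1n j (f + g : Ck_circle) = derive1n j f + derive1n j g.
Proof.
have := @derive1n_lin 1 f g j (proj2 (Ck_circleP f)) (proj2 (Ck_circleP g)).
by rewrite !scale1r -ltnS; apply.
Qed.

Lemma Ck_derZ a (f : Ck_circle) (j : 'I_k.+1) :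
  derive1n j (a *: f : Ck_circle) = a *: derive1n j f.
Proof.
have := @derive1n_lin a f (0 : Ck_circle) j
  (proj2 (Ck_circleP f)) (proj2 (Ck_circleP _)).
rewrite -ltnS => /(_ (ltn_ord j)).
have -> : derive1n j (0 : Ck_circle) = 0.
  elim: (nat_of_ord j) => [//|i IH]; rewrite derive1nS IH; apply/funext => x.
  exact: derive1_cst.
by rewrite !addr0.
Qed.

Lemma Ck_normD (f g : Ck_circle) : Ck_norm (f + g) <= Ck_norm f + Ck_norm g.
Proof.
rewrite /Ck_norm -big_split /=; apply: ler_sum => j _.
apply: sup_norm_le => x; rewrite Ck_derD.
apply: (le_trans (ler_normD _ _)).
by apply: lerD; apply: sup_norm_ub; exact: Ck_has_sup.
Qed.

Lemma Ck_normZ a (f : Ck_circle) : Ck_norm (a *: f) = `|a| * Ck_norm f.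
Proof.
rewrite /Ck_norm mulr_sumr; apply: eq_bigr => j _; rewrite Ck_derZ.
apply/eqP; rewrite eq_le; apply/andP; split.
  apply: sup_norm_le => x; rewrite normrM ler_wpM2l//.
  by apply: sup_norm_ub; exact: Ck_has_sup.
have [->|a0] := eqVneq a 0.
  rewrite normr0 mul0r; apply: (le_trans (normr_ge0 ((0 *: derive1n j f) 0))).
  by apply: sup_norm_ub; rewrite -Ck_derZ; exact: Ck_has_sup.
rewrite mulrC -ler_pdivlMr ?normr_gt0//.
apply: sup_norm_le => x; rewrite ler_pdivlMr ?normr_gt0// mulrC -normrM.
apply: (@sup_norm_ub (a *: derive1n j f)).
by rewrite -Ck_derZ; exact: Ck_has_sup.
Qed.

Lemma Ck_norm0_eq0 (f : Ck_circle) : Ck_norm f = 0 -> f = 0.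
Proof.
move=> /eqP; rewrite psumr_eq0 => [/allP/(_ ord0)|j _]; last first.
  by apply: (le_trans (normr_ge0 (derive1n j f 0))); apply: sup_norm_ub;
     exact: Ck_has_sup.
rewrite mem_index_enum => /(_ isT)/eqP f0; apply: val_inj; apply/funext => x.
apply/eqP; rewrite -normr_le0 -f0.
exact: (sup_norm_ub x (Ck_has_sup f ord0)).
Qed.

HB.instance Definition _ :=
  Lmodule_isNormed.Build R Ck_circle Ck_normD Ck_normZ Ck_norm0_eq0.

End CkFunctions.

Section HaarNull.
Context (R : realType) (X : normedModType R).

Local Notation borel := (g_sigma_algebraType (@open X)).

(* Completeness and separability of X are not needed for the definition; E is
   required to be Borel itself, not merely contained in a Borel null set. *)
Definition haar_null (E : set X) : Prop :=
  measurable (E : set borel) /\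
  exists mu : probability borel R,
    forall x : X, mu [set x + e | e in E] = 0%E.

Definition haar_prevalent (A : set X) : Prop := haar_null (~` A).

End HaarNull.

Definition IC_infty (R : realType) (k : nat) : set (Ck_circle R k) :=
  [set f : Ck_circle R k | infinite_infinitesimal_cyclicity f].
Arguments IC_infty : clear implicits.

(* Main.v *)
(* For |a| small the lift of F_(r,a) is monotone, and an orbit of rotation number
   p / q is attracting exactly when the return displacement
   D(x) = F^q(x) - x - 2 pi p changes sign from + to - across each of its points.
   Strict sign alternations of D on disjoint arcs are an open condition on f; and
   since D increases with r, Sard's lemma yields r' close to r for which the zeros
   of D are nondegenerate, so that alternations become attracting orbits.  Hence a
   bound on the number of attracting orbits is a closed condition on every ball,
   and finite cyclicity is Borel.

   As a -> 0, D / (a q) tends to f_q - c, where f_q is the average of f over the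
   rotations of order q; the cyclicity at 1 / q is thus at least the number of
   alternations of f_q around a level on a period 2 pi / q.

   The measure is the law of h = sum_j 2^-j (l_j q_j)^-k cos (l_j q_j x), with
   l_j = 2^j and q_j picked uniformly in a long block of a chain of dilations in
   which each one divides the next.  For a fixed g in C^k the averages of g^(k)
   along the chain are successive orthogonal projections, so their increments are
   small for all but a bounded number of places of the block, and the proportion of
   bad q_j tends to 0.  For a good q_j the oscillation of g_(q_j) is negligible
   before the j-th term of h, while the earlier terms average to 0 and the later
   ones are tiny: (g + h)_(q_j) alternates l_j times on a period.  Almost surely
   infinitely many q_j are good, and the cyclicity is unbounded. *)

Require Import Defs.
From HB Require Import structures.
From mathcomp Require Import all_boot all_order all_algebra.
From mathcomp Require Import all_classical all_reals all_analysis.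
From mathcomp Require Import finmap measurable_realfun.
From mathcomp Require Import ring lra zify.

Set Implicit Arguments.
Unset Strict Implicit.
Unset Printing Implicit Defensive.

Import Order.TTheory GRing.Theory Num.Theory.
Import numFieldNormedType.Exports.

Local Open Scope classical_set_scope.
Local Open Scope ring_scope.

(** * Circle maps and their attracting orbits *)

Section CirclePoints.
Context {R : realType}.
Implicit Types x y : R.
Local Open Scope quotient_scope.

(** What opposes the alternations is a fixed function whose derivative of order k is merely
    continuous: its averages have no rate of decay at a given dilation, only a square-summable total
    of increments along a chain. Square means suffice, because summing over one period tau / q turns
    them into a sup bound on the derivative of order k - 1 with the right power of q. Inner products
    are finite sums on a grid, with increments of the derivative of order k - 1 over the mesh in
    place of the derivative of order k, so that projections are exact and telescoping sums replace
    integrals. The random function is a continuous curve in a parameter t uniform on [0, 1], read by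
    all blocks; tents make the choice of a place continuous in t. Finite cyclicity puts t in the bad
    set of every block from some rank on, and that intersection is no larger than any single bad
    set. The block length 2^((2k+3)j) is dictated by the threshold of badness: up to a factor
    depending on g and k, at most 2^(2(k+1)j) places of block j are bad, a proportion of order
    2^-j. *)

Definition tau : R := pi *+ 2.
Definition cpi x : circle R := \pi_(circle R) x.

Lemma tau_gt0 : 0 < tau.
Proof. by rewrite mulrn_wgt0// pi_gt0. Qed.

Lemma cpiE x y : cpi x = cpi y <-> exists m : int, x = y + m%:~R * tau.
Proof.
have t0 : tau != 0 by rewrite gt_eqF// tau_gt0.
split=> [xy|[m ->]].
  have /intrP[m xym] : congr_2pi x y by apply/eqmodP.
  by exists m; rewrite -xym divfK// addrC subrK.
apply/eqmodP; rewrite /= /congr_2pi addrC addKr mulfK//; apply/intrP; by exists m.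
Qed.

Lemma cpi_shift x (m : int) : cpi (x + m%:~R * tau) = cpi x.
Proof. by apply/cpiE; exists m. Qed.

Lemma cpi_surj (c : circle R) : exists x, c = cpi x.
Proof. by exists (repr c); rewrite /cpi reprK. Qed.

Lemma cpi_rep (c : circle R) x0 : exists x, c = cpi x /\ x0 < x <= x0 + tau.
Proof.
have t0 := tau_gt0.
have [y ->] := cpi_surj c.
pose m := Num.floor ((x0 + tau - y) / tau).
exists (y + m%:~R * tau); rewrite cpi_shift; split=> //.
have h1 : m%:~R <= (x0 + tau - y) / tau by exact: floor_le.
have h2 : (x0 + tau - y) / tau < m%:~R + 1 by rewrite -intrD1; exact: floorD1_gt.
rewrite ler_pdivlMr// in h1; rewrite ltr_pdivrMr// in h2.
apply/andP; split; lra.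
Qed.

Lemma cpi_continuous : continuous cpi.
Proof. exact: pi_continuous. Qed.

Lemma cpi_open (A : set R) : open A -> open (cpi @` A).
Proof.
move=> oA; rewrite /open /= /quotient_open.
have -> : \pi_(circle R) @^-1` (cpi @` A) =
    \bigcup_(m in [set: int]) ((fun x => x + m%:~R * tau) @^-1` A).
  apply/seteqP; split=> [x /= [y Ay /cpiE [m ym]]|x [m _ Am]].
    by exists m => //=; rewrite -ym.
  by exists (x + m%:~R * tau) => //; exact: cpi_shift.
apply: bigcup_open => m _; apply: open_comp => // x _.
by apply: cvgD; [exact: cvg_id|exact: cvg_cst].
Qed.

Lemma nbhs_cpi (A : set (circle R)) x : nbhs (cpi x) A <-> nbhs x (cpi @^-1` A).
Proof.
split; first exact: (@cpi_continuous x).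
rewrite nbhsE => -[B [oB Bx] BA]; rewrite nbhsE.
exists (cpi @` B); first by split; [exact: cpi_open|exists x].
by move=> _ [y By <-]; exact: BA.
Qed.

End CirclePoints.

(** * Lifts of circle maps, rotation numbers and periodic points *)

Section Lifts.
Context {R : realType}.
Implicit Types (x y z : R) (G H : R -> R).
Local Notation tau := (@tau R).

Definition circle_lift G :=
  [/\ continuous G, {homo G : x y / x < y} & forall x, G (x + tau) = G x + tau].

Lemma circle_lift_le G : circle_lift G -> {homo G : x y / x <= y}.
Proof.
by move=> [_ Gh _] x y; rewrite le_eqVlt => /predU1P[->//|/Gh/ltW].
Qed.

Lemma circle_lift_int G x (m : int) : circle_lift G ->
  G (x + m%:~R * tau) = G x + m%:~R * tau.
Proof.
move=> [_ _ Gt].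
have pG : periodic (fun x => G x - x) (pi *+ 2).
  by move=> y; have := Gt y; rewrite /tau => ->; lra.
by have := periodicZ m x pG; rewrite mulrzl -/tau => h; lra.
Qed.

Lemma circle_lift_iter G n : circle_lift G -> circle_lift (iter n G).
Proof.
move=> [Gc Gh Gt]; elim: n => [|n [IHc IHh IHt]].
  by split=> // x; exact: cvg_id.
split=> [x|x y xy|x] /=.
- by apply: continuous_comp; [exact: IHc|exact: Gc].
- by apply: Gh; exact: IHh.
- by rewrite IHt Gt.
Qed.

Lemma circle_lift_add G c : circle_lift G -> circle_lift (fun x => G x + c).
Proof.
move=> [Gc Gh Gt]; split=> [x|x y xy|x].
- by apply: cvgD; [exact: Gc|exact: cvg_cst].
- by rewrite ltrD2r; exact: Gh.
- by rewrite Gt addrAC.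
Qed.

Lemma iter_opp H n x : iter n (fun x => - H (- x)) (- x) = - iter n H x.
Proof. by elim: n => //= n ->; rewrite opprK. Qed.

Lemma iter_lift_add G q (p : int) n x : circle_lift G ->
  iter n (fun x => iter q G x - p%:~R * tau) x =
  iter (n * q) G x - (n%:Z * p)%:~R * tau.
Proof.
move=> lG; elim: n => [|n IH] /=; first by rewrite !mul0r subr0.
rewrite IH mulSn iterD -mulNr -intrN circle_lift_int; last exact: circle_lift_iter.
by rewrite -addrA; congr (_ + _); rewrite intS intrN !intrM intrD; ring.
Qed.

Lemma iter_cpi F G n x : (forall y, F (cpi y) = cpi (G y)) ->
  iter n F (cpi x) = cpi (iter n G x).
Proof. by move=> FG; elim: n => //= n ->. Qed.

(** Along the orbit of [x] the deviation from the uniform rotation is q-periodic in n, hence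
    bounded. With [x] taken in ]0, tau], monotonicity keeps the orbit of 0 within [tau] of that of
    [x]. *)
Lemma periodic_lift_bounded G q (p : int) x : circle_lift G -> (0 < q)%N ->
  iter q G x = x + p%:~R * tau ->
  exists C : R, forall n, `|iter n G 0 - n%:R * (p%:~R / q%:R) * tau| <= C.
Proof.
move=> lG q0 Gx.
wlog /andP[x0 xt] : x Gx / 0 < x <= tau.
  have [x' [/cpiE[m xx'] x'b]] := cpi_rep (cpi x) 0.
  rewrite add0r in x'b; apply => //; last exact: x'b.
  have -> : x' = x + (- m)%:~R * tau by rewrite intrN xx'; ring.
  by rewrite circle_lift_int ?Gx//; [ring|exact: circle_lift_iter].
pose e n := iter n G x - n%:R * (p%:~R / q%:R) * tau.
have eq n : e (q + n)%N = e n.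
  rewrite /e addnC iterD Gx circle_lift_int; last exact: circle_lift_iter.
  by rewrite natrD; field; rewrite pnatr_eq0 -lt0n.
have [C hC] : exists C, forall n, `|e n| <= C.
  exists (\sum_(i < q) `|e i|) => n.
  have -> : e n = e (n %% q)%N.
    rewrite {1}(divn_eq n q); elim: (n %/ q)%N => //= m IH.
    by rewrite mulSn -addnA eq.
  have nq : (n %% q < q)%N by rewrite ltn_mod.
  by rewrite (bigD1 (Ordinal nq))//= lerDl sumr_ge0.
exists (C + tau) => n.
have h1 : iter n G 0 <= iter n G x.
  by apply: circle_lift_le; [exact: circle_lift_iter|exact: ltW].
have h2 : iter n G x <= iter n G 0 + tau.
  have [_ _ <-] := circle_lift_iter n lG.
  by apply: circle_lift_le; [exact: circle_lift_iter|rewrite add0r].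
have := hC n; rewrite /e !ler_norml => /andP[h3 h4]; have := @tau_gt0 R.
move: (_ * _ * _) h3 h4 => w h3 h4 t0; apply/andP; split; lra.
Qed.

Lemma rotation_number_periodic G q (p : int) x : circle_lift G -> (0 < q)%N ->
  iter q G x = x + p%:~R * tau -> rotation_number G = p%:~R / q%:R.
Proof.
move=> lG q0 Gx; have [C hC] := periodic_lift_bounded lG q0 Gx.
have t0 := @tau_gt0 R.
apply: cvg_lim => //; apply/cvgrPdist_le => e e0; near=> n.
have n0 : 0 < n%:R :> R.
  by near: n; apply: nbhs_infty_gtr.
have nC : C / (tau * e) < n%:R by near: n; apply: nbhs_infty_gtr.
rewrite -/tau distrC; move: (hC n); move: (p%:~R / q%:R) => r hn.
have -> : iter n G 0 / (tau * n%:R) - r = (iter n G 0 - n%:R * r * tau) / (tau * n%:R).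
  have fld (t m u : R) : t != 0 -> m != 0 ->
      u / (t * m) - r = (u - m * r * t) / (t * m).
    by move=> t1 m1; field; rewrite t1 m1.
  by rewrite fld// gt_eqF.
rewrite normrM (gtr0_norm (_ : 0 < (tau * n%:R)^-1)) ?invr_gt0 ?mulr_gt0//.
rewrite ler_pdivrMr ?mulr_gt0//; apply: (le_trans hn).
move: nC; rewrite ltr_pdivrMr ?mulr_gt0// => /ltW; lra.
Unshelve. all: by end_near. Qed.

(** If [G] moves [x], monotonicity moves every later iterate further in the same direction, so the
    orbit never returns. *)
Lemma iter_fixed G t x : {homo G : x y / x < y} -> (0 < t)%N ->
  iter t G x = x -> G x = x.
Proof.
move=> Gh t0 Gx.
have up n (xG : x < G x) : x < iter n.+1 G x.
  elim: n => [|n IH]; first exact: xG.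
  by rewrite iterS; apply: (lt_trans xG); exact: Gh.
have dn n (xG : G x < x) : iter n.+1 G x < x.
  elim: n => [|n IH]; first exact: xG.
  by rewrite iterS; apply: (lt_trans _ xG); exact: Gh.
case: t t0 Gx => // t _ Gx.
by case: (ltgtP (G x) x) => // [/(dn t)|/(up t)]; rewrite Gx ltxx.
Qed.

(** The lift advances by m turns in q' steps, so m / q' = p / q, and coprimality gives q' = t q, m =
    t p. The point [x] then has period t under the increasing map G^q - p tau, and is therefore
    fixed by it. *)
Lemma periodic_point_lift F G q (p : int) q' x : circle_lift G ->
  (forall y, F (cpi y) = cpi (G y)) ->
  (0 < q)%N -> coprimez p q -> rotation_number G = p%:~R / q%:R ->
  (0 < q')%N -> iter q' F (cpi x) = cpi x ->
  (q %| q')%N /\ iter q G x = x + p%:~R * tau.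
Proof.
move=> lG FG q0 pq rG q'0; rewrite (iter_cpi _ _ FG) => /cpiE[m Gx].
have := rotation_number_periodic lG q'0 Gx; rewrite rG => /eqP.
rewrite eqr_div ?pnatr_eq0 -?lt0n// !pmulrn -!intrM eqr_int => /eqP e.
have qq' : (q %| q')%N.
  have : (q %| p * q')%Z by rewrite e dvdz_mull.
  by rewrite Gauss_dvdzr// coprimez_sym.
split=> //; have [t q't] := dvdnP qq'.
have mt : m = t%:Z * p.
  apply/eqP; rewrite -(inj_eq (@mulIf _ (q%:Z : int) _)) ?eqz_nat -?lt0n//.
  by rewrite -e q't PoszM; apply/eqP; ring.
have t0 : (0 < t)%N by move: q'0; rewrite q't muln_gt0 => /andP[].
have [_ hh _] := circle_lift_add (- (p%:~R * tau)) (circle_lift_iter q lG).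
have := @iter_fixed (fun x => iter q G x - p%:~R * tau) t x hh t0.
rewrite (iter_lift_add _ _ _ _ lG) -q't Gx -mt addrK => /(_ erefl) h.
by rewrite -[in RHS]h subrK.
Qed.

End Lifts.

(** * Attraction of an orbit as a sign change of the return displacement *)

Section Attraction.
Context {R : realType}.
Implicit Types (x y z c d e s : R) (G H : R -> R) (A : set R).
Local Notation tau := (@tau R).

Lemma nbhs_realP x (P : set R) :
  nbhs x P <-> exists2 e, 0 < e & forall y, `|y - x| < e -> P y.
Proof.
split=> [/nbhs_ballP[e /= e0 eP]|[e e0 eP]].
  by exists e => // y yx; apply: eP; rewrite /ball /= distrC.
by apply/nbhs_ballP; exists e => //= y; rewrite /ball /= distrC; exact: eP.
Qed.

Lemma continuous_realP (g : R -> R) x e : {for x, continuous g} -> 0 < e ->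
  exists2 s, 0 < s & forall y, `|y - x| < s -> `|g y - g x| < e.
Proof.
move=> cg e0; have /nbhs_realP[s s0 sP] : nbhs x (fun y => `|g y - g x| < e).
  have : nbhs (g x) (fun z => `|z - g x| < e) by apply/nbhs_realP; exists e.
  exact: cg.
by exists s.
Qed.

(* What attraction of an orbit says about the lifted return map H fixing x;
   A is the set of all lifts of the points of the orbit.  Stability and
   convergence are tested on the complements of closed arcs missing A. *)
Definition lift_attracting H A x :=
  [/\ forall c d, c <= d < c + tau -> (forall y, c <= y <= d -> ~ A y) ->
        exists2 s, 0 < s & forall z, `|z - x| < s ->
          forall n, ~ (c <= iter n H z <= d),
      exists2 s, 0 < s & forall z, `|z - x| < s ->
        forall c d, c <= d < c + tau -> (forall y, c <= y <= d -> ~ A y) ->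
        exists n, ~ (c <= iter n H z <= d) &
      exists2 s, 0 < s & forall y, 0 < `|y - x| < s -> ~ A y].

(** Conjugation by the reflection x -> -x, so that only the right-hand side of a fixed point has to
    be studied. *)
Lemma lift_attracting_opp H A x : lift_attracting H A x ->
  lift_attracting (fun y => - H (- y)) [set y | A (- y)] (- x).
Proof.
have nn y z : `|- y - z| = `|y - - z| by rewrite opprK -opprD normrN.
have it n z : iter n (fun y => - H (- y)) z = - iter n H (- z).
  by rewrite -iter_opp opprK.
have arc c d : c <= d < c + tau -> - d <= - c < - d + tau by lra.
have flip c y d : (c <= y <= d) = (- d <= - y <= - c).
  by rewrite !lerN2 andbC.
move=> [stab [s s0 sP] [e e0 eP]]; split.
- move=> c d /arc cd Acd; have [|s' s'0 s'P] := stab _ _ cd.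
    by move=> y; rewrite flip !opprK => /Acd; rewrite /= opprK.
  exists s' => // z zx n; rewrite it flip opprK; apply: s'P.
  by rewrite nn.
- exists s => // z zx c d /arc cd Acd.
  have [||n nP] := sP (- z) _ _ _ cd; first by rewrite nn.
    by move=> y; rewrite flip !opprK => /Acd; rewrite /= opprK.
  by exists n; rewrite it flip opprK.
- by exists e => // y yx; apply: eP; rewrite nn.
Qed.

(* A monotone return map cannot jump over the arc from c to H c. *)
Lemma lift_attracting_right H A x e : {homo H : y z / y < z} -> continuous H ->
  H x = x -> lift_attracting H A x -> 0 < e ->
  exists z, x < z < x + e /\ H z < z.
Proof.
move=> Hh Hc Hx [stab [s s0 sP] [e1 e10 e1P]] e0.
have t0 := @tau_gt0 R.
pose e' := Order.min e (Order.min e1 tau).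
have e'0 : 0 < e' by rewrite !lt_min e0 e10 t0.
have [e'e e'1 e't] : [/\ e' <= e, e' <= e1 & e' <= tau].
  by split; rewrite ?/e' !ge_min lexx ?orbT.
apply: contrapT => nex.
have Hge z : x < z < x + e' -> z <= H z.
  move=> /andP[xz ze]; rewrite leNgt; apply/negP => Hz; apply: nex.
  by exists z; rewrite xz Hz (lt_le_trans ze)// lerD2l.
have nA y : x < y < x + e' -> ~ A y.
  move=> /andP[xy ye]; apply: e1P; rewrite gtr0_norm ?subr_gt0//.
  by rewrite xy ltrBlDl (lt_le_trans ye)// lerD2l.
have [u u0 uP] := continuous_realP (Hc x) e'0.
pose c := x + Order.min u e' / 2.
have mu : 0 < Order.min u e' by rewrite lt_min u0.
have [mu1 mu2] : Order.min u e' <= u /\ Order.min u e' <= e'.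
  by split; rewrite ge_min lexx ?orbT.
have xc : x < c by rewrite /c; lra.
have ce : c < x + e' by rewrite /c; lra.
have Hce : H c < x + e'.
  have : `|c - x| < u by rewrite gtr0_norm /c; lra.
  by move=> /uP; rewrite Hx ltr_norml => /andP[_]; rewrite ltrBlDl.
have cHc : c <= H c by apply: Hge; rewrite xc.
have [||v v0 vP] := stab c (H c).
- by rewrite cHc; lra.
- by move=> y /andP[cy yH]; apply: nA; lra.
pose z := x + Order.min (Order.min v s) (c - x) / 2.
have mv : 0 < Order.min (Order.min v s) (c - x) by rewrite !lt_min v0 s0 subr_gt0.
have [mv1 mv2 mv3] : [/\ Order.min (Order.min v s) (c - x) <= v,
    Order.min (Order.min v s) (c - x) <= s &
    Order.min (Order.min v s) (c - x) <= c - x].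
  by split; rewrite ?/e' !ge_min lexx ?orbT.
have xz : x < z by rewrite /z; lra.
have zc : z < c by rewrite /z; lra.
have zx : `|z - x| = z - x by rewrite gtr0_norm// subr_gt0.
(* An orbit started below [c] cannot reach [c] without landing in the arc from [c] to [H c], which
   stability forbids. It is thus trapped in the arc from [z] to [c], and this contradicts
   convergence. *)
have inv n : z <= iter n H z < c.
  elim: n => [|n /andP[IH1 IH2]]; first by rewrite lexx.
  have h1 : iter n H z <= H (iter n H z) by apply: Hge; lra.
  rewrite iterS (le_trans IH1 h1)/= ltNge; apply/negP => h2.
  apply: (vP z _ n.+1); first by rewrite zx /z; lra.
  by rewrite iterS h2/= ltW// Hh.
have [|||n] := sP z _ z c; first by rewrite zx /z; lra.
- by rewrite ltW//=; lra.
- by move=> y /andP[zy yc]; apply: nA; lra.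
by apply; have /andP[-> /ltW] := inv n.
Qed.

Lemma lift_attracting_sign H A x e : {homo H : y z / y < z} -> continuous H ->
  H x = x -> lift_attracting H A x -> 0 < e ->
  exists y z, [/\ x - e < y, y < x, x < z, z < x + e & y < H y /\ H z < z].
Proof.
move=> Hh Hc Hx aH e0.
have [z [/andP[xz ze] Hz]] := lift_attracting_right Hh Hc Hx aH e0.
have Hh' : {homo (fun y => - H (- y)) : y z / y < z}.
  by move=> y w yw; rewrite ltrN2 Hh// ltrN2.
have Hc' : continuous (fun y => - H (- y)).
  move=> y; apply: cvgN; apply: (@continuous_comp _ _ _ (fun x => - x) H).
    exact: opp_continuous.
  exact: Hc.
have Hx' : - H (- - x) = - x by rewrite opprK Hx.
have [y [/andP[xy ye] Hy]] :=
  lift_attracting_right Hh' Hc' Hx' (lift_attracting_opp aH) e0.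
by exists (- y), z; split => //; lra.
Qed.

Lemma int_tau_small (m : int) : 0 < m%:~R * tau < tau -> False.
Proof.
have t0 := @tau_gt0 R.
rewrite pmulr_lgt0// -{2}[tau]mul1r ltr_pM2r// ltr0z ltrz1; lia.
Qed.

(** The orbit increases and stays below the fixed point. If it stayed below [x - s], the positive
    minimum of H z - z on [y, x - s] would make it grow at least linearly. *)
Lemma iter_cvg_left H x e y : {homo H : y z / y < z} -> continuous H ->
  H x = x -> (forall y, x - e < y < x -> y < H y) -> x - e < y < x ->
  (forall n, y <= iter n H y < x) /\
  (forall s, 0 < s -> exists n, x - s < iter n H y).
Proof.
move=> Hh Hc Hx Hgt /andP[ey yx].
have inv n : y <= iter n H y < x.
  elim: n => [|n /andP[IH1 IH2]]; first by rewrite lexx.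
  rewrite iterS (le_trans IH1)/=; last by rewrite ltW// Hgt// IH2 (lt_le_trans ey).
  by rewrite -[ltRHS]Hx Hh.
split=> // s s0; apply: contrapT => nex.
have low n : iter n H y <= x - s.
  by rewrite leNgt; apply/negP => h; apply: nex; exists n.
have yxs : y <= x - s := low 0%N.
have cD : {within `[y, x - s], continuous (fun z => H z - z)}.
  by apply: continuous_subspaceT => z; apply: cvgB; [exact: Hc|exact: cvg_id].
have [c] := EVT_min yxs cD.
rewrite in_itv/= => /andP[yc cx] cmin.
have d0 : 0 < H c - c by rewrite subr_gt0 Hgt//; apply/andP; split; lra.
have grow n : y + n%:R * (H c - c) <= iter n H y.
  elim: n => [|n IH]; first by rewrite mul0r addr0.
  have /andP[h1 _] := inv n.
  have := cmin (iter n H y); rewrite in_itv/= h1 low => /(_ isT) h2.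
  rewrite -natr1; move: IH h2; lra.
have [n /= hn] : exists n, (x - y) / (H c - c) < n%:R.
  by exists (Num.bound ((x - y) / (H c - c))); rewrite archi_boundP// divr_ge0//; lra.
rewrite ltr_pdivrMr// in hn.
have := grow n; have /andP[_] := inv n; lra.
Qed.

Lemma iter_cvg_sign H x e y : {homo H : y z / y < z} -> continuous H ->
  H x = x -> (forall y, x - e < y < x -> y < H y) ->
  (forall y, x < y < x + e -> H y < y) -> `|y - x| < e ->
  (forall n, `|iter n H y - x| <= `|y - x|) /\
  (forall s, 0 < s -> exists n, `|iter n H y - x| < s).
Proof.
move=> Hh Hc Hx Hgt Hlt; rewrite ltr_norml => /andP[ey ye].
case: (ltgtP y x) => [yx|xy|->].
- have [|inv low] := iter_cvg_left (y := y) Hh Hc Hx Hgt; first by lra.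
  split=> [n|s s0].
    by have /andP[h1 h2] := inv n; rewrite !ltr0_norm ?subr_lt0//; lra.
  have [n hn] := low s s0; exists n.
  by have /andP[h1 h2] := inv n; rewrite ltr0_norm ?subr_lt0//; lra.
- have Hh' : {homo (fun y => - H (- y)) : y z / y < z}.
    by move=> z w zw; rewrite ltrN2 Hh// ltrN2.
  have Hc' : continuous (fun y => - H (- y)).
    move=> z; apply: cvgN; apply: (@continuous_comp _ _ _ (fun x => - x) H).
      exact: opp_continuous.
    exact: Hc.
  have Hx' : - H (- - x) = - x by rewrite opprK Hx.
  have [||inv low] := iter_cvg_left (x := - x) (e := e) (y := - y) Hh' Hc' Hx'.
  + by move=> z zx; rewrite ltrNr; apply: Hlt; lra.
  + by lra.
  split=> [n|s s0].
    have /andP[] := inv n; rewrite iter_opp lerN2 ltrN2 => h1 h2.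
    by rewrite !gtr0_norm ?subr_gt0//; lra.
  have [n] := low s s0; rewrite iter_opp => hn; exists n.
  have /andP[] := inv n; rewrite iter_opp lerN2 ltrN2 => h1 h2.
  by rewrite gtr0_norm ?subr_gt0//; lra.
- have it n : iter n H x = x by elim: n => //= n ->.
  by split=> [n|s s0]; [|exists 0%N]; rewrite ?it subrr normr0.
Qed.

Section Orbit.
Variables (F : circle R -> circle R) (G : R -> R) (q : nat) (p : int) (x : R).
Hypothesis lG : circle_lift G.
Hypothesis FG : forall y, F (cpi y) = cpi (G y).
Hypothesis q0 : (0 < q)%N.
Let H y := iter q G y - p%:~R * tau.
Hypothesis Hx : H x = x.

Let lH : circle_lift H.
Proof. exact/circle_lift_add/circle_lift_iter. Qed.

Let iterH n z : cpi (iter n H z) = iter (n * q) F (cpi z).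
Proof. by rewrite iter_lift_add// -mulNr -intrN cpi_shift (iter_cpi _ _ FG). Qed.

Let iterFx : iter q F (cpi x) = cpi x.
Proof. by have := iterH 1 x; rewrite mul1n /= Hx => <-. Qed.

Let orbit_mod n : iter n F (cpi x) = cpi (iter (n %% q) G x).
Proof.
rewrite -(iter_cpi _ _ FG) [in LHS](divn_eq n q) addnC iterD; congr iter.
by elim: (n %/ q)%N => //= m IH; rewrite mulSn iterD IH iterFx.
Qed.

(** On the circle the complement of the closed arc from [c] to [d] is the image of the open interval
    ]d - tau, c[. *)
Let arc_nbhs c d : c <= d < c + tau ->
  (forall y, c <= y <= d -> ~ trajectory F (cpi x) (cpi y)) ->
  set_nbhs (trajectory F (cpi x)) (cpi @` `]d - tau, c[).
Proof.
move=> /andP[cd dc] nO o oO.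
apply: open_nbhs_nbhs; split; first by apply: cpi_open; exact: interval_open.
have [u [ou /andP[u1 u2]]] := cpi_rep o (d - tau).
exists u => //=; rewrite in_itv/= u1 /= ltNge; apply/negP => cu.
by apply: (nO u); rewrite ?cu -?ou//; lra.
Qed.

Let arc_notin c d y : c <= y <= d -> d < c + tau ->
  ~ (cpi @` `]d - tau, c[) (cpi y).
Proof.
move=> /andP[cy yd] dc [u /=]; rewrite in_itv/= => /andP[u1 u2] /esym/cpiE[m ym].
by apply: (@int_tau_small m); lra.
Qed.

Lemma attracting_lift : attracting F (trajectory F (cpi x)) ->
  lift_attracting H (cpi @^-1` trajectory F (cpi x)) x.
Proof.
have xO : trajectory F (cpi x) (cpi x) by exists 0%N.
move=> [stab [W OW WP]]; split.
- move=> c d cd nO; have [V OV VP] := stab _ (arc_nbhs cd nO).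
  have /nbhs_cpi/nbhs_realP[s s0 sP] := OV _ xO.
  exists s => // z zx n cnd; have /andP[_ dc] := cd.
  apply: (arc_notin cnd dc); rewrite iterH; apply: VP; exact: sP.
- have /nbhs_cpi/nbhs_realP[s s0 sP] := OW _ xO.
  exists s => // z zx c d cd nO; have [n _ nP] := WP _ (sP _ zx) _ (arc_nbhs cd nO).
  exists n => cnd; have /andP[_ dc] := cd.
  by apply: (arc_notin cnd dc); rewrite iterH; apply: nP => /=; rewrite leq_pmulr.
(* The orbit has at most q points, each lifted to some [u] in ]x, x + tau]. The end u = x + tau is
   the class of [x] itself, which explains the case distinction in [s]. *)
- have isol (i : 'I_q) : \forall y \near x^', cpi y <> iter i F (cpi x).
    have t0 := @tau_gt0 R.
    have [u [-> /andP[xu ux]]] := cpi_rep (iter i F (cpi x)) x.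
    pose s := Order.min (u - x) (Order.min tau (if u == x + tau then tau else x + tau - u)).
    have s0 : 0 < s.
      by rewrite !lt_min subr_gt0 xu t0/=; case: eqVneq => // ne;
      rewrite subr_gt0 lt_neqAle ne.
    apply/nbhs_realP; exists s => // y; rewrite !lt_min => /and3P[h1 h2 h3] yx /cpiE[m ym].
    case: eqVneq h3 => [ue _|ne h3].
      have [xy|xy] := ltP x y.
        rewrite gtr0_norm ?subr_gt0// in h1.
        by apply: (@int_tau_small (- m)); rewrite intrN; lra.
      have xy' : y < x by rewrite lt_neqAle yx.
      rewrite ltr0_norm ?subr_lt0// in h2.
      by apply: (@int_tau_small (- m - 1)); rewrite intrB intrN; lra.
    have [xy|xy] := ltP x y.
      rewrite gtr0_norm ?subr_gt0// in h1.
      by apply: (@int_tau_small (- m)); rewrite intrN; lra.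
    have ux' : u < x + tau by rewrite lt_neqAle ne.
    rewrite ler0_norm ?subr_le0// in h3.
    by apply: (@int_tau_small (- m)); rewrite intrN; lra.
  have : \forall y \near x^', forall i : 'I_q, cpi y <> iter i F (cpi x).
    by apply: filter_forall.
  move=> /nbhs_realP[s s0 sP].
  exists s => // y /andP[y0 ys] [n _].
  have nq : (n %% q < q)%N by rewrite ltn_mod.
  rewrite orbit_mod -(iter_cpi _ _ FG) => /esym.
  apply: (sP _ ys _ (Ordinal nq)).
  by rewrite -subr_eq0 -normr_gt0.
Qed.

Let F_continuous : continuous F.
Proof.
have [cG _ _] := lG.
move=> c; have [y ->] := cpi_surj c; move=> B; rewrite FG => /nbhs_cpi BG.
apply/nbhs_cpi; rewrite /= in BG *.
have -> : cpi @^-1` (F @^-1` B) = G @^-1` (cpi @^-1` B).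
  by apply/seteqP; split=> z /=; rewrite FG.
exact: cG.
Qed.

Let iterF_continuous n : continuous (iter n F).
Proof.
elim: n => [|n IH] c; first exact: cvg_id.
by apply: (@continuous_comp _ _ _ (iter n F) F); [exact: IH|exact: F_continuous].
Qed.

Let orbit_nbhs (P : set (circle R)) o : trajectory F (cpi x) o ->
  nbhs (cpi x) P -> exists2 j, iter j F o = cpi x & nbhs o (iter j F @^-1` P).
Proof.
move=> [n _ <-] nP.
have e : iter (n * q.-1) F (iter n F (cpi x)) = cpi x.
  rewrite -iterD -mulnSr prednK// orbit_mod modnMl.
  by rewrite /=.
exists (n * q.-1)%N => //.
by apply: iterF_continuous; rewrite e.
Qed.

(** Near [x] the return map never increases the distance to [x] and brings it below any bound.
    Stability and convergence follow near [cpi x], and are carried to another point of the orbit by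
    the continuous iterate that sends it to [cpi x]. *)
Lemma sign_attracting e : 0 < e ->
  (forall y, x - e < y < x -> y < H y) -> (forall y, x < y < x + e -> H y < y) ->
  attracting F (trajectory F (cpi x)).
Proof.
move=> e0 Hgt Hlt; have [Hc Hh _] := lH.
have conv y (yx : `|y - x| < e) := iter_cvg_sign Hh Hc Hx Hgt Hlt yx.
pose B U := [set c | forall n, U (iter n F c) : Prop].
have Bx U : set_nbhs (trajectory F (cpi x)) U -> nbhs (cpi x) (B U).
  move=> OU; have Ui (i : 'I_q) : \forall y \near x, U (cpi (iter i G y)).
    have Oi : trajectory F (cpi x) (cpi (iter i G x)).
      by exists (i : nat) => //; rewrite (iter_cpi _ _ FG).
    have /nbhs_cpi Ui := OU _ Oi.
    by have [ciG _ _] := circle_lift_iter i lG; exact: (ciG x _ Ui).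
  have : \forall y \near x, forall i : 'I_q, U (cpi (iter i G y)).
    exact: (@filter_forall _ _ (fun i : 'I_q => [set y | U (cpi (iter i G y))]) _ _ Ui).
  move=> /nbhs_realP[s s0 sP]; apply/nbhs_cpi/nbhs_realP.
  exists (Order.min s e); first by rewrite lt_min s0.
  move=> y; rewrite lt_min => /andP[ys ye] n /=.
  have nq : (n %% q < q)%N by rewrite ltn_mod.
  rewrite (divn_eq n q) addnC iterD -iterH (iter_cpi _ _ FG).
  apply: (sP _ _ (Ordinal nq)); have [h _] := conv _ ye.
  exact: le_lt_trans (h _) ys.
split=> [U OU|].
  exists (B U); last by move=> n y; apply.
  move=> o Oo.
  have [j jo nB] := orbit_nbhs Oo (Bx _ OU).
  have nU i : nbhs o (iter i F @^-1` U).
    apply: iterF_continuous; have Oi : trajectory F (cpi x) (iter i F o).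
      by case: Oo => n _ <-; exists (i + n)%N => //; rewrite iterD.
    exact: OU Oi.
  have nUj (i : 'I_j) : \forall c \near o, U (iter i F c) by exact: nU.
  have : \forall c \near o, forall i : 'I_j, U (iter i F c).
    exact: (@filter_forall _ _ (fun i : 'I_j => [set c | U (iter i F c)]) _ _ nUj).
  move=> near_j; apply: filterS2 nB near_j => c Bc Uc n.
  have [nj|jn] := ltnP n j; first exact: (Uc (Ordinal nj)).
  by rewrite -(subnK jn) iterD; exact: Bc.
pose W := [set c | forall U, set_nbhs (trajectory F (cpi x)) U ->
      \forall n \near \oo, U (iter n F c)].
have Wx : nbhs (cpi x) W.
  apply/nbhs_cpi/nbhs_realP; exists e => // y ye U OU.
  have /nbhs_cpi/nbhs_realP[s s0 sP] := Bx _ OU.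
  have [_ /(_ s s0) [m /sP]] := conv _ ye.
  rewrite /= iterH => Bm; exists (m * q)%N => // n /= mn.
  by rewrite -(subnK mn) iterD; exact: Bm.
exists W => // o Oo; have [j jo nB] := orbit_nbhs Oo Wx.
apply: filterS nB => c /= Wc U /Wc[N _ NP]; exists (N + j)%N => // n /= Nn.
have jn : (j <= n)%N := leq_trans (leq_addl _ _) Nn.
by rewrite -(subnK jn) iterD; apply: NP; rewrite /= leq_subRL// addnC.
Qed.

End Orbit.
End Attraction.

(** * Counting attracting orbits by sign alternations *)

Section Calculus.
Context {R : realType}.
Implicit Types (x y z w e K r : R) (u du : R -> R).
Local Notation tau := (@tau R).

Lemma MVT_abs u du x y : (forall z, is_derive z 1 u (du z)) ->
  exists c, `|c - x| <= `|y - x| /\ u y - u x = du c * (y - x).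
Proof.
move=> uD.
have cu : continuous u.
  by move=> z; apply/differentiable_continuous/derivable1_diffP.
have key a b : a <= b -> exists c, a <= c <= b /\ u b - u a = du c * (b - a).
  move=> ab.
  have [c] := MVT_segment ab (fun z _ => uD z) (continuous_subspaceT cu).
  by rewrite in_itv/= => cab ->; exists c.
have [xy|yx] := leP x y.
  have [c [/andP[h1 h2] e]] := key _ _ xy; exists c; split=> //.
  by rewrite !ger0_norm ?subr_ge0//; lra.
have [c [/andP[h1 h2] e]] := key _ _ (ltW yx); exists c; split.
  by rewrite !ler0_norm ?subr_le0 ?(ltW yx)//; lra.
by rewrite -opprB e; ring.
Qed.

Lemma lipschitz_derive u du K x y : (forall z, is_derive z 1 u (du z)) ->
  (forall z, `|du z| <= K) -> `|u y - u x| <= K * `|y - x|.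
Proof.
move=> uD duK; have [c [_ ->]] := MVT_abs x y uD.
by rewrite normrM ler_wpM2r.
Qed.

Lemma taylor_bound u du K x y : (forall z, is_derive z 1 u (du z)) ->
  (forall z w, `|du z - du w| <= K * `|z - w|) ->
  `|u y - u x - du x * (y - x)| <= K * `|y - x| ^+ 2.
Proof.
move=> uD duK; have [c [cx ->]] := MVT_abs x y uD.
have K0 : 0 <= K by have := duK 1 0; rewrite subr0 normr1 mulr1; exact: le_trans.
rewrite -mulrBl normrM expr2 mulrA ler_wpM2r//; apply: (le_trans (duK _ _)).
exact: ler_wpM2l.
Qed.

(* Sard's lemma in one dimension, by the pigeonhole principle: among n + 2
   values of the parameter, two would have a critical zero in the same arc of
   length tau / n. *)
Lemma regular_parameter (u : R -> R -> R) (K r0 h : R) : 0 <= K -> 0 < h ->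
  (forall r x, u r (x + tau) = u r x) ->
  (forall r r' x, r <= r' -> u r x + tau * (r' - r) <= u r' x) ->
  exists2 r, r0 < r < r0 + h &
    forall x, u r x = 0 -> exists y, K * `|y - x| ^+ 2 < `|u r y|.
Proof.
move=> K0 h0 ut umono; apply: contrapT => nreg.
have t0 := @tau_gt0 R.
have crit r : r0 < r < r0 + h -> exists x,
    [/\ 0 < x <= tau, u r x = 0 & forall y, `|u r y| <= K * `|y - x| ^+ 2].
  move=> rr; apply: contrapT => nx; apply: nreg; exists r => // x ux.
  apply: contrapT => ny; apply: nx.
  have uint (m : int) y : u r (y + m%:~R * tau) = u r y.
    have pu : periodic (u r) (pi *+ 2) by move=> z; exact: ut.
    by have := periodicZ m y pu; rewrite mulrzl.
  have [x' [/cpiE[m xx'] x'b]] := cpi_rep (cpi x) 0; rewrite add0r in x'b.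
  exists x'; split=> //; first by rewrite -ux xx' uint.
  move=> y; rewrite leNgt; apply/negP => hy; apply: ny.
  exists (y + m%:~R * tau); rewrite uint.
  by have -> : y + m%:~R * tau - x = y - x' by rewrite xx'; ring.
pose n := (Num.bound (4 * K * tau / h)).+1.
have nK : 4 * K * tau < n%:R * h.
  rewrite -ltr_pdivrMr//; apply: lt_trans (archi_boundP _) _.
    by rewrite divr_ge0 ?mulr_ge0// ltW.
  by rewrite ltr_nat.
have n1 : 1 <= n%:R :> R by rewrite ler1n.
pose rr (i : 'I_n.+2) := r0 + h * i.+1%:R / n.+3%:R.
have n30 : 0 < n.+3%:R :> R by rewrite ltr0n.
have rrb i : r0 < rr i < r0 + h.
  rewrite /rr ltrDl divr_gt0 ?mulr_gt0 ?ltr0n//= ltrD2l ltr_pdivrMr//.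
  by rewrite ltr_pM2l// ltr_nat ltnS.
have [X XP] := choice (fun i => crit _ (rrb i)).
have pieceP i : (Num.truncn (X i * n%:R / tau) < n.+1)%N.
  have [/andP[x0 xt] _ _] := XP i.
  rewrite ltnS truncn_le_nat; apply: (@le_lt_trans _ _ n%:R); last by rewrite ltr_nat.
  by rewrite ler_pdivrMr// mulrC ler_pM2l// ltr0n.
pose piece i := Ordinal (pieceP i).
have /injectivePn[i [j ij pij]] : ~~ injectiveb piece.
  by apply/negP => /injectiveP/leq_card; rewrite !card_ord ltnn.
wlog lij : i j ij pij / (i < j)%N.
  move=> W; case: (ltngtP i j) => [lij|lji|/val_inj eij].
  - exact: (W i j).
  - by apply: (W j i); rewrite 1?eq_sym.
  - by rewrite eij eqxx in ij.
have [/andP[xi0 xit] ui uiK] := XP i; have [/andP[xj0 xjt] uj _] := XP j.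
have close : `|X j - X i| <= tau / n%:R.
  have n0 : 0 < n%:R :> R by rewrite ltr0n.
  have fl k : (piece k)%:R <= X k * n%:R / tau < (piece k)%:R + 1.
    rewrite /piece /= natr1; apply: truncn_itv.
    by have [/andP[? _] _ _] := XP k; rewrite divr_ge0 ?mulr_ge0// ltW.
  have /andP[h1 h2] := fl i; have /andP[h3 h4] := fl j.
  rewrite pij in h1 h2.
  have : `|X j * n%:R / tau - X i * n%:R / tau| <= 1.
    by rewrite ler_norml; apply/andP; split; lra.
  rewrite -!mulrA -mulrBl normrM [X in _ * X]gtr0_norm ?divr_gt0//.
  by rewrite -ler_pdivlMr ?divr_gt0// mul1r invf_div.
have rij : h / n.+3%:R <= rr j - rr i.
  rewrite /rr opprD addrACA subrr add0r -mulrBl -mulrBr ler_pM2r ?invr_gt0//.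
  rewrite -[leLHS]mulr1 ler_pM2l// -natrB; last by rewrite ltnS ltnW.
  by rewrite ler1n subn_gt0 ltnS.
have rle : rr i <= rr j by rewrite -subr_ge0 (le_trans _ rij)// divr_ge0// ltW.
have h1 : tau * (rr j - rr i) <= K * (tau / n%:R) ^+ 2.
  have := umono _ _ (X j) rle; rewrite uj => h1.
  have h2 : tau * (rr j - rr i) <= `|u (rr i) (X j)|.
    by rewrite -normrN; apply: le_trans (ler_norm _); lra.
  apply: (le_trans h2); apply: (le_trans (uiK _)).
  by rewrite ler_wpM2l// lerXn2r ?nnegrE// divr_ge0// ltW.
have h2 : tau * (h / n.+3%:R) <= K * (tau / n%:R) ^+ 2.
  by apply: le_trans h1; rewrite ler_pM2l.
have n0 : 0 < n%:R :> R by rewrite ltr0n.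
have h3 : h * n%:R ^+ 2 <= K * tau * n.+3%:R.
  move: h2; rewrite mulrA ler_pdivrMr// expr_div_n mulrA mulrAC ler_pdivlMr ?exprn_gt0//.
  rewrite -[in X in _ -> X](ler_pM2l t0) => h2; apply: le_trans (le_trans h2 _); nra.
have : n.+3%:R <= 4 * n%:R :> R.
  by rewrite -[n.+3]addn3 natrD; lra.
have Kt : 0 <= K * tau by rewrite mulr_ge0// ltW.
move=> h4; have h5 := ler_wpM2l Kt h4.
have : h * n%:R * n%:R <= (4 * K * tau) * n%:R by rewrite -mulrA -expr2; lra.
rewrite ler_pM2r// => h6; lra.
Qed.

(** The zero is the supremum [w] of the points of [y, z] where u >= 0. As u < 0 just after it, the
    nonzero slope at [w] is negative; within |du w| / (K + 1) of [w] the linear term dominates the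
    Taylor remainder, which settles the sign on both sides. *)
Lemma nondegenerate_crossing u du K y z : (forall x, is_derive x 1 u (du x)) ->
  (forall x w, `|du x - du w| <= K * `|x - w|) ->
  (forall x, u x = 0 -> du x != 0) -> y < z -> 0 < u y -> u z < 0 ->
  exists w e, [/\ y < w, w < z, 0 < e, u w = 0 &
    (forall x, w - e < x < w -> 0 < u x) /\
    (forall x, w < x < w + e -> u x < 0)].
Proof.
move=> uD duK nd yz uy uz.
have cu : continuous u.
  by move=> x; apply/differentiable_continuous/derivable1_diffP.
pose S := [set x | y <= x <= z /\ 0 <= u x].
have Sy : S y by rewrite /S /= lexx !ltW.
have supS : has_sup S.
  by split; [exists y|exists z => x [/andP[_]]].
pose w := sup S.
have yw : y <= w by apply: ub_le_sup => //; case: supS.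
have wz : w <= z by apply: ge_sup; [exists y|move=> x [/andP[_]]].
have after x : w < x <= z -> u x < 0.
  move=> /andP[wx xz]; rewrite ltNge; apply/negP => ux.
  have : x <= w.
    by apply: ub_le_sup; [case: supS|split=> //; rewrite xz andbT (le_trans yw)// ltW].
  by rewrite leNgt wx.
have uw0 : u w = 0.
  case: (ltgtP (u w) 0) => // uw.
    have nuw : 0 < - u w by rewrite oppr_gt0.
    have [s s0 sP] := continuous_realP (cu w) nuw.
    have [x [/andP[yx xz] ux] xs] := sup_adherent s0 supS.
    have xw : x <= w.
      by apply: ub_le_sup; [case: supS|split=> //; rewrite yx].
    rewrite -/w in xs.
    have /sP : `|x - w| < s by rewrite ler0_norm ?subr_le0//; lra.
    by rewrite ltr_norml => /andP[_ h]; lra.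
  have wlz : w < z by rewrite lt_neqAle wz andbT; apply/eqP => wz'; rewrite wz' in uw; lra.
  have [s s0 sP] := continuous_realP (cu w) uw.
  pose x := w + Order.min s (z - w) / 2.
  have m0 : 0 < Order.min s (z - w) by rewrite lt_min s0 subr_gt0.
  have [m1 m2] : Order.min s (z - w) <= s /\ Order.min s (z - w) <= z - w.
    by split; rewrite ge_min lexx ?orbT.
  have ux : u x < 0 by apply: after; rewrite /x; lra.
  have /sP : `|x - w| < s by rewrite gtr0_norm /x; lra.
  by rewrite ltr_norml => /andP[h _]; lra.
have d0 := nd _ uw0.
have T x : `|u x - du w * (x - w)| <= K * `|x - w| ^+ 2.
  by have := taylor_bound w x uD duK; rewrite uw0 subr0.
have ylw : y < w by rewrite lt_neqAle yw andbT; apply/eqP => yw'; rewrite yw' in uy; lra.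
have wlz : w < z by rewrite lt_neqAle wz andbT; apply/eqP => wz'; rewrite wz' in uw0; lra.
have K0 : 0 <= K by have := duK 1 0; rewrite subr0 normr1 mulr1; exact: le_trans.
pose e := `|du w| / (K + 1).
have e0 : 0 < e by rewrite divr_gt0 ?normr_gt0//; lra.
have sgn x : 0 < `|x - w| < e -> `|u x - du w * (x - w)| < `|du w * (x - w)|.
  move=> /andP[x0 xe]; apply: (le_lt_trans (T x)).
  rewrite normrM expr2 mulrA ltr_pM2r//.
  rewrite /e ltr_pdivlMr in xe; last by lra.
  by apply: le_lt_trans xe; nra.
have dneg : du w < 0.
  rewrite ltNge; apply/negP => dge.
  have dgt : 0 < du w by rewrite lt_neqAle eq_sym d0.
  pose x := w + Order.min e (z - w) / 2.
  have m0 : 0 < Order.min e (z - w) by rewrite lt_min e0 subr_gt0.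
  have [m1 m2] : Order.min e (z - w) <= e /\ Order.min e (z - w) <= z - w.
    by split; rewrite ge_min lexx ?orbT.
  have ux : u x < 0 by apply: after; rewrite /x; lra.
  have xw : 0 < x - w by rewrite /x; lra.
  have /sgn : 0 < `|x - w| < e by rewrite gtr0_norm// xw /x/=; lra.
  rewrite (gtr0_norm (_ : 0 < du w * (x - w))) ?mulr_gt0// ltr_norml => /andP[h1 _].
  lra.
exists w, e; split=> //; split=> x /andP[h1 h2].
  have xw : x - w < 0 by rewrite subr_lt0.
  have /sgn : 0 < `|x - w| < e by rewrite ltr0_norm//; lra.
  rewrite (gtr0_norm (_ : 0 < du w * (x - w))) ?nmulr_rgt0// ltr_norml => /andP[h3 _].
  lra.
have xw : 0 < x - w by rewrite subr_gt0.
have /sgn : 0 < `|x - w| < e by rewrite gtr0_norm// xw; lra.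
rewrite (ltr0_norm (_ : du w * (x - w) < 0)) ?nmulr_rlt0// ltr_norml => /andP[_ h3].
lra.
Qed.

End Calculus.

Section Counting.
Context {R : realType}.

Lemma counting_geP (T : choiceType) (A : set T) (m : nat) :
  ((m%:R)%:E <= counting A :> \bar R)%E <->
  exists O : 'I_m -> T, injective O /\ forall i, A (O i).
Proof.
split=> [mA|[F [Finj FA]]].
  have [B BA mB] : exists2 B : {fset T}, [set` B] `<=` A & (m <= #|` B|)%N.
    move: mA; rewrite /counting; case: asboolP => [finA|infA _].
      rewrite lee_fin ler_nat => mA; exists (fset_set A) => //.
      by rewrite fset_setK.
    exact: infinite_set_fset.
  have mB' : (m <= #|{: B}|)%N by rewrite -cardfE.
  exists (fun i => fsval (enum_val (widen_ord mB' i))); split.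
    move=> i j /val_inj/enum_val_inj ij; apply: val_inj.
    exact: (congr1 val ij).
  by move=> i; apply: BA; exact: (valP (enum_val (widen_ord mB' i))).
rewrite /counting; case: asboolP => [finA|_]; last exact: leey.
rewrite lee_fin ler_nat.
have FS i : F i \in fset_set A by rewrite in_fset_set//; apply/mem_set; exact: FA.
have /leq_card : injective (fun i => [` FS i]%fset).
  by move=> i j ij; apply: Finj; exact: (congr1 val ij).
by rewrite card_ord cardfE.
Qed.

End Counting.

Section PeriodicTrajectory.
Context {T : topologicalType}.
Implicit Types (g : T -> T) (x y : T).

Lemma iter_periodic g q x n : iter q g x = x -> iter n g x = iter (n %% q) g x.
Proof.
move=> gx; rewrite [in LHS](divn_eq n q) addnC iterD; congr iter.
by elim: (n %/ q)%N => //= m IH; rewrite mulSn iterD IH.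
Qed.

Lemma trajectory_eq g q x y : (0 < q)%N -> iter q g x = x ->
  trajectory g x y -> trajectory g y = trajectory g x.
Proof.
move=> q0 gx [n _ <-]; apply/seteqP; split=> _ [m _ <-].
  by exists (m + n)%N => //; rewrite iterD.
exists (m + n * q.-1)%N => //; rewrite -iterD -addnA -mulnSr prednK//.
by rewrite iterD; congr iter; rewrite (iter_periodic _ gx) modnMl.
Qed.

End PeriodicTrajectory.

(** * The family F_(r,a): dependence on f, r and x *)

Section Family.
Context {R : realType}.
Implicit Types (x y z w e K r a : R).
Local Notation tau := (@tau R).

(** A discrete Gronwall estimate: as |a| L <= 1, each step at most doubles the distance and adds the
    error of one step, for a total factor 2^n - 1. *)
Lemma family_lift_dist (f g : R -> R) (L d r s a : R) n x : 0 <= d ->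
  (forall y z, `|f y - f z| <= L * `|y - z|) -> (forall y, `|f y - g y| <= d) ->
  `|a| * L <= 1 ->
  `|iter n (family_lift f r a) x - iter n (family_lift g s a) x|
    <= 2 ^+ n * (tau * `|r - s| + `|a| * d).
Proof.
move=> d0 fL fg aL; have t0 := @tau_gt0 R.
have c0 : 0 <= tau * `|r - s| + `|a| * d.
  by rewrite addr_ge0// mulr_ge0// ltW.
set c := tau * _ + _ in c0 *.
suff : `|iter n (family_lift f r a) x - iter n (family_lift g s a) x|
    <= (2 ^+ n - 1) * c.
  by move/le_trans; apply; rewrite ler_wpM2r// gerBl.
elim: n => [|n IH]; first by rewrite subrr normr0 expr0 subrr mul0r.
rewrite !iterS; move: (iter n _ x) (iter n (family_lift g s a) x) IH => u v uv.
have -> : family_lift f r a u - family_lift g s a v =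
    (u - v) + a * (f u - f v) + (tau * (r - s) + a * (f v - g v)).
  by rewrite /family_lift -/tau; ring.
have h1 : `|a * (f u - f v)| <= `|u - v|.
  rewrite normrM; apply: le_trans (ler_wpM2l (normr_ge0 a) (fL u v)) _.
  by rewrite mulrA ler_piMl.
have h2 : `|tau * (r - s) + a * (f v - g v)| <= c.
  apply: (le_trans (ler_normD _ _)); rewrite !normrM (gtr0_norm t0) lerD2l.
  exact: ler_wpM2l.
apply: (le_trans (ler_normD _ _)); rewrite exprS.
have := ler_normD (u - v) (a * (f u - f v)); move: h1 h2 uv; lra.
Qed.

Variables (f df : R -> R) (L : R).
Hypothesis fper : periodic f (pi *+ 2).
Hypothesis fD : forall x, is_derive x 1 f (df x).
Hypothesis dfL : forall x, `|df x| <= L.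
Hypothesis ddfL : forall x y, `|df x - df y| <= L * `|x - y|.
Variable a : R.
Hypothesis aL : `|a| * L < 1.

Lemma C1_lipschitz y z : `|f y - f z| <= L * `|y - z|.
Proof. exact: lipschitz_derive fD dfL. Qed.

Lemma scaled_derive_lt1 x : `|a * df x| < 1.
Proof. by apply: le_lt_trans aL; rewrite normrM ler_wpM2l. Qed.

Lemma family_lift_derive r x :
  is_derive x 1 (family_lift f r a) (1 + a * df x).
Proof.
have dZ : is_derive x 1 (a *: f) (a *: df x) by exact: is_deriveZ.
have dC : is_derive x 1 ((id : R -> R) + cst (pi *+ 2 * r)) (1 + 0).
  exact: is_deriveD.
rewrite addr0 in dC.
exact: (is_deriveD dC dZ).
Qed.

Lemma family_circle_lift r : circle_lift (family_lift f r a).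
Proof.
have cF : continuous (family_lift f r a).
  move=> x; apply/differentiable_continuous/derivable1_diffP.
  by have [] := family_lift_derive r x.
split=> // [x y xy|x]; last by rewrite /family_lift -/tau (fper x); lra.
rewrite -subr_gt0.
have [c [_ ->]] := MVT_abs x y (family_lift_derive r).
rewrite mulr_gt0 ?subr_gt0//.
by have := scaled_derive_lt1 c; rewrite ltr_norml => /andP[]; lra.
Qed.

Lemma family_cpi r y : circle_family f r a (cpi y) = cpi (family_lift f r a y).
Proof. exact: circle_family_pi. Qed.

Lemma family_iter_mono r s n x : r <= s -> (0 < n)%N ->
  iter n (family_lift f r a) x + tau * (s - r) <= iter n (family_lift f s a) x.
Proof.
move=> rs n0; have t0 := @tau_gt0 R.
have step y z : y <= z ->
    family_lift f r a y + tau * (s - r) <= family_lift f s a z.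
  move=> yz; have := circle_lift_le (family_circle_lift s) yz.
  by apply: le_trans; rewrite /family_lift -/tau; lra.
have ge : 0 <= tau * (s - r) by rewrite mulr_ge0 ?subr_ge0// ltW.
have mono m : iter m (family_lift f r a) x <= iter m (family_lift f s a) x.
  by elim: m => //= m IH; have := step _ _ IH; lra.
by case: n n0 => // n _; rewrite !iterS; exact: step.
Qed.

(** The constant [K] is chosen before [r], because [regular_parameter] compares displacements for
    different [r] with a single [K]. By the chain rule each step contributes a factor 1 + a f', at
    most 2 in absolute value. *)
Lemma family_iter_derive n : exists K, forall r, exists dH : R -> R,
  [/\ forall x, is_derive x 1 (iter n (family_lift f r a)) (dH x),
      forall x, `|dH x| <= 2 ^+ n &
      forall x y, `|dH x - dH y| <= K * `|x - y|].
Proof.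
elim: n => [|n [K IH]].
  exists 0 => r; exists (cst 1); split=> [x|x|x y].
  - by have := @is_derive_id R R x 1.
  - by rewrite normr1.
  - by rewrite subrr normr0 mul0r.
exists (2 * K + 2 ^+ n * 2 ^+ n) => r; have [dH [HD H2 HK]] := IH r.
pose g := family_lift f r a.
exists (fun x => (1 + a * df (iter n g x)) * dH x).
have b2 y : `|1 + a * df y| <= 2.
  by apply: (le_trans (ler_normD _ _)); rewrite normr1; have := scaled_derive_lt1 y; lra.
split=> [x|x|x y].
- have := @is_derive1_comp R g (iter n g) x _ _ (family_lift_derive r _) (HD x).
  by [].
- by rewrite normrM exprS ler_pM.
- have -> : (1 + a * df (iter n g x)) * dH x - (1 + a * df (iter n g y)) * dH y =
      (1 + a * df (iter n g x)) * (dH x - dH y) +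
      a * (df (iter n g x) - df (iter n g y)) * dH y by ring.
  apply: (le_trans (ler_normD _ _)); rewrite [leRHS]mulrDl; apply: lerD.
    by rewrite normrM -mulrA ler_pM.
  rewrite normrM mulrAC; apply: ler_pM => //.
  rewrite normrM; apply: le_trans (ler_wpM2l (normr_ge0 a) (ddfL _ _)) _.
  rewrite mulrA; apply: (@le_trans _ _ (1 * `|iter n g x - iter n g y|)).
    by rewrite ler_wpM2r// ltW.
  by rewrite mul1r; exact: lipschitz_derive HD H2.
Qed.

End Family.

Section Arcs.
Context {R : realType}.
Implicit Types (x y z w e K r a : R).
Local Notation tau := (@tau R).

Lemma finite_positive_lb (I : finType) (c : I -> R) : (forall i, 0 < c i) ->
  exists2 d, 0 < d & forall i, d <= c i.
Proof.
move=> c0; have s0 : 0 <= \sum_i (c i)^-1.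
  by apply: sumr_ge0 => i _; rewrite invr_ge0 ltW.
have s1 : 0 < \sum_i (c i)^-1 + 1 by rewrite ltr_wpDl.
exists (\sum_i (c i)^-1 + 1)^-1; first by rewrite invr_gt0.
move=> i; rewrite -[leRHS]invrK lef_pV2 ?posrE ?invr_gt0//.
rewrite (bigD1 i)//= -addrA lerDl addr_ge0//.
by apply: sumr_ge0 => j _; rewrite invr_ge0 ltW.
Qed.

Lemma cpi_separated x y : cpi x <> cpi y ->
  exists2 e, 0 < e & forall u v, `|u - x| < e -> `|v - y| < e -> cpi u <> cpi v.
Proof.
move=> xy; have [y' [yy' /andP[xy' y'x]]] := cpi_rep (cpi y) x.
have y'lt : y' < x + tau.
  rewrite lt_neqAle y'x andbT; apply/eqP => e; apply: xy.
  by rewrite yy' e; apply/cpiE; exists (-1); rewrite intrN; ring.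
have [m ym] := (cpiE y y').1 yy'.
exists (Order.min (y' - x) (x + tau - y') / 2).
  by rewrite divr_gt0// lt_min !subr_gt0 xy'.
have [] : Order.min (y' - x) (x + tau - y') <= y' - x /\
    Order.min (y' - x) (x + tau - y') <= x + tau - y'.
  by split; rewrite ge_min lexx ?orbT.
move: (Order.min _ _) => d d1 d2 u v.
rewrite !ltr_norml => /andP[u1 u2] /andP[v1 v2] /cpiE[l uv].
by apply: (@int_tau_small R (- l - m)); rewrite intrB intrN; lra.
Qed.

(* Arcs are given by lifts of their endpoints; being stated without any ordering,
   disjointness on the circle makes the number of arcs a lower bound for the number
   of points of the circle selected one in each arc. *)
Definition separated_arcs n (y z : 'I_n -> R) :=
  (forall i, y i < z i) /\
  forall i j, i <> j -> forall u v, y i <= u <= z i -> y j <= v <= z j ->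
    cpi u <> cpi v.

Definition return_dev (f : R -> R) r a (p : int) q x :=
  iter q (family_lift f r a) x - x - p%:~R * tau.

Definition alternates (u : R -> R) n (y z : 'I_n -> R) :=
  forall i, 0 < u (y i) /\ u (z i) < 0.

Variables (f df : R -> R) (L : R).
Hypothesis fper : periodic f (pi *+ 2).
Hypothesis fD : forall x, is_derive x 1 f (df x).
Hypothesis dfL : forall x, `|df x| <= L.
Hypothesis ddfL : forall x y, `|df x - df y| <= L * `|x - y|.
Variables (a : R) (p : int) (q : nat).
Hypothesis aL : `|a| * L < 1.
Hypothesis q0 : (0 < q)%N.
Hypothesis pq : coprimez p q.

Let lG r : circle_lift (family_lift f r a) := family_circle_lift fper fD dfL aL r.
Let FG r y : circle_family f r a (cpi y) = cpi (family_lift f r a y) :=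
  family_cpi fper a r y.

Lemma periodic_trajectory_lift r O :
  rotation_number (family_lift f r a) = p%:~R / q%:R ->
  periodic_trajectory (circle_family f r a) O ->
  exists x, iter q (family_lift f r a) x = x + p%:~R * tau /\
    O = trajectory (circle_family f r a) (cpi x).
Proof.
move=> rho [c [[q' q'0] + ->]]; have [x ->] := cpi_surj c => Fx; exists x; split=> //.
by have [] := periodic_point_lift (lG r) (FG r) q0 pq rho q'0 Fx.
Qed.

(** Raising [r] slightly keeps the positive values, since the displacement increases with [r], and
    keeps the negative ones as long as 2^q tau (r - r0) < d. Among such [r] a regular one exists: at
    a critical zero Taylor's formula would bound the displacement by K |y - x|^2 everywhere. *)
Lemma regular_crossings r0 n (y z : 'I_n -> R) : separated_arcs y z ->
  alternates (return_dev f r0 a p q) y z ->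
  exists r (w e : 'I_n -> R), forall i, [/\ y i < w i, w i < z i, 0 < e i,
    return_dev f r a p q (w i) = 0 &
    (forall x, w i - e i < x < w i -> 0 < return_dev f r a p q x) /\
    (forall x, w i < x < w i + e i -> return_dev f r a p q x < 0)].
Proof.
move=> [yz _] alt; have t0 := @tau_gt0 R.
have z0 i : 0 < - return_dev f r0 a p q (z i).
  by rewrite oppr_gt0; case: (alt i).
have [d d0 dz] := finite_positive_lb z0.
have [K HK] := family_iter_derive fD dfL ddfL aL q.
have K0 : 0 <= K.
  have [dH [_ _ /(_ 1 0)]] := HK 0.
  by rewrite subr0 normr1 mulr1; exact: le_trans.
have h0 : 0 < d / (2 ^+ q * tau) by rewrite divr_gt0// mulr_gt0// exprn_gt0.
have uper r x : return_dev f r a p q (x + tau) = return_dev f r a p q x.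
  rewrite /return_dev; have [_ _ ->] := circle_lift_iter q (lG r); ring.
have umono r s x : r <= s ->
    return_dev f r a p q x + tau * (s - r) <= return_dev f s a p q x.
  by move=> rs; have := family_iter_mono fper fD dfL aL x rs q0; rewrite /return_dev; lra.
have [r /andP[r1 r2] reg] := regular_parameter r0 K0 h0 uper umono.
have [dH [HD _ HKr]] := HK r.
have uD x : is_derive x 1 (return_dev f r a p q) (dH x - 1).
  have -> : dH x - 1 = (dH x - 1) - 0 by rewrite subr0.
  have d1 : is_derive x 1 (iter q (family_lift f r a) - id) (dH x - 1).
    exact: is_deriveB.
  exact: (is_deriveB d1 (is_derive_cst (p%:~R * tau) x 1)).
have uK x w : `|(dH x - 1) - (dH w - 1)| <= K * `|x - w|.
  by rewrite opprB addrA subrK; exact: HKr.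
have nd x : return_dev f r a p q x = 0 -> dH x - 1 != 0.
  move=> ux; apply/eqP => dx; have [w] := reg x ux.
  rewrite ltNge => /negP; apply.
  by have := taylor_bound x w uD uK; rewrite ux dx mul0r !subr0.
have cross i : exists we : R * R, [/\ y i < we.1, we.1 < z i, 0 < we.2,
    return_dev f r a p q we.1 = 0 &
    (forall x, we.1 - we.2 < x < we.1 -> 0 < return_dev f r a p q x) /\
    (forall x, we.1 < x < we.1 + we.2 -> return_dev f r a p q x < 0)].
  have uy : 0 < return_dev f r a p q (y i).
    have [h _] := alt i; apply: (lt_le_trans h); apply: le_trans (umono _ _ _ (ltW r1)).
    by rewrite lerDl mulr_ge0// ?subr_ge0 ltW.
  have uz : return_dev f r a p q (z i) < 0.
    have := @family_lift_dist R f f L 0 r r0 a q (z i) (lexx _).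
    have f0 x : `|f x - f x| <= 0 by rewrite subrr normr0.
    move=> /(_ (C1_lipschitz fD dfL) f0 (ltW aL)).
    rewrite mulr0 addr0 (gtr0_norm (_ : 0 < r - r0)) ?subr_gt0// ler_norml => /andP[_].
    rewrite mulrA => h; have := dz i; rewrite /return_dev => dzi.
    have : 2 ^+ q * tau * (r - r0) < d.
      by rewrite mulrC -ltr_pdivlMr ?mulr_gt0 ?exprn_gt0//; lra.
    move: h dzi; rewrite /return_dev; lra.
  have [w [e we]] := nondegenerate_crossing uD uK nd (yz i) uy uz.
  by exists (w, e).
have [we weP] := choice cross.
by exists r, (fun i => (we i).1), (fun i => (we i).2).
Qed.

(* Every orbit of rotation number p / q has exactly q points on the circle, so m
   attracting orbits correspond to q * m attracting points of the return map. *)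
Lemma alternating_arcs_attracting r0 m (y z : 'I_(q * m) -> R) : (0 < m)%N ->
  separated_arcs y z -> alternates (return_dev f r0 a p q) y z ->
  exists r, rotation_number (family_lift f r a) = p%:~R / q%:R /\
    ((m%:R)%:E <= num_attracting R (circle_family f r a))%E.
Proof.
move=> m0 sep alt; have [r [w [e we]]] := regular_crossings sep alt.
have [_ disj] := sep.
have Gw i : iter q (family_lift f r a) (w i) = w i + p%:~R * tau.
  by have [_ _ _ + _] := we i; rewrite /return_dev => h; lra.
have qm0 : (0 < q * m)%N by rewrite muln_gt0 q0.
have rho := rotation_number_periodic (lG r) q0 (Gw (Ordinal qm0)).
exists r; split=> //; set F := circle_family f r a.
have Fw i : iter q F (cpi (w i)) = cpi (w i).
  by rewrite (iter_cpi _ _ (FG r)) Gw cpi_shift.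
have att i : attracting F (trajectory F (cpi (w i))).
  have [_ _ e0 uw [lft rgt]] := we i.
  have Hw : iter q (family_lift f r a) (w i) - p%:~R * tau = w i.
    by rewrite Gw addrK.
  apply: (sign_attracting (lG r) (FG r) q0 Hw e0).
  - by move=> x /lft; rewrite /return_dev; lra.
  - by move=> x /rgt; rewrite /return_dev; lra.
rewrite /num_attracting /counting; case: asboolP => [finA|_]; last exact: leey.
rewrite lee_fin ler_nat; set T := [set O | _] in finA *.
pose A := fset_set T.
have AT (O : A) : T (fsval O).
  by have := fsvalP O; rewrite in_fset_set// => /set_mem.
have base (O : A) : exists c, iter q F c = c /\ fsval O = trajectory F c.
  have [per _] := AT O; have [x [Gx Ox]] := periodic_trajectory_lift rho per.
  by exists (cpi x); rewrite (iter_cpi _ _ (FG r)) Gx cpi_shift.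
have [b bP] := choice base.
(* Each zero is coded by its orbit and its position from a base point. The arcs being disjoint on
   the circle, the code is injective, whence q m <= q times the number of attracting orbits. *)
have idx i : exists os : A * 'I_q, cpi (w i) = iter os.2 F (b os.1).
  have TO : T (trajectory F (cpi (w i))).
    by split=> //; exists (cpi (w i)); split=> //; exists q.
  have OA : trajectory F (cpi (w i)) \in A by rewrite in_fset_set//; exact/mem_set.
  have [bq bO] := bP [` OA]%fset.
  have : trajectory F (b [` OA]%fset) (cpi (w i)) by rewrite -bO; exists 0%N.
  move=> [n _ bn]; have nq : (n %% q < q)%N by rewrite ltn_mod.
  by exists ([` OA]%fset, Ordinal nq); rewrite /= -(iter_periodic _ bq).
have [os osP] := choice idx.
have /leq_card : injective os.
  move=> i j ij; apply/eqP/negPn/negP => /eqP nij.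
  have [yi zi _ _ _] := we i; have [yj zj _ _ _] := we j.
  apply: (disj _ _ nij (w i) (w j)); rewrite ?ltW//.
  by rewrite (osP i) (osP j) ij.
by rewrite card_prod !card_ord cardfE mulnC leq_pmul2r.
Qed.

(** The index i stands for the point of rank i mod q on the orbit of number i / q. These points are
    distinct: a coincidence on one orbit would be a period smaller than q, whereas q divides every
    period. Each carries a sign change at arbitrarily small distance, taken below the separation of
    the points. *)
Lemma attracting_alternating_arcs r m :
  rotation_number (family_lift f r a) = p%:~R / q%:R ->
  ((m%:R)%:E <= num_attracting R (circle_family f r a))%E ->
  exists y z : 'I_(q * m) -> R, separated_arcs y z /\
    alternates (return_dev f r a p q) y z.
Proof.
move=> rho /counting_geP[Orb [Oinj OP]]; set F := circle_family f r a.
set G := family_lift f r a in rho *.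
have base i : exists x, iter q G x = x + p%:~R * tau /\ Orb i = trajectory F (cpi x).
  by have [per _] := OP i; exact: periodic_trajectory_lift rho per.
have [x xP] := choice base.
have dP (i : 'I_(q * m)) : (i %/ q < m)%N by rewrite ltn_divLR// [(m * q)%N]mulnC.
pose d i := Ordinal (dP i).
pose w (i : 'I_(q * m)) := iter (i %% q) G (x (d i)).
have Gw i : iter q G (w i) = w i + p%:~R * tau.
  have [Gx _] := xP (d i); rewrite /w -iterD addnC iterD Gx circle_lift_int//.
  exact/circle_lift_iter/lG.
have Fx i : iter q F (cpi (x i)) = cpi (x i).
  by have [Gx _] := xP i; rewrite (iter_cpi _ _ (FG r)) Gx cpi_shift.
have traj i : trajectory F (cpi (w i)) = Orb (d i).
  have [_ ->] := xP (d i); apply: (trajectory_eq q0 (Fx _)).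
  by exists (i %% q)%N => //; rewrite (iter_cpi _ _ (FG r)).
have wneq i j : i <> j -> cpi (w i) <> cpi (w j).
  move=> ij wij; have dij : d i = d j by apply: Oinj; rewrite -!traj wij.
  have sij : (i %% q)%N <> (j %% q)%N.
    move=> s; apply: ij; apply: val_inj => /=.
    by rewrite (divn_eq i q) (divn_eq j q) s; have /= -> := congr1 val dij.
  wlog lij : i j ij wij dij sij / (i %% q < j %% q)%N.
    move=> W; case: (ltngtP (i %% q) (j %% q))%N => // lij; first exact: (W i j).
    by apply: (W j i) => //; exact: nesym.
  have per : iter (j %% q - i %% q) F (cpi (w i)) = cpi (w i).
    rewrite [RHS]wij (iter_cpi _ _ (FG r)) /w dij -/G -iterD subnK//.
    exact: ltnW.
  have s0 : (0 < j %% q - i %% q)%N by rewrite subn_gt0.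
  have [+ _] := periodic_point_lift (lG r) (FG r) q0 pq rho s0 per.
  by move=> /(dvdn_leq s0) h; have := ltn_pmod j q0; move: h lij; lia.
have sep (ij : 'I_(q * m) * 'I_(q * m)) : exists e, 0 < e /\ (ij.1 <> ij.2 ->
    forall u v, `|u - w ij.1| < e -> `|v - w ij.2| < e -> cpi u <> cpi v).
  case: ij => i j /=; have [->|/eqP/wneq/cpi_separated[e e0 eP]] := eqVneq i j.
    by exists 1; split.
  by exists e.
have [e eP] := choice sep.
have [s s0 se] := finite_positive_lb (fun ij => (eP ij).1).
have [cH hH _] := circle_lift_add (- (p%:~R * tau)) (circle_lift_iter q (lG r)).
have sgn i : exists yz : R * R, [/\ w i - s < yz.1, yz.1 < w i, w i < yz.2,
    yz.2 < w i + s & 0 < return_dev f r a p q yz.1 /\ return_dev f r a p q yz.2 < 0].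
  have Hw : iter q G (w i) - p%:~R * tau = w i by rewrite Gw addrK.
  have [_ att] := OP (d i); rewrite -traj in att.
  have [y [z [h1 h2 h3 h4 [h5 h6]]]] := lift_attracting_sign hH cH Hw
    (attracting_lift (lG r) (FG r) q0 Hw att) s0.
  by exists (y, z); split=> //=; rewrite /return_dev -/G; split; lra.
have [yz yzP] := choice sgn.
exists (fun i => (yz i).1), (fun i => (yz i).2); split; last first.
  by move=> i; have [_ _ _ _] := yzP i.
split=> [i|i j ij u v /andP[u1 u2] /andP[v1 v2]].
  by have [_ h1 h2 _ _] := yzP i; exact: lt_trans h2.
have [a1 a2 a3 a4 _] := yzP i; have [b1 b2 b3 b4 _] := yzP j.
have es := se (i, j).
apply: ((eP (i, j)).2 ij); apply: lt_le_trans es;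
  by rewrite ltr_norml /=; apply/andP; split; lra.
Qed.

End Arcs.

(** * Finite cyclicity is a Borel condition *)

Section CkBounds.
Context {R : realType} {k : nat}.
Implicit Types f g : Ck_circle R k.

Lemma Ck_der_bound f j (x : R) : (j <= k)%N -> `|derive1n j f x| <= `|f|.
Proof.
rewrite -ltnS => jk; change (`|derive1n (Ordinal jk) f x| <= Ck_norm f).
rewrite /Ck_norm (bigD1 (Ordinal jk))//=.
apply: le_trans (sup_norm_ub x (Ck_has_sup f (Ordinal jk))) _.
rewrite lerDl; apply: sumr_ge0 => i _.
exact: le_trans (sup_norm_ub 0 (Ck_has_sup f i)).
Qed.

Lemma Ck_is_derive f j (x : R) : (j < k)%N ->
  is_derive x 1 (derive1n j f) (derive1n j.+1 f x).
Proof.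
move=> jk; have [_ [df _]] := Ck_circleP f.
by rewrite derive1nS derive1E; apply/derivableP; exact: df.
Qed.

Lemma Ck_periodic f : periodic f (pi *+ 2).
Proof. by have [] := Ck_circleP f. Qed.

Lemma Ck_sub_bound f g x : `|f x - g x| <= `|f - g|.
Proof. exact: (@Ck_der_bound (f - g) 0). Qed.

Hypothesis k2 : (2 <= k)%N.

Lemma C2_lipschitz f x y : `|derive1n 1 f x - derive1n 1 f y| <= `|f| * `|x - y|.
Proof.
apply: (lipschitz_derive (du := derive1n 2 f)) => z; first exact: Ck_is_derive.
exact: Ck_der_bound.
Qed.

Lemma C1_derive f (x : R) : is_derive x 1 f (derive1n 1 f x).
Proof. by apply: (@Ck_is_derive f 0); exact: ltnW. Qed.

Lemma C1_bound f (x : R) : `|derive1n 1 f x| <= `|f|.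
Proof. by apply: Ck_der_bound; exact: ltnW. Qed.

End CkBounds.

Section Cyclicity.
Context {R : realType}.
Local Notation tau := (@tau R).

Lemma counting_lt_nat (T : choiceType) (A : set T) (M : nat) :
  (counting A < (M.+1%:R)%:E :> \bar R)%E -> (counting A <= (M%:R)%:E :> \bar R)%E.
Proof.
rewrite /counting; case: asboolP => // finA.
by rewrite lte_fin lee_fin ltr_nat ler_nat.
Qed.

(** Counts are integers or infinite: an upper limit at most M is below M + 1, so the counts
    themselves are at most M for all |a| below some [e]. *)
Lemma cyclicity_leP (f : R -> R) (rho : R) (M : nat) :
  (cyclicity f rho <= (M%:R)%:E)%E <->
  exists2 e : R, 0 < e & forall r a, rotation_number (family_lift f r a) = rho ->
    `|a| < e -> (num_attracting R (circle_family f r a) <= (M%:R)%:E)%E.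
Proof.
rewrite /cyclicity; set g := (fun a1 : R => _).
split=> [cM|[e e0 eM]].
  have : (limf_esup g 0^'+ < (M.+1%:R)%:E)%E.
    by apply: (le_lt_trans cM); rewrite lte_fin ltr_nat.
  move=> /ereal_inf_lt[_ [V V0 <-]] supV.
  have [e [e0 Ve]] : exists e : R, 0 < e /\ V e.
    have : \forall e \near (0 : R)^'+, 0 < e /\ V e.
      by apply: filterI => //; exact: nbhs_right_gt.
    exact: filter_ex.
  exists e => // r a rho_ra ae; apply: counting_lt_nat.
  apply: le_lt_trans supV; have gV : (g e <= ereal_sup (g @` V))%E.
    by apply: ereal_sup_ubound; exists e.
  by apply: le_trans gV; apply: ereal_sup_ubound; exists (r, a).
have : (limf_esup g 0^'+ <= ereal_sup (g @` [set a1 | (a1 < e)%R]))%E.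
  by apply: ereal_inf_lbound; exists [set a1 | a1 < e] => //; exact: nbhs_right_lt.
move=> /le_trans; apply.
apply: ge_ereal_sup => _ [a1 /= a1e <-].
apply: ge_ereal_sup => _ [[r a] /= [rho_ra aa1] <-].
by apply: eM => //; exact: lt_trans a1e.
Qed.

Lemma finite_cyclicityP (f : R -> R) : finite_infinitesimal_cyclicity f <->
  exists M : nat, forall rho, (cyclicity f rho <= (M%:R)%:E)%E.
Proof.
split=> [[M fM]|[M fM]]; last by exists M%:R.
exists (Num.bound `|M|) => rho; apply: (le_trans (fM rho)); rewrite lee_fin.
by apply: (le_trans (ler_norm M)); rewrite ltW// archi_boundP.
Qed.

Lemma coprime_ratio (m : int) (n : nat) : (0 < n)%N ->
  exists (p : int) (q : nat), [/\ (0 < q)%N, coprimez p q &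
    m%:~R / n%:R = p%:~R / q%:R :> R].
Proof.
move=> n0; pose x : rat := m%:~R / n%:R.
exists (numq x), `|denq x|%N; split.
- by rewrite absz_gt0 denq_eq0.
- by rewrite /coprimez /gcdz absz_nat; exact: coprime_num_den.
have nx : x * n%:R = m%:~R by rewrite /x divfK// pnatr_eq0 -lt0n.
have e : (numq x * n)%:~R = (m * denq x)%:~R :> rat.
  by rewrite !intrM -nx -[in LHS]pmulrn mulrAC -numqE; ring.
have {}e : numq x * n = m * denq x by apply/eqP; rewrite -(eqr_int rat) e.
have -> : `|denq x|%N%:R = (denq x)%:~R :> R by rewrite pmulrn gez0_abs.
apply/eqP; rewrite eqr_div ?pnatr_eq0 -?lt0n// ?intr_eq0 ?denq_eq0//.
by rewrite [n%:R]pmulrn -!intrM e.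
Qed.

End Cyclicity.

Section Borel.
Context {R : realType} {k : nat}.
Hypothesis k2 : (2 <= k)%N.
Local Notation X := (Ck_circle R k).
Local Notation tau := (@tau R).

Definition alternating_set (e : R) (p : int) (q n : nat) : set X :=
  [set f : X | exists r a (y z : 'I_n -> R), [/\ `|a| < e, `|a| * `|f| < 1,
    separated_arcs y z & alternates (return_dev f r a p q) y z]].

(** The same [r], [a] and arcs serve every nearby g: the displacement moves by at most 2^q |a| |f -
    g|, less than the smallest of the finitely many values tested, and |a| |g| < 1 persists. *)
Lemma alternating_set_open e p q n : open (alternating_set e p q n).
Proof.
rewrite openE => f [r [a [y [z [ae af sep alt]]]]].
have c0 (ib : 'I_n * bool) : 0 < (if ib.2 then return_dev f r a p q (y ib.1)
    else - return_dev f r a p q (z ib.1)).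
  by case: ib => i [] /=; have [? ?] := alt i; rewrite ?oppr_gt0.
have [d d0 dP] := finite_positive_lb c0.
have a1 : 0 < 2 ^+ q * (`|a| + 1) by rewrite mulr_gt0 ?exprn_gt0// ltr_wpDl.
pose s := Order.min (d / (2 ^+ q * (`|a| + 1))) ((1 - `|a| * `|f|) / (`|a| + 1)).
have s0 : 0 < s.
  by rewrite lt_min !divr_gt0 ?subr_gt0// ltr_wpDl.
have [s1 s2] : s <= d / (2 ^+ q * (`|a| + 1)) /\ s <= (1 - `|a| * `|f|) / (`|a| + 1).
  by split; rewrite /s ge_min lexx ?orbT.
apply/nbhs_ballP; exists s => // g; rewrite -ball_normE /= => fg.
have dist x : `|return_dev f r a p q x - return_dev g r a p q x| < d.
  have := @family_lift_dist R f g `|f| `|f - g| r r a q x (normr_ge0 _)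
    (C1_lipschitz (C1_derive k2 f) (C1_bound k2 f)) (Ck_sub_bound f g) (ltW af).
  rewrite subrr normr0 mulr0 add0r /return_dev.
  have -> u v : u - x - p%:~R * tau - (v - x - p%:~R * tau) = u - v :> R by ring.
  move=> h; apply: (le_lt_trans h).
  have h2 : `|f - g| * (2 ^+ q * (`|a| + 1)) < d.
    by rewrite -ltr_pdivlMr//; exact: lt_le_trans s1.
  apply: le_lt_trans h2; rewrite mulrA mulrC ler_wpM2l// ler_wpM2l ?exprn_ge0//.
  by rewrite lerDl.
exists r, a, y, z; split=> // [|i].
  have h2 : `|f - g| * (`|a| + 1) < 1 - `|a| * `|f|.
    by rewrite -ltr_pdivlMr ?ltr_wpDl//; exact: lt_le_trans s2.
  have h3 : `|g| <= `|f| + `|f - g|.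
    by rewrite -{1}(subKr f g); exact: ler_normB.
  have h4 := ler_wpM2l (normr_ge0 a) h3.
  have := normr_ge0 (f - g); lra.
have := dP (i, true); have := dP (i, false) => /= h1 h2.
have := dist (y i); have := dist (z i).
by rewrite !ltr_norml => /andP[? ?] /andP[? ?]; split; lra.
Qed.

Local Notation borel := (g_sigma_algebraType (@open X)).

Lemma open_borel (A : set X) : open A -> measurable (A : set borel).
Proof. exact: sub_sigma_algebra. Qed.

(* The integer p is written n1 - n2 so that all unions and intersections range over
   nat; the norm bound makes all maps with |a| < 1 / N.+1 diffeomorphisms. *)
Definition bounded_cyclicity_piece (M n1 n2 q N : nat) : set X :=
  [set f : X | (0 < q)%N -> coprimez (n1%:Z - n2%:Z) q ->
    `|f| <= N%:R /\
    ~ alternating_set (N.+1%:R^-1) (n1%:Z - n2%:Z) q (q * M.+1) f].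

Lemma bounded_cyclicity_piece_borel M n1 n2 q N :
  measurable (bounded_cyclicity_piece M n1 n2 q N : set borel).
Proof.
rewrite /bounded_cyclicity_piece.
have [/andP[q0 pq]|npq] := boolP ((0 < q)%N && coprimez (n1%:Z - n2%:Z) q); last first.
  rewrite (_ : [set f | _] = setT); first exact: measurableT.
  by apply/seteqP; split=> // f _ q0 pq; rewrite q0 pq in npq.
rewrite (_ : [set f | _] = ~` [set f | N%:R < `|f|] `&`
    ~` alternating_set (N.+1%:R^-1) (n1%:Z - n2%:Z) q (q * M.+1)); last first.
  apply/seteqP; split=> f /=; first by move=> /(_ q0 pq)[h1 h2]; split=> //; rewrite leNgt in h1; exact/negP.
  by move=> [/negP h1 h2] _ _; rewrite leNgt.
apply: measurableI; apply: measurableC; apply: open_borel.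
  have := @open_comp X R (fun f => `|f|) [set t | N%:R < t].
  by apply; [move=> f _; exact: norm_continuous|exact: open_gt].
exact: alternating_set_open.
Qed.

(** A count above M at p / q amounts to q (M + 1) alternations. The integer N plays two roles: it
    bounds the norm of f, and 1 / (N + 1) is the range allowed for |a|. *)
Lemma finite_cyclicity_pieces (f : X) : finite_infinitesimal_cyclicity f <->
  (\bigcup_M \bigcap_n1 \bigcap_n2 \bigcap_q \bigcup_N
    bounded_cyclicity_piece M n1 n2 q N) f.
Proof.
have D := C1_derive k2 f; have B := C1_bound k2 f; have L2 := C2_lipschitz k2 f.
have per := Ck_periodic f.
split=> [/finite_cyclicityP[M fM]|[M _ fM]].
  exists M => // n1 _ n2 _ q _.
  have [q0|] := posnP q; first by exists 0%N => //; rewrite q0.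
  move=> q0; have [e e0 eM] := (cyclicity_leP f _ M).1 (fM ((n1%:Z - n2%:Z)%:~R / q%:R)).
  exists (Num.bound (`|f| + e^-1)) => // _ pq; set N := Num.bound _.
  have hN : `|f| + e^-1 < N%:R.
    by apply: archi_boundP; rewrite addr_ge0// invr_ge0 ltW.
  have ei : 0 < e^-1 by rewrite invr_gt0.
  split; first by have := normr_ge0 f; lra.
  move=> [r [a [y [z [ae af sep alt]]]]].
  have [r' [rho' N']] := alternating_arcs_attracting per D B L2 af q0 pq
    (ltn0Sn M) sep alt.
  have ae' : `|a| < e.
    apply: (lt_trans ae); rewrite -[ltRHS]invrK ltf_pV2 ?posrE ?invr_gt0//.
    by rewrite -natr1; have := normr_ge0 f; lra.
  have := le_trans N' (eM r' a rho' ae').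
  by rewrite lee_fin ler_nat ltnn.
apply/finite_cyclicityP; exists M => rho; apply/cyclicity_leP.
have [[p [q [q0 pq ->]]]|nrho] := pselect (exists (p : int) (q : nat),
    [/\ (0 < q)%N, coprimez p q & rho = p%:~R / q%:R]).
  pose n1 := if 0 <= p then `|p|%N else 0%N.
  pose n2 := if 0 <= p then 0%N else `|p|%N.
  have pn : p = n1%:Z - n2%:Z by rewrite /n1 /n2; case: ifP => ?; lia.
  have [N _ NP] := fM n1 I n2 I q I; rewrite /bounded_cyclicity_piece /= -pn in NP.
  have [fN nalt] := NP q0 pq.
  exists (N.+1%:R^-1); first by rewrite invr_gt0 ltr0n.
  move=> r a rho_ra ae.
  have af : `|a| * `|f| < 1.
    apply: (@le_lt_trans _ _ (`|a| * N%:R)); first by rewrite ler_wpM2l.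
    move: ae; rewrite -[_^-1]mul1r ltr_pdivlMr ?ltr0n// -natr1.
    by have := normr_ge0 a; lra.
  apply: counting_lt_nat; rewrite ltNge; apply/negP => N'; apply: nalt.
  have [y [z [sep alt]]] := attracting_alternating_arcs per D B af q0 pq rho_ra N'.
  by exists r, a, y, z.
(* For |a| |f| < 1 a periodic orbit forces a rational rotation number, so the count is 0 here. *)
exists (`|f| + 1)^-1; first by rewrite invr_gt0 ltr_wpDl.
move=> r a rho_ra ae.
have af : `|a| * `|f| < 1.
  move: ae; rewrite -[_^-1]mul1r ltr_pdivlMr ?ltr_wpDl//.
  by have := normr_ge0 a; lra.
apply: (@le_trans _ _ 0%:R%:E); last by rewrite lee_fin ler_nat.
apply: counting_lt_nat; rewrite ltNge; apply/negP => /counting_geP[Orb [_ OP]].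
have [[c [[n n0 +] _]] _] := OP ord0; have [x ->] := cpi_surj c => Fx; apply: nrho.
rewrite (iter_cpi _ _ (family_cpi per a r)) in Fx.
have [m Gx] := (cpiE _ _).1 Fx.
have rm := rotation_number_periodic (family_circle_lift per D B af r) n0 Gx.
have [p [q [q0 pq e]]] := @coprime_ratio R m n n0.
by exists p, q; split=> //; rewrite -rho_ra rm.
Qed.

Lemma finite_cyclicity_borel :
  measurable ([set f : X | finite_infinitesimal_cyclicity f] : set borel).
Proof.
rewrite (_ : [set f : X | _] = \bigcup_M \bigcap_n1 \bigcap_n2 \bigcap_q \bigcup_N
    bounded_cyclicity_piece M n1 n2 q N); last first.
  by apply/seteqP; split=> f /finite_cyclicity_pieces.
apply: bigcupT_measurable => M; apply: bigcapT_measurable => n1.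
apply: bigcapT_measurable => n2; apply: bigcapT_measurable => q.
by apply: bigcupT_measurable => N; exact: bounded_cyclicity_piece_borel.
Qed.

End Borel.

(** * Averages over finite rotation groups *)

Section Average.
Context {R : realType}.
Implicit Types (f g : R -> R) (x y c : R) (q m n : nat).
Local Notation tau := (@tau R).

Definition average q f x : R := q%:R^-1 * \sum_(t < q) f (x + tau * t%:R / q%:R).

Lemma averageD q f g x : average q (fun y => f y + g y) x = average q f x + average q g x.
Proof. by rewrite /average big_split mulrDr. Qed.

Lemma averageZ q c f x : average q (fun y => c * f y) x = c * average q f x.
Proof. by rewrite /average -mulr_sumr mulrCA. Qed.

Lemma averageB q f g x : average q (fun y => f y - g y) x = average q f x - average q g x.
Proof. by rewrite /average sumrB mulrBr. Qed.

Lemma average_cst q c x : (0 < q)%N -> average q (fun=> c) x = c.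
Proof.
by move=> q0; rewrite /average sumr_const card_ord -[c *+ q]mulr_natl mulKf// pnatr_eq0 -lt0n.
Qed.

Lemma le_average q f g x : (forall y, f y <= g y) -> average q f x <= average q g x.
Proof.
by move=> fg; rewrite /average ler_wpM2l ?invr_ge0//; apply: ler_sum.
Qed.

Lemma average_abs q f x : `|average q f x| <= average q (fun y => `|f y|) x.
Proof.
rewrite /average normrM ger0_norm ?invr_ge0// ler_wpM2l ?invr_ge0//.
exact: ler_norm_sum.
Qed.

Lemma average_bound q f c x : (0 < q)%N -> (forall y, `|f y| <= c) ->
  `|average q f x| <= c.
Proof.
move=> q0 fc; apply: (le_trans (average_abs _ _ _)).
by rewrite -[leRHS](average_cst c x q0); exact: le_average.
Qed.

Lemma average_comm q m f x :
  average q (average m f) x = average m (average q f) x.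
Proof.
rewrite /average -!mulr_sumr mulrCA exchange_big /=.
congr (_ * (_ * _)); apply: eq_bigr => t _; apply: eq_bigr => s _.
by rewrite addrAC.
Qed.

Lemma periodic_mul (P : R) f (m : nat) x : periodic f P -> f (x + m%:R * P) = f x.
Proof. by move=> fP; rewrite mulr_natl; exact: periodicn. Qed.

Lemma periodic_fine q m f : (0 < q)%N -> (0 < m)%N ->
  periodic f (tau / (q * m)%:R) -> periodic f (tau / q%:R).
Proof.
move=> q0 m0 fp x; rewrite -[RHS](periodic_mul m x fp).
by congr (f (x + _)); rewrite natrM; field; rewrite !pnatr_eq0 -!lt0n m0.
Qed.

Lemma average_periodic q f : (0 < q)%N -> periodic f tau ->
  periodic (average q f) (tau / q%:R).
Proof.
case: q => // q _ fp x; rewrite /average; congr (_ * _).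
rewrite big_ord_recr big_ord_recl /= addrC; congr (_ + _).
  rewrite mulr0 mul0r addr0 -[RHS]fp; congr f.
  have q1 : q.+1%:R != 0 :> R by rewrite pnatr_eq0.
  by rewrite -addrA -mulrDl -{1}[tau]mulr1 -mulrDr nat1r mulfK.
apply: eq_bigr => t _; congr f; rewrite /bump /= add1n.
by rewrite -addrA -mulrDl -{1}[tau]mulr1 -mulrDr nat1r.
Qed.

Lemma average_id q f x : (0 < q)%N -> periodic f (tau / q%:R) -> average q f x = f x.
Proof.
move=> q0 fp; rewrite -[RHS](average_cst _ x q0); congr (_ * _).
apply: eq_bigr => t _; rewrite -[RHS](periodic_mul t x fp).
by congr (f (x + _)); rewrite mulrAC mulrC mulrA.
Qed.

(** As for a conditional expectation, functions already invariant under the rotations of order q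
    factor out. *)
Lemma average_mulr q f g x : (0 < q)%N -> periodic g (tau / q%:R) ->
  average q (fun y => f y * g y) x = average q f x * g x.
Proof.
move=> q0 gp; rewrite /average -mulrA; congr (_ * _); rewrite mulr_suml.
apply: eq_bigr => t _; congr (_ * _); rewrite -[RHS](periodic_mul t x gp).
by congr (g (x + _)); rewrite mulrAC mulrC mulrA.
Qed.

Lemma average_period_tau q f : periodic f tau -> periodic (average q f) tau.
Proof.
move=> fp x; rewrite /average; congr (_ * _); apply: eq_bigr => t _.
by rewrite addrAC fp.
Qed.

End Average.

(** * First-order averaging of the dynamics near a = 0 *)

Section AveragedDynamics.
Context {R : realType}.
Local Notation tau := (@tau R).
Variables (f : R -> R) (L B c : R) (q : nat).
Hypothesis fL : forall y z, `|f y - f z| <= L * `|y - z|.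
Hypothesis fB : forall y, `|f y - c| <= B.
Hypothesis q0 : (0 < q)%N.

(* First-order averaging at rotation number 1 / q, with the shift of the parameter r
   chosen to compare the average of f with the level c. *)
Lemma family_iter_expansion n : exists C, forall a x, `|a| <= 1 ->
  `|iter n (family_lift f (q%:R^-1 - a * c / tau) a) x -
    (x + tau * n%:R / q%:R +
     a * \sum_(t < n) (f (x + tau * t%:R / q%:R) - c))| <= C * `|a| ^+ 2.
Proof.
have t0 := @tau_gt0 R; have tn0 : tau != 0 by rewrite gt_eqF.
have L0 : 0 <= L by have := fL 1 0; rewrite subr0 normr1 mulr1; exact: le_trans.
have qn0 : q%:R != 0 :> R by rewrite pnatr_eq0 -lt0n.
elim: n => [|n [C IH]].
  exists 0 => a x _; rewrite big_ord0 mulr0 mul0r !addr0 mulr0 mul0r.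
  by rewrite addr0 subrr normr0.
exists (C + L * (n%:R * B + `|C|)) => a x a1.
have := IH a x a1; rewrite iterS big_ord_recr /=.
set S := \sum_(t < n) _; set xn := iter n _ x; set yn := x + tau * n%:R / q%:R.
move=> h.
have -> : family_lift f (q%:R^-1 - a * c / tau) a xn -
    (x + tau * n.+1%:R / q%:R + a * (S + (f yn - c))) =
    (xn - (yn + a * S)) + a * (f xn - f yn).
  have fld (T r : R) : T != 0 -> r != 0 ->
      xn + T * (r^-1 - a * c / T) + a * f xn - (x + T * (n%:R + 1) / r + a * (S + (f yn - c)))
      = (xn - (x + T * n%:R / r + a * S)) + a * (f xn - f yn).
    by move=> T0 r0; field; rewrite T0 r0.
  by rewrite -fld// /family_lift natr1.
have hS : `|S| <= n%:R * B.
  apply: (le_trans (ler_norm_sum _ _ _)).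
  apply: (@le_trans _ _ (\sum_(t < n) B)); first by apply: ler_sum.
  by rewrite sumr_const card_ord mulr_natl.
have a2 : `|a| ^+ 2 <= `|a| by rewrite expr2 ler_piMl.
have hx : `|xn - yn| <= `|a| * (n%:R * B + `|C|).
  have -> : xn - yn = (xn - (yn + a * S)) + a * S by ring.
  apply: (le_trans (ler_normD _ _)); rewrite mulrDr addrC; apply: lerD.
    by rewrite normrM ler_wpM2l.
  apply: (le_trans h); rewrite mulrC; apply: (le_trans (ler_norm _)).
  by rewrite normrM (ger0_norm (exprn_ge0 2 (normr_ge0 a))) ler_wpM2r.
apply: (le_trans (ler_normD _ _)); rewrite mulrDl; apply: lerD => //.
rewrite normrM; apply: le_trans (ler_wpM2l (normr_ge0 a) (fL _ _)) _.
apply: (@le_trans _ _ (`|a| * (L * (`|a| * (n%:R * B + `|C|))))).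
  by rewrite ler_wpM2l// ler_wpM2l.
by rewrite le_eqVlt; apply/orP; left; apply/eqP; ring.
Qed.

(** The return displacement is a q (average q f - c) up to C a^2. The gap [d] between the averages
    and the level being uniform over the finitely many endpoints, a (|C| + 1) < q d is enough for
    equal signs. *)
Lemma averaged_alternation n (y z : 'I_n -> R) (e : R) : 0 < e ->
  (forall i, c < average q f (y i) /\ average q f (z i) < c) ->
  exists a r, 0 < a < e /\ alternates (return_dev f r a 1 q) y z.
Proof.
move=> e0 alt; have t0 := @tau_gt0 R.
have qn0 : q%:R != 0 :> R by rewrite pnatr_eq0 -lt0n.
have qp : 0 < q%:R :> R by rewrite ltr0n.
have [C HC] := family_iter_expansion q.
have c0 (ib : 'I_n * bool) : 0 < (if ib.2 then average q f (y ib.1) - c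
    else c - average q f (z ib.1)).
  by case: ib => i [] /=; have [? ?] := alt i; rewrite subr_gt0.
have [d d0 dP] := finite_positive_lb c0.
pose a := Order.min 1 (Order.min e (q%:R * d / (`|C| + 1))) / 2.
have C1 : 0 < `|C| + 1 by rewrite ltr_wpDl.
have m0 : 0 < Order.min 1 (Order.min e (q%:R * d / (`|C| + 1))).
  by rewrite !lt_min ltr01 e0 divr_gt0// mulr_gt0.
have [m1 m2 m3] : [/\ Order.min 1 (Order.min e (q%:R * d / (`|C| + 1))) <= 1,
    Order.min 1 (Order.min e (q%:R * d / (`|C| + 1))) <= e &
    Order.min 1 (Order.min e (q%:R * d / (`|C| + 1))) <= q%:R * d / (`|C| + 1)].
  by split; rewrite !ge_min !lexx ?orbT.
have a0 : 0 < a by rewrite /a divr_gt0.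
have a1 : `|a| <= 1 by rewrite gtr0_norm// /a; lra.
have ad : a * (`|C| + 1) < q%:R * d.
  by rewrite -ltr_pdivlMr// /a; lra.
exists a, (q%:R^-1 - a * c / tau); split; first by rewrite a0 /a/=; lra.
have dev x : `|return_dev f (q%:R^-1 - a * c / tau) a 1 q x -
    a * (q%:R * (average q f x - c))| < a * (q%:R * d).
  have := HC a x a1; rewrite mulfK// sumrB sumr_const card_ord.
  have -> : \sum_(t < q) f (x + tau * t%:R / q%:R) = q%:R * average q f x.
    by rewrite /average mulVKf.
  rewrite -[c *+ q]mulr_natl -mulrBr /return_dev mul1r.
  have -> (u v : R) : u - (x + tau + v) = u - x - tau - v by ring.
  move=> h; apply: (le_lt_trans h); rewrite (gtr0_norm a0) expr2 mulrCA ltr_pM2l//.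
  apply: le_lt_trans ad; rewrite mulrC ler_pM2l//.
  by have := ler_norm C; lra.
move=> i; have h1 := dP (i, true); have h2 := dP (i, false).
rewrite /= in h1 h2.
have k1 : a * (q%:R * d) <= a * (q%:R * (average q f (y i) - c)).
  by rewrite ler_pM2l// ler_pM2l.
have k2 : a * (q%:R * d) <= a * (q%:R * (c - average q f (z i))).
  by rewrite ler_pM2l// ler_pM2l.
have := dev (y i); have := dev (z i).
rewrite !ltr_norml => /andP[_ l1] /andP[l2 _].
by split; move: k1 k2 l1 l2; rewrite !mulrBr; lra.
Qed.

End AveragedDynamics.

(** Turning alternations into attracting orbits changes [r] but not [a], so m > M attracting orbits
    of rotation number 1 / q appear at arbitrarily small [a]. *)
Lemma averaged_cyclicity (R : realType) (k : nat) (f : Ck_circle R k) (c : R)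
    (q m M : nat) (y z : 'I_(q * m) -> R) : (2 <= k)%N -> (0 < q)%N ->
  (M < m)%N -> separated_arcs y z ->
  (forall i, c < average q f (y i) /\ average q f (z i) < c) ->
  ~ (cyclicity f (q%:R^-1) <= (M%:R)%:E)%E.
Proof.
move=> k2 q0 Mm sep alt /cyclicity_leP[e e0 eM].
have D := C1_derive k2 f; have B := C1_bound k2 f; have L2 := C2_lipschitz k2 f.
have per := Ck_periodic f.
have fB x : `|f x - c| <= `|f| + `|c|.
  apply: (le_trans (ler_normB _ _)); rewrite lerD2r.
  exact: (@Ck_der_bound _ _ f 0).
have f1 : 0 < `|f| + 1 by rewrite ltr_wpDl.
have e'0 : 0 < Order.min e (`|f| + 1)^-1 by rewrite lt_min e0 invr_gt0.
have [a [r [/andP[a0 ae] altd]]] := averaged_alternation (C1_lipschitz D B) fB q0 e'0 alt.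
move: ae; rewrite lt_min => /andP[ae af'].
have af : `|a| * `|f| < 1.
  rewrite (gtr0_norm a0); move: af'; rewrite -[_^-1]mul1r ltr_pdivlMr//.
  by lra.
have pq : coprimez 1 q by rewrite /coprimez gcd1z.
have m0 : (0 < m)%N by exact: leq_ltn_trans Mm.
have [r' [rho N']] := alternating_arcs_attracting per D B L2 af q0 pq m0 sep altd.
have := eM r' a; rewrite rho mul1r (gtr0_norm a0) => /(_ erefl ae).
by move=> /(le_trans N'); rewrite lee_fin ler_nat leqNgt Mm.
Qed.

(** * Square means on a grid and the oscillation of averages *)

Section Energy.
Context {R : realType}.
Implicit Types (f g v : R -> R) (x y c : R) (q m n : nat).
Local Notation tau := (@tau R).

(** The mean square of [v] on the grid of Q equally spaced points; it is preserved exactly by the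
    rotations of order dividing Q when [v] is [tau]-periodic. *)
Definition energy Q v : R := average Q (fun y => v y ^+ 2) 0.

Lemma energy_ge0 Q v : 0 <= energy Q v.
Proof.
by rewrite /energy /average mulr_ge0 ?invr_ge0// sumr_ge0// => t _; exact: sqr_ge0.
Qed.

Lemma average_fine_id q m f x : (0 < q)%N -> (0 < m)%N -> periodic f tau ->
  average q (average (q * m) f) x = average (q * m) f x.
Proof.
move=> q0 m0 fp; apply: average_id => //; apply: (periodic_fine (m := m)) => //.
by apply: average_periodic; rewrite ?muln_gt0 ?q0.
Qed.

(** Pythagoras: averaging over the larger group sends V to W and lets W factor out, so the mean of V
    W on the grid is the energy of W. *)
Lemma energy_average_split q m n v : (0 < q)%N -> (0 < m)%N -> (0 < n)%N ->
  periodic v tau ->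
  energy (q * m * n) (fun x => average q v x - average (q * m) v x) =
  energy (q * m * n) (average q v) - energy (q * m * n) (average (q * m) v).
Proof.
move=> q0 m0 n0 vp; set V := average q v; set W := average (q * m) v.
have qm0 : (0 < q * m)%N by rewrite muln_gt0 q0.
have Vp : periodic V tau by exact: average_period_tau.
have Wp : periodic W (tau / (q * m)%:R) by exact: average_periodic.
have VW : average (q * m) V = W.
  by apply/funext => x; rewrite average_comm average_fine_id.
have cross : average (q * m * n) (fun x => V x * W x) 0 = energy (q * m * n) W.
  have VWp : periodic (fun x => V x * W x) tau.
    move=> x; rewrite Vp; congr (_ * _); exact: average_period_tau.
  rewrite -(average_fine_id 0 qm0 n0 VWp) average_comm.
  congr average; apply/funext => x.
  by rewrite average_mulr// VW expr2.
rewrite /energy.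
have -> : (fun y => (V y - W y) ^+ 2) =
    (fun y => (V y ^+ 2 - 2 * (V y * W y)) + W y ^+ 2).
  by apply/funext => y; ring.
by rewrite averageD averageB averageZ cross /energy; ring.
Qed.

(* The averages of v over the increasing chain of groups of order Q i are
   successive orthogonal projections for the inner product of mesh tau / Q n. *)
Lemma energy_chain (Q : nat -> nat) n v U : (forall i, 0 < Q i)%N ->
  (forall i, Q i %| Q i.+1)%N -> periodic v tau -> (forall x, `|v x| <= U) ->
  \sum_(i < n) energy (Q n) (fun x => average (Q i) v x - average (Q i.+1) v x)
    <= U ^+ 2.
Proof.
move=> Q0 Qd vp vU.
have Qdv i j : (i <= j)%N -> (Q i %| Q j)%N.
  by elim: j => [|j IH]; rewrite leq_eqVlt => /predU1P[->//|//] /IH/dvdn_trans; apply.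
have tele : forall m, (m <= n)%N ->
    \sum_(i < m) energy (Q n) (fun x => average (Q i) v x - average (Q i.+1) v x) =
    energy (Q n) (average (Q 0) v) - energy (Q n) (average (Q m) v).
  elim=> [|m IH] mn; first by rewrite big_ord0 subrr.
  rewrite big_ord_recr /= IH; last exact: ltnW.
  have /dvdnP[b Qb] := Qd m; have /dvdnP[d Qnd] := Qdv _ _ mn.
  have b0 : (0 < b)%N by have := Q0 m.+1; rewrite Qb muln_gt0 => /andP[].
  have d0 : (0 < d)%N by have := Q0 n; rewrite Qnd muln_gt0 => /andP[].
  have Qn : Q n = (Q m * b * d)%N by rewrite Qnd Qb mulnC [(b * _)%N]mulnC.
  have Qm : Q m.+1 = (Q m * b)%N by rewrite Qb mulnC.
  by rewrite Qm Qn energy_average_split//; ring.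
rewrite tele//; apply: (@le_trans _ _ (energy (Q n) (average (Q 0) v))).
  by rewrite gerBl energy_ge0.
rewrite /energy; apply: (le_trans (ler_norm _)); apply: average_bound => // x.
rewrite normrX lerXn2r ?nnegrE//; last exact: average_bound.
by apply: le_trans (vU 0); exact: normr_ge0.
Qed.

Lemma sum_periodic_nat (F : nat -> R) q M : (forall t, F (t + M)%N = F t) ->
  \sum_(t < q * M) F t = q%:R * \sum_(t < M) F t.
Proof.
move=> Fp; rewrite -!(big_mkord xpredT).
elim: q => [|q IH]; first by rewrite mul0n big_geq ?mul0r.
rewrite mulSn (big_cat_nat (n := M)) ?leq_addr//= -{2}[M]add0n big_addn addKn.
under [X in _ + X]eq_bigr do rewrite Fp.
by rewrite IH -nat1r mulrDl mul1r.
Qed.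

(** Cauchy-Schwarz on one period, in the form F <= (F^2 / s + s) / 2; by periodicity the sum over
    the whole grid is q times the sum over the M points of a period. Partial sums are what
    telescoping along a period will need. *)
Lemma energy_oscillation q M v (s : R) : (0 < q)%N -> (0 < M)%N -> 0 < s ->
  periodic v (tau / q%:R) -> energy (q * M) v <= s ^+ 2 ->
  forall m, (m <= M)%N ->
    \sum_(t < m) `|v (tau * t%:R / (q * M)%:R)| <= M%:R * s.
Proof.
move=> q0 M0 s0 vp vE m mM.
have qp : 0 < q%:R :> R by rewrite ltr0n.
have Mp : 0 < M%:R :> R by rewrite ltr0n.
have qMp : 0 < (q * M)%:R :> R by rewrite ltr0n muln_gt0 q0.
pose F t := `|v (tau * t%:R / (q * M)%:R)|.
have Fp t : F (t + M)%N = F t.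
  rewrite /F -[in RHS]vp; congr (`| v _ |); rewrite !natrD natrM.
  by field; rewrite !gt_eqF.
apply: (@le_trans _ _ (\sum_(t < M) F t)).
  rewrite -!(big_mkord xpredT (fun t => F t)) (big_cat_nat (n := m) (p := M))//=.
  by rewrite lerDl sumr_ge0// => t _; exact: normr_ge0.
rewrite -(ler_pM2l qp) -sum_periodic_nat//.
have Fs t : F t <= (F t ^+ 2 / s + s) / 2.
  rewrite ler_pdivlMr// -(ler_pM2r s0) mulrDl divfK ?gt_eqF//.
  by have := sqr_ge0 (F t - s); nra.
apply: (@le_trans _ _ (\sum_(t < q * M) ((F t ^+ 2 / s + s) / 2))).
  by apply: ler_sum => t _; exact: Fs.
rewrite -mulr_suml big_split /= -mulr_suml sumr_const card_ord.
have hE : \sum_(t < q * M) F t ^+ 2 <= (q * M)%:R * s ^+ 2.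
  rewrite mulrC -ler_pdivrMr// mulrC; apply: le_trans vE.
  rewrite /energy /average le_eqVlt; apply/orP; left; apply/eqP; congr (_ * _).
  by apply: eq_bigr => t _; rewrite /F real_normK ?num_real// add0r.
have hE2 : (\sum_(t < q * M) F t ^+ 2) / s <= (q * M)%:R * s.
  by rewrite ler_pdivrMr// -mulrA -expr2.
rewrite -[s *+ _]mulr_natl ler_pdivrMr//.
move: hE2; rewrite natrM; lra.
Qed.

End Energy.

Section OscillationChain.
Context {R : realType}.
Implicit Types (h : nat -> R -> R) (x y z w P : R).
Local Notation tau := (@tau R).

Lemma periodic_rep P x (u : R -> R) y : 0 < P -> periodic u P ->
  exists x', u x' = u x /\ y <= x' < y + P.
Proof.
move=> P0 up; pose m := Num.floor ((x - y) / P).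
exists (x - m%:~R * P); split.
  case: m => n.
    by rewrite -[in RHS](subrK (n%:~R * P) x) -[LHS](periodic_mul n _ up).
  by rewrite NegzE intrN mulNr opprK (periodic_mul n.+1 x up).
have h1 : m%:~R <= (x - y) / P by exact: floor_le.
have h2 : (x - y) / P < m%:~R + 1 by rewrite -intrD1; exact: floorD1_gt.
rewrite ler_pdivlMr// in h1; rewrite ltr_pdivrMr// in h2.
by apply/andP; split; lra.
Qed.

Lemma periodic_oscillation (u du : R -> R) P (S : R) x y : 0 < P -> periodic u P ->
  (forall z, is_derive z 1 u (du z)) -> (forall z, `|du z| <= S) ->
  `|u x - u y| <= P * S.
Proof.
move=> P0 up uD duS; have [x' [<- /andP[h1 h2]]] := periodic_rep x y P0 up.
apply: (le_trans (lipschitz_derive _ _ uD duS)); rewrite mulrC ler_wpM2r//.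
  by apply: le_trans (duS 0); exact: normr_ge0.
by rewrite ger0_norm ?subr_ge0//; lra.
Qed.

Lemma periodic_derive_zero (u du : R -> R) P : 0 < P -> periodic u P ->
  (forall z, is_derive z 1 u (du z)) -> exists x, du x = 0.
Proof.
move=> P0 up uD.
have cu : continuous u.
  by move=> z; apply/differentiable_continuous/derivable1_diffP.
have uP : u 0 = u P by rewrite -[P in RHS]add0r up.
have dru z : z \in `]0, P[%R -> derivable u z 1 by move=> _; have [] := uD z.
have [x _ x0] := Rolle P0 dru (continuous_subspaceT cu) uP.
by exists x; have [_ <-] := uD x; have [_ ->] := x0.
Qed.

Lemma periodic_derive_bound (u du ddu : R -> R) P (S : R) x : 0 < P -> periodic u P ->
  periodic du P -> (forall z, is_derive z 1 u (du z)) ->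
  (forall z, is_derive z 1 du (ddu z)) -> (forall z, `|ddu z| <= S) ->
  `|du x| <= P * S.
Proof.
move=> P0 up dup uD duD dduS; have [y y0] := periodic_derive_zero P0 up uD.
by have := periodic_oscillation x y P0 dup duD dduS; rewrite y0 subr0.
Qed.

(** The derivative of a periodic function vanishes somewhere, so each descent by one derivative
    costs a factor P. *)
Lemma oscillation_chain h n P (S : R) x y : 0 < P -> (forall j, periodic (h j) P) ->
  (forall j z, (j <= n)%N -> is_derive z 1 (h j) (h j.+1 z)) ->
  (forall z, `|h n.+1 z| <= S) -> `|h 0%N x - h 0%N y| <= P ^+ n.+1 * S.
Proof.
move=> P0 hp hD hS.
have bd i : (i <= n)%N -> forall z, `|h (n - i).+1 z| <= P ^+ i * S.
  elim: i => [|i IH] ilen z; first by rewrite subn0 mul1r.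
  rewrite exprS -mulrA.
  apply: (periodic_derive_bound z P0 (hp (n - i.+1)%N) (hp _)).
  - by move=> w; apply: hD; exact: leq_subr.
  - by move=> w; apply: hD; rewrite subnSK// leq_subr.
  - by rewrite subnSK//; apply: IH; exact: ltnW.
rewrite exprS -mulrA; apply: (periodic_oscillation _ _ P0 (hp 0%N)).
  by move=> z; exact: hD.
by have := bd n (leqnn n); rewrite subnn.
Qed.

End OscillationChain.

Section AverageDerivative.
Context {R : realType}.
Implicit Types (f df : R -> R) (x y z b : R) (q : nat).
Local Notation tau := (@tau R).

Lemma is_derive_shift f df x b : (forall z, is_derive z 1 f (df z)) ->
  is_derive x 1 (fun y => f (y + b)) (df (x + b)).
Proof.
move=> fD; have dS : is_derive x 1 ((id : R -> R) + cst b) (1 + 0) by exact: is_deriveD.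
have := @is_derive1_comp R f ((id : R -> R) + cst b) x _ _ (fD _) dS.
by rewrite addr0 mulr1.
Qed.

Lemma average_shift q f x b : average q (fun y => f (y + b)) x = average q f (x + b).
Proof.
by rewrite /average; congr (_ * _); apply: eq_bigr => t _; rewrite addrAC.
Qed.

Lemma average_derive q f df x : (forall z, is_derive z 1 f (df z)) ->
  is_derive x 1 (average q f) (average q df x).
Proof.
move=> fD.
have -> : average q f =
    q%:R^-1 *: \sum_(t < q) (fun y => f (y + tau * t%:R / q%:R)).
  by apply/funext => y; rewrite /average /= fct_sumE.
apply: is_deriveZ; apply: is_derive_sum => t; exact: is_derive_shift.
Qed.

End AverageDerivative.

Section AverageOscillation.
Context {R : realType} {k : nat}.
Implicit Types (x y z c : R).
Variables (g : Ck_circle R k.+2) (Q : nat -> nat).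
Hypothesis Q0 : forall i, (0 < Q i)%N.
Hypothesis Qd : forall i, (Q i %| Q i.+1)%N.
Local Notation tau := (@tau R).

(** The stand-in for tau / Q n times the derivative of order k + 2: its sums along the grid
    telescope to exact differences of the derivative of order k + 1. *)
Definition top_increment n x := derive1n k.+1 g (x + tau / (Q n)%:R) - derive1n k.+1 g x.

Let gD j z : (j <= k.+1)%N -> is_derive z 1 (derive1n j g) (derive1n j.+1 g z).
Proof. by move=> jk; apply: Ck_is_derive. Qed.

Let gp j : periodic (derive1n j g) tau.
Proof. exact/periodic_derive1n/Ck_periodic. Qed.

Let Qp i : 0 < (Q i)%:R :> R. Proof. by rewrite ltr0n. Qed.

Let Qdv i j : (i <= j)%N -> (Q i %| Q j)%N.
Proof.
by elim: j => [|j IH]; rewrite leq_eqVlt => /predU1P[->//|//] /IH/dvdn_trans; apply.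
Qed.

Lemma top_increment_periodic n : periodic (top_increment n) tau.
Proof. by move=> x; rewrite /top_increment addrAC !gp. Qed.

Lemma top_increment_bound n x : `|top_increment n x| <= `|g| * (tau / (Q n)%:R).
Proof.
have t0 := @tau_gt0 R.
have := lipschitz_derive x (x + tau / (Q n)%:R) (fun z => gD z (leqnn _))
  (fun z => Ck_der_bound g z (leqnn _)).
by rewrite addrAC subrr add0r (gtr0_norm (_ : 0 < tau / (Q n)%:R)) ?divr_gt0.
Qed.

Lemma top_increment_energy n :
  \sum_(i < n) energy (Q n) (fun x => average (Q i) (top_increment n) x -
     average (Q i.+1) (top_increment n) x) <= (`|g| * (tau / (Q n)%:R)) ^+ 2.
Proof.
apply: energy_chain => //; first exact: top_increment_periodic.
exact: top_increment_bound.
Qed.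

Let average_per i f : periodic f tau -> periodic (average (Q i) f) (tau / (Q i)%:R).
Proof. exact: average_periodic. Qed.

Lemma average_top_bound i x :
  `|average (Q i) (derive1n k.+1 g) x| <= tau / (Q i)%:R * `|g|.
Proof.
have P0 : 0 < tau / (Q i)%:R by rewrite divr_gt0// tau_gt0.
apply: (periodic_derive_bound (u := average (Q i) (derive1n k g))
  (ddu := average (Q i) (derive1n k.+2 g)) x P0).
- exact: average_per.
- exact: average_per.
- by move=> z; apply: average_derive => w; exact: gD.
- by move=> z; apply: average_derive => w; exact: gD.
- by move=> z; apply: average_bound => // w; exact: Ck_der_bound.
Qed.

(** On the grid, telescoping and [energy_oscillation] bound the variation of the difference [Di] by
    c tau / Q i; off the grid its Lipschitz constant 2 |g| costs at most 2 |g| tau / Q (i+1). Both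
    errors count twice, since [x] and a zero of [Di] given by Rolle are each compared with 0. *)
Lemma average_step_bound n i c x : (i < n)%N -> 0 < c ->
  energy (Q n) (fun x => average (Q i) (top_increment n) x -
     average (Q i.+1) (top_increment n) x) <= (tau / (Q n)%:R * c) ^+ 2 ->
  `|average (Q i) (derive1n k.+1 g) x - average (Q i.+1) (derive1n k.+1 g) x|
    <= tau / (Q i)%:R * (2 * c + 4 * `|g| * ((Q i)%:R / (Q i.+1)%:R)).
Proof.
move=> iltn c0 small; have t0 := @tau_gt0 R.
pose Di x := average (Q i) (derive1n k.+1 g) x - average (Q i.+1) (derive1n k.+1 g) x.
have /dvdnP[b Qib] := Qd i.
have /dvdnP[M QM] := Qdv (ltnW iltn).
have b0 : (0 < b)%N by have := Q0 i.+1; rewrite Qib muln_gt0 => /andP[].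
have M0 : (0 < M)%N by have := Q0 n; rewrite QM muln_gt0 => /andP[].
have P0 : 0 < tau / (Q i)%:R by rewrite divr_gt0.
have e0 : 0 < tau / (Q n)%:R by rewrite divr_gt0.
have fine f : periodic f tau ->
    periodic (fun x => average (Q i) f x - average (Q i.+1) f x) (tau / (Q i)%:R).
  move=> fp y; rewrite (average_per i fp).
  by rewrite (periodic_fine (m := b) _ _ (f := average (Q i.+1) f))// mulnC -Qib; exact: average_per.
have DiP : periodic Di (tau / (Q i)%:R) by exact: fine.
have diffD j z : (j <= k.+1)%N ->
    is_derive z 1 (fun x => average (Q i) (derive1n j g) x - average (Q i.+1) (derive1n j g) x)
     (average (Q i) (derive1n j.+1 g) z - average (Q i.+1) (derive1n j.+1 g) z).
  move=> jk; apply: (@is_deriveB _ _ _ (average (Q i) (derive1n j g)) (average (Q i.+1) (derive1n j g)));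
    by apply: average_derive => w; exact: gD.
have Dilip y z : `|Di y - Di z| <= 2 * `|g| * `|y - z|.
  have dub w : `|average (Q i) (derive1n k.+2 g) w - average (Q i.+1) (derive1n k.+2 g) w|
      <= 2 * `|g|.
    apply: (le_trans (ler_normB _ _)); rewrite mulr2n mulrDl mul1r.
    by apply: lerD; apply: average_bound => // u; exact: Ck_der_bound.
  exact: (lipschitz_derive z y (fun w => diffD k.+1 w (leqnn _)) dub).
have [x0 Dx0] := periodic_derive_zero P0 (fine _ (gp k)) (fun z => diffD k z (leqnSn k)).
have mesh m : (m <= M)%N -> `|Di (tau / (Q n)%:R * m%:R) - Di 0| <= M%:R * (tau / (Q n)%:R * c).
  move=> mM.
  pose vi x := average (Q i) (top_increment n) x - average (Q i.+1) (top_increment n) x.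
  have viE y : vi y = Di (y + tau / (Q n)%:R) - Di y.
    by rewrite /vi /Di /top_increment !averageB !(average_shift _ (derive1n k.+1 g)); ring.
  have tele : Di (tau / (Q n)%:R * m%:R) - Di 0 =
      \sum_(t < m) vi (tau * t%:R / (Q i * M)%:R).
    elim: m {mM} => [|m IH]; first by rewrite big_ord0 mulr0 subrr.
    rewrite big_ord_recr /= -IH viE mulnC -QM.
    have -> : tau / (Q n)%:R * m.+1%:R = tau * m%:R / (Q n)%:R + tau / (Q n)%:R.
      by rewrite -natr1; ring.
    have -> : tau / (Q n)%:R * m%:R = tau * m%:R / (Q n)%:R by ring.
    ring.
  rewrite tele; apply: (le_trans (ler_norm_sum _ _ _)).
  apply: (energy_oscillation (q := Q i) (v := vi)) => //.
  - by rewrite mulr_gt0.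
  - by apply: fine; exact: top_increment_periodic.
  - by rewrite mulnC -QM.
have near0 y : `|Di y - Di 0| <= 2 * `|g| * (tau / (Q n)%:R) + M%:R * (tau / (Q n)%:R * c).
  have [y' [<- /andP[y0 yP]]] := periodic_rep y 0 P0 DiP; rewrite add0r in yP.
  pose m := Num.truncn (y' / (tau / (Q n)%:R)).
  have /truncn_itv/andP[m1 m2] : 0 <= y' / (tau / (Q n)%:R) by rewrite divr_ge0// ltW.
  rewrite -/m ler_pdivlMr// in m1; rewrite -/m ltr_pdivrMr// in m2.
  have mM : (m <= M)%N.
    rewrite -(ler_nat R) -(ler_pM2r e0); apply: (le_trans m1); apply: (le_trans (ltW yP)).
    have fld (T a d : R) : a != 0 -> d != 0 -> T / d = a * (T / (a * d)).
      by move=> a0 d0; field; rewrite ?a0 ?d0.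
    by rewrite QM natrM -fld// gt_eqF// ltr0n.
  have -> : Di y' - Di 0 = (Di y' - Di (tau / (Q n)%:R * m%:R)) +
      (Di (tau / (Q n)%:R * m%:R) - Di 0) by ring.
  apply: (le_trans (ler_normD _ _)); apply: lerD; last exact: mesh.
  apply: (le_trans (Dilip _ _)); rewrite ler_wpM2l ?mulr_ge0//.
  by rewrite ger0_norm; move: m2; rewrite -natr1; lra.
have -> : average (Q i) (derive1n k.+1 g) x - average (Q i.+1) (derive1n k.+1 g) x =
    (Di x - Di 0) - (Di x0 - Di 0) by rewrite /Di Dx0; ring.
apply: (le_trans (ler_normB _ _)); apply: (le_trans (lerD (near0 x) (near0 x0))).
have ME : M%:R * (tau / (Q n)%:R * c) = tau / (Q i)%:R * c.
  have fld (T a d : R) : a != 0 -> d != 0 -> a * (T / (a * d) * c) = T / d * c.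
    by move=> a0 d0; field; rewrite ?a0 ?d0.
  by rewrite QM natrM fld// gt_eqF// ltr0n.
have QE : tau / (Q n)%:R <= tau / (Q i)%:R * ((Q i)%:R / (Q i.+1)%:R).
  rewrite -mulrA mulKf ?gt_eqF// ler_pM2l// lef_pV2 ?posrE//.
  by rewrite ler_nat; apply: dvdn_leq => //; exact: Qdv.
have := ler_wpM2l (mulr_ge0 (ler0n R 4) (normr_ge0 g)) QE.
rewrite ME; lra.
Qed.

(** The average of order Q (i+1) of the derivative of order k + 1 is at most |g| tau / Q (i+1),
    which turns the 4 of the previous bound into 5. Then [oscillation_chain] brings the estimate
    down to [g]. *)
Lemma average_oscillation n i c x y : (i < n)%N -> 0 < c ->
  energy (Q n) (fun x => average (Q i) (top_increment n) x -
     average (Q i.+1) (top_increment n) x) <= (tau / (Q n)%:R * c) ^+ 2 ->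
  `|average (Q i) g x - average (Q i) g y|
    <= (tau / (Q i)%:R) ^+ k.+2 * (2 * c + 5 * `|g| * ((Q i)%:R / (Q i.+1)%:R)).
Proof.
move=> iltn c0 small; have t0 := @tau_gt0 R.
have P0 : 0 < tau / (Q i)%:R by rewrite divr_gt0.
have top z : `|average (Q i) (derive1n k.+1 g) z| <=
    tau / (Q i)%:R * (2 * c + 5 * `|g| * ((Q i)%:R / (Q i.+1)%:R)).
  rewrite -[X in `|X|](subrK (average (Q i.+1) (derive1n k.+1 g) z)).
  apply: (le_trans (ler_normD _ _)).
  apply: (le_trans (lerD (average_step_bound z iltn c0 small) (average_top_bound i.+1 z))).
  have -> : tau / (Q i.+1)%:R = tau / (Q i)%:R * ((Q i)%:R / (Q i.+1)%:R).
    by rewrite -mulrA mulKf// gt_eqF.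
  by rewrite le_eqVlt; apply/orP; left; apply/eqP; ring.
rewrite exprSr -mulrA.
apply: (oscillation_chain (h := fun j => average (Q i) (derive1n j g)) _ _ P0) => //.
- by move=> j; exact: average_per.
- by move=> j z jk; apply: average_derive => w; apply: gD; exact: leqW.
Qed.

End AverageOscillation.

(** * The random function *)

Section DerivativeEpsilon.
Context {R : realType}.
Implicit Types (f : R -> R) (x y d e : R).

Lemma is_derive_realP f x d : is_derive x 1 f d <->
  forall e, 0 < e -> exists2 s, 0 < s &
    forall y, `|y - x| < s -> `|f y - f x - d * (y - x)| <= e * `|y - x|.
Proof.
pose Q h := h^-1 *: (f (h *: 1 + x) - f x).
have QE h : Q h = (f (h + x) - f x) / h.
  by rewrite /Q /GRing.scale /= mulr1 mulrC.
split=> [[fd fdE] e e0|H].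
  have cQ : Q @ 0^' --> d by rewrite -fdE; exact: fd.
  move/cvgrPdist_le : cQ => /(_ e e0) /nbhs_realP[s s0 sP].
  exists s => // y yx; have [->|yx0] := eqVneq y x.
    by rewrite !subrr mulr0 subr0 normr0 mulr0.
  have h0 : y - x != 0 by rewrite subr_eq0.
  have := sP (y - x); rewrite subr0 QE subrK => /(_ yx h0) h.
  have -> : f y - f x - d * (y - x) = - ((d - (f y - f x) / (y - x)) * (y - x)).
    by rewrite mulrBl divfK//; ring.
  by rewrite normrN normrM ler_wpM2r.
have cQ : Q @ 0^' --> d.
  apply/cvgrPdist_le => e e0; have [s s0 sP] := H e e0.
  apply/nbhs_realP; exists s => // h; rewrite subr0 => hs h0.
  have := sP (h + x); rewrite addrK => /(_ hs) hb; rewrite QE.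
  have -> : d - (f (h + x) - f x) / h = - ((f (h + x) - f x - d * h) / h).
    by rewrite [(_ - d * h) / h]mulrBl mulfK//; ring.
  by rewrite normrN normrM normfV ler_pdivrMr ?normr_gt0.
by apply: DeriveDef; [exact: cvgP cQ|exact: cvg_lim cQ].
Qed.

End DerivativeEpsilon.

(** * Sums of geometrically dominated series in C^k *)

Section CkSeries.
Context {R : realType} {k : nat}.
Implicit Types (x y z : R).
Local Notation X := (Ck_circle R k).

Lemma geometric_half n m : (n <= m)%N ->
  \sum_(n <= j < m) (2^-1 : R) ^+ j <= 2 * 2^-1 ^+ n.
Proof.
move=> nm; suff -> : \sum_(n <= j < m) (2^-1 : R) ^+ j = 2 * (2^-1 ^+ n - 2^-1 ^+ m).
  by rewrite ler_pM2l// gerBl exprn_ge0// invr_ge0.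
elim: m nm => [|m IH]; first by rewrite leqn0 => /eqP->; rewrite big_geq// subrr mulr0.
rewrite leq_eqVlt => /predU1P[->|]; first by rewrite big_geq// subrr mulr0.
rewrite ltnS => nm; rewrite big_nat_recr//= IH// exprS.
by field.
Qed.

Lemma Ck_derB (f g : X) i x : (i <= k)%N ->
  derive1n i (f - g : X) x = derive1n i f x - derive1n i g x.
Proof.
move=> ik; have := @derive1n_lin R k (-1) g f i (proj2 (Ck_circleP _)) (proj2 (Ck_circleP _)) ik.
have -> : (-1 : R) *: (g : R -> R) + f = (f - g : X).
  by apply/funext => z; rewrite scaleN1r addrC.
by move=> ->; rewrite scaleN1r addrC.
Qed.

Variables (F : nat -> X) (C : R).
Hypothesis FC : forall j, `|F j| <= C * 2^-1 ^+ j.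

Let P n : X := \sum_(j < n) F j.

Let C0 : 0 <= C.
Proof. by have := FC 0; rewrite expr0 mulr1; exact: le_trans. Qed.

Let P_dist n m : (n <= m)%N -> `|P m - P n| <= 2 * C * 2^-1 ^+ n.
Proof.
move=> nm; rewrite /P -!(big_mkord xpredT) (big_cat_nat (n := n))//= addrAC subrr add0r.
apply: (le_trans (ler_norm_sum _ _ _)).
apply: (@le_trans _ _ (\sum_(n <= j < m) C * 2^-1 ^+ j)).
  by apply: ler_sum => j _; exact: FC.
by rewrite -mulr_sumr; have := ler_wpM2l C0 (geometric_half nm); lra.
Qed.

Let P_der i n m x : (i <= k)%N -> (n <= m)%N ->
  `|derive1n i (P m) x - derive1n i (P n) x| <= 2 * C * 2^-1 ^+ n.
Proof.
move=> ik nm; apply: le_trans (P_dist nm).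
have -> : derive1n i (P m) x - derive1n i (P n) x = derive1n i (P m - P n : X) x.
  by rewrite Ck_derB.
exact: Ck_der_bound.
Qed.

Let r n : R := 2 * C * 2^-1 ^+ n.

Let r_ge0 n : 0 <= r n.
Proof. by rewrite /r !mulr_ge0// exprn_ge0// invr_ge0. Qed.

Let r_small (e : R) N : 0 < e -> exists2 n, (N <= n)%N & r n <= e.
Proof.
move=> e0; have C1 : 0 < 2 * C + 1 by rewrite ltr_wpDl// mulr_ge0.
exists (maxn N (Num.bound ((2 * C + 1) / e))); first exact: leq_maxl.
set n := maxn _ _.
have h1 : (2 * C + 1) / e < n%:R.
  apply: (@lt_le_trans _ _ (Num.bound ((2 * C + 1) / e))%:R).
    by apply: archi_boundP; rewrite divr_ge0// ltW.
  by rewrite ler_nat leq_maxr.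
have h2 : (n%:R : R) < 2 ^+ n by rewrite -natrX ltr_nat ltn_expl.
rewrite /r exprVn ler_pdivrMr ?exprn_gt0//.
rewrite ltr_pdivrMr// in h1.
by have := ltr_pM2l e0 n%:R (2 ^+ n); rewrite h2 => h3; lra.
Qed.

(** The limit of the derivatives of order i, written as a supremum of lower bounds so that its
    distance to the n-th partial sum is at most [r n] by construction. *)
Let G i x : R := sup (range (fun n => derive1n i (P n) x - r n)).

Let G_dist i n x : (i <= k)%N -> `|G i x - derive1n i (P n) x| <= r n.
Proof.
move=> ik.
have cross m l : derive1n i (P m) x - r m <= derive1n i (P l) x + r l.
  have [ml|lm] := leqP m l.
    have := P_der x ik ml; rewrite ler_norml -/(r m) => /andP[h _].
    by have := r_ge0 l; lra.
  have := P_der x ik (ltnW lm); rewrite ler_norml -/(r l) => /andP[_ h].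
  by have := r_ge0 m; lra.
have ub : has_ubound (range (fun n => derive1n i (P n) x - r n)).
  by exists (derive1n i (P 0) x + r 0) => _ [m _ <-].
rewrite ler_norml; apply/andP; split.
  rewrite lerBrDl; apply: ub_le_sup => //; by exists n.
rewrite lerBlDl; apply: ge_sup; first by exists (derive1n i (P 0) x - r 0), 0%N.
by move=> _ [m _ <-]; exact: cross.
Qed.

(** The mean value bound for P m - P n, passed to the limit in m. It lets the difference quotients
    of [G i] inherit those of a partial sum, whence termwise differentiation. *)
Let G_incr i n x y : (i < k)%N ->
  `|(G i y - derive1n i (P n) y) - (G i x - derive1n i (P n) x)| <= r n * `|y - x|.
Proof.
move=> ik; apply/ler_addgt0Pr => e e0.
have [m nm rm] := r_small n (divr_gt0 e0 (ltr0Sn R 1)).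
have D l z : is_derive z 1 (derive1n i (P l)) (derive1n i.+1 (P l) z).
  exact: Ck_is_derive.
have h1 := G_dist m x (ltnW ik); have h2 := G_dist m y (ltnW ik).
have h3 : `|(derive1n i (P m) y - derive1n i (P n) y) -
    (derive1n i (P m) x - derive1n i (P n) x)| <= r n * `|y - x|.
  have DB z : is_derive z 1 (fun z => derive1n i (P m) z - derive1n i (P n) z)
      (derive1n i.+1 (P m) z - derive1n i.+1 (P n) z).
    exact: (is_deriveB (D m z) (D n z)).
  exact: (lipschitz_derive x y DB (fun z => P_der z ik nm)).
move: h1 h2 h3; rewrite !ler_norml => /andP[a1 a2] /andP[b1 b2] /andP[c1 c2].
by apply/andP; split; lra.
Qed.

Let G_derive i x : (i < k)%N -> is_derive x 1 (G i) (G i.+1 x).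
Proof.
move=> ik; apply/is_derive_realP => e e0.
have e3 : 0 < e / 3 by rewrite divr_gt0.
have [n _ rn] := r_small 0 e3.
have := Ck_is_derive (P n) x ik; move=> /is_derive_realP /(_ _ e3)[s s0 sP].
exists s => // y /sP h1; have h2 := G_incr n x y ik; have h3 := G_dist n x ik.
have -> : G i y - G i x - G i.+1 x * (y - x) =
    ((G i y - derive1n i (P n) y) - (G i x - derive1n i (P n) x)) +
    (derive1n i (P n) y - derive1n i (P n) x - derive1n i.+1 (P n) x * (y - x)) -
    (G i.+1 x - derive1n i.+1 (P n) x) * (y - x) by ring.
apply: (le_trans (ler_normB _ _)); rewrite [X in _ + X]normrM.
have := ler_normD ((G i y - derive1n i (P n) y) - (G i x - derive1n i (P n) x))
    (derive1n i (P n) y - derive1n i (P n) x - derive1n i.+1 (P n) x * (y - x)).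
have n0 := normr_ge0 (y - x).
have := ler_wpM2r n0 rn; have := ler_wpM2r n0 h3.
move: h1 h2; lra.
Qed.

Let G_continuous : continuous (G k).
Proof.
move=> x; apply/cvgrPdist_le => e e0; have e3 : 0 < e / 3 by rewrite divr_gt0.
have [n _ rn] := r_small 0 e3.
have [_ [_ cP]] := Ck_circleP (P n).
have [s s0 sP] := continuous_realP (cP x) e3.
apply/nbhs_realP; exists s => // y /sP /ltW; rewrite ler_norml => /andP[h1 h2].
have := G_dist n x (leqnn k); have := G_dist n y (leqnn k).
rewrite !ler_norml => /andP[a1 a2] /andP[b1 b2]; apply/andP; split; lra.
Qed.

Let G_iter i : (i <= k)%N -> derive1n i (G 0) = G i.
Proof.
elim: i => // i IH ik; rewrite derive1nS IH ?(ltnW ik)//.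
by apply/funext => x; rewrite derive1E; have [_ ->] := G_derive x ik.
Qed.

Let G_Ck : G 0 \in @Ck_circle_pred R k.
Proof.
apply/mem_set; split.
  move=> x; rewrite /G.
  have -> // : (fun n => derive1n 0 (P n) (x + pi *+ 2) - r n) =
      (fun n => derive1n 0 (P n) x - r n).
  by apply/funext => n; congr (_ - _); exact: (Ck_periodic (P n)).
split=> [j jk x|]; last by rewrite G_iter//; exact: G_continuous.
by rewrite G_iter ?(ltnW jk)//; have [] := G_derive x jk.
Qed.

Lemma Ck_series_sum : exists S : X, forall n,
  `|S - \sum_(j < n) F j| <= k.+1%:R * (2 * C) * 2^-1 ^+ n.
Proof.
exists (CkCircle G_Ck) => n; change (Ck_norm (CkCircle G_Ck - P n) <= k.+1%:R * (2 * C) * 2^-1 ^+ n).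
rewrite -mulrA -/(r n) /Ck_norm; apply: (@le_trans _ _ (\sum_(j < k.+1) r n)).
  apply: ler_sum => j _; apply: sup_norm_le => x.
  have jk : (j <= k)%N by rewrite -ltnS.
  have -> : derive1n j (CkCircle G_Ck - P n : X) x = derive1n j (G 0) x - derive1n j (P n) x.
    exact: (Ck_derB (CkCircle G_Ck)).
  by rewrite G_iter//; exact: G_dist.
by rewrite sumr_const card_ord mulr_natl.
Qed.

End CkSeries.

Section Cosines.
Context {R : realType}.
Implicit Types (x y z : R) (m q j n : nat).
Local Notation tau := (@tau R).

Definition cosm m x : R := cos (m%:R * x).

Lemma cosm_der m j :
  derive1n j (cosm m) = (fun x => m%:R ^+ j * cos (m%:R * x + j%:R * (pi / 2))).
Proof.
elim: j => [|j IH].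
  by apply/funext => x; rewrite /= expr0 mul1r mul0r addr0.
rewrite derive1nS IH; apply/funext => x; rewrite derive1E.
have dA : is_derive x 1 (m%:R *: (id : R -> R) + cst (j%:R * (pi / 2))) (m%:R *: 1 + 0).
  exact: is_deriveD.
have dC := @is_derive1_comp R cos _ x _ _ (is_derive_cos _) dA.
have [_ ->] := is_deriveZ (m%:R ^+ j) dC.
rewrite addr0 /GRing.scale /= mulr1.
have -> : m%:R * x + j.+1%:R * (pi / 2) = (m%:R * x + j%:R * (pi / 2)) + pi / 2.
  by rewrite -natr1; ring.
by rewrite cosDpihalf exprSr /cst !fctE /GRing.scale /=; ring.
Qed.

Lemma cosm_derivable m j x : derivable (derive1n j (cosm m)) x 1.
Proof.
rewrite cosm_der.
have dA : is_derive x 1 (m%:R *: (id : R -> R) + cst (j%:R * (pi / 2))) (m%:R *: 1 + 0).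
  exact: is_deriveD.
have dC := @is_derive1_comp R cos _ x _ _ (is_derive_cos _) dA.
by have [] := is_deriveZ (m%:R ^+ j) dC.
Qed.

Lemma cosm_periodic m : periodic (cosm m) tau.
Proof.
move=> x; rewrite /cosm mulrDr -(periodic_mul m (m%:R * x) (@cosD2pi R)).
by congr cos.
Qed.

Lemma cosm_Ck k m : cosm m \in @Ck_circle_pred R k.
Proof.
apply/mem_set; split; first exact: cosm_periodic.
split=> [j _ x|x]; first exact: cosm_derivable.
by apply/differentiable_continuous/derivable1_diffP; exact: cosm_derivable.
Qed.

Definition cos_Ck k m : Ck_circle R k := CkCircle (cosm_Ck k m).

Lemma cos_Ck_norm k m : (0 < m)%N -> `|cos_Ck k m| <= k.+1%:R * m%:R ^+ k.
Proof.
move=> m0; change (Ck_norm (cos_Ck k m) <= k.+1%:R * m%:R ^+ k).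
apply: (@le_trans _ _ (\sum_(j < k.+1) m%:R ^+ k)); last first.
  by rewrite sumr_const card_ord mulr_natl.
apply: ler_sum => j _; apply: sup_norm_le => x.
rewrite /= cosm_der normrM normrX ger0_norm//.
apply: (@le_trans _ _ (m%:R ^+ j * 1)).
  rewrite ler_wpM2l ?exprn_ge0// ler_norml.
  by rewrite cos_geN1 cos_le1.
by rewrite mulr1 ler_weXn2l ?ler1n// -ltnS.
Qed.

Lemma cosm_bound m x : `|cosm m x| <= 1.
Proof. by rewrite ler_norml cos_geN1 cos_le1. Qed.

Lemma average_cosm_high q m y : (0 < q)%N -> (q %| m)%N ->
  average q (cosm m) y = cosm m y.
Proof.
move=> q0 /dvdnP[d ->]; apply: average_id => // x.
rewrite /cosm mulrDr -[RHS](periodic_mul d _ (@cosD2pi R)); congr (cos (_ + _)).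
by rewrite -/tau natrM -mulrA [q%:R * _]mulrC divfK// pnatr_eq0 -lt0n.
Qed.

(** The shift by tau / (2m) is a rotation of order dividing q, so it preserves the average, yet it
    changes the sign of cos (m x). *)
Lemma average_cosm_low q m y : (0 < q)%N -> (0 < m)%N -> (2 * m %| q)%N ->
  average q (cosm m) y = 0.
Proof.
move=> q0 m0 /dvdnP[d qd].
have d0 : (0 < d)%N by move: q0; rewrite qd muln_gt0 => /andP[].
have ap := average_periodic q0 (cosm_periodic m).
have h1 : average q (cosm m) (y + d%:R * (tau / q%:R)) = average q (cosm m) y.
  exact: periodic_mul.
have h2 : average q (cosm m) (y + d%:R * (tau / q%:R)) = - average q (cosm m) y.
  rewrite -average_shift -[RHS]mulN1r -averageZ; congr average.
  apply/funext => x; rewrite /cosm mulrDr mulN1r -cosDpi; congr (cos (_ + _)).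
  rewrite qd !natrM /tau -[pi *+ 2]mulr_natl.
  by field; rewrite !pnatr_eq0 -!lt0n m0 d0.
by move: h1; rewrite h2; lra.
Qed.

Lemma uniform_arcs N : (0 < N)%N ->
  let y (s : 'I_N) := tau * s%:R / N%:R in
  let z (s : 'I_N) := tau * s%:R / N%:R + tau / (2 * N%:R) in
  [/\ separated_arcs y z, forall s, cosm N (y s) = 1 & forall s, cosm N (z s) = -1].
Proof.
move=> N0 y z; have t0 := @tau_gt0 R.
have Np : 0 < N%:R :> R by rewrite ltr0n.
have Nn : N%:R != 0 :> R by rewrite gt_eqF.
pose u : R := tau / (2 * N%:R).
have u0 : 0 < u by rewrite divr_gt0// mulr_gt0.
have yE s : y s = u * (2 * s%:R).
  have fld (T r a : R) : r != 0 -> T * a / r = T / (2 * r) * (2 * a).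
    by move=> r0; field; rewrite ?r0.
  exact: fld.
have zE s : z s = u * (2 * s%:R + 1) by rewrite /z -/(y s) yE -/u; ring.
have tE : tau = u * (2 * N%:R) by rewrite /u divfK// mulf_neq0.
split=> [|s|s].
- split=> [s|s s' ss' v w]; first by rewrite yE zE ltr_pM2l// ltrDl.
  rewrite !yE !zE => /andP[v1 v2] /andP[w1 w2] /cpiE[l vw].
  have sN (t : 'I_N) : 2 * t%:R + 2 <= 2 * N%:R :> R.
    by have := ltn_ord t; rewrite -(ler_nat R) -natr1; lra.
  have b1 := ler_wpM2l (ltW u0) (sN s); have b2 := ler_wpM2l (ltW u0) (sN s').
  have p1 := mulr_ge0 (ltW u0) (mulr_ge0 (ler0n R 2) (ler0n R s)).
  have p2 := mulr_ge0 (ltW u0) (mulr_ge0 (ler0n R 2) (ler0n R s')).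
  have l0 : l%:~R * tau = 0.
    case: (ltgtP (l%:~R * tau) 0) => // hl; exfalso.
      apply: (@int_tau_small R (- l)); rewrite intrN mulNr oppr_gt0 hl /=.
      by move: v1 v2 w1 w2 b1 b2 vw; rewrite tE; lra.
    apply: (@int_tau_small R l); rewrite hl /=.
    by move: v1 v2 w1 w2 b1 b2 vw; rewrite tE; lra.
  rewrite l0 addr0 in vw; subst v.
  have cmp (t t' : 'I_N) : (t < t')%N -> u * (2 * t%:R + 1) < u * (2 * t'%:R).
    by move=> tt'; rewrite ltr_pM2l//; move: tt'; rewrite -(ler_nat R) -natr1; lra.
  case: (ltngtP s s') => [/cmp|/cmp|/val_inj//]; lra.
- rewrite /cosm /y mulrCA divff// mulr1 mulrC -[_ * tau]add0r.
  by rewrite (periodic_mul s 0 (@cosD2pi R)) cos0.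
- rewrite /cosm /z mulrDr mulrCA divff// mulr1 [tau * _]mulrC addrC.
  rewrite (periodic_mul s _ (@cosD2pi R)).
  have -> : N%:R * (tau / (2 * N%:R)) = pi.
    by rewrite /tau -[pi *+ 2]mulr_natl; field.
  exact: cospi.
Qed.

End Cosines.

Section Weights.
Context {R : realType}.
Implicit Types (x y t : R) (i n : nat).

(* [weight i] is the tent of height 1 and half-width 1 centred at i; as a difference
   of clamps, the sum over i telescopes. *)
Definition clamp t : R := Order.min 1 (Order.max 0 t).
Definition weight i y : R := clamp (y - i%:R + 1) - clamp (y - i%:R).

Lemma clamp_le t t' : t <= t' -> clamp t <= clamp t'.
Proof.
move=> tt'; rewrite /clamp le_min ge_min lexx /= ge_min; apply/orP; right.
by rewrite ge_max !le_max lexx /= tt' orbT.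
Qed.

Lemma clamp_itv t : 0 <= clamp t <= 1.
Proof. by rewrite /clamp le_min ler01 le_max lexx /= ge_min lexx. Qed.

Lemma clamp_id t : 0 <= t <= 1 -> clamp t = t.
Proof. by move=> /andP[t0 t1]; rewrite /clamp max_r// min_r. Qed.

Lemma clamp_ge1 t : 1 <= t -> clamp t = 1.
Proof. by move=> t1; rewrite /clamp max_r ?(le_trans ler01)// min_l. Qed.

Lemma clamp_le0 t : t <= 0 -> clamp t = 0.
Proof. by move=> t0; rewrite /clamp max_l// min_r. Qed.

Lemma clamp_continuous : continuous clamp.
Proof.
move=> t; apply: (@continuous_min _ _ (fun=> 1) (fun t => Order.max 0 t)).
  exact: cvg_cst.
apply: (@continuous_max _ _ (fun=> 0) id); [exact: cvg_cst|exact: cvg_id].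
Qed.

Lemma weight_continuous i : continuous (weight i).
Proof.
move=> y; apply: cvgB.
  apply: (@continuous_comp _ _ _ (fun y => y - i%:R + 1) clamp); last exact: clamp_continuous.
  by apply: cvgD; [apply: cvgB; [exact: cvg_id|exact: cvg_cst]|exact: cvg_cst].
apply: (@continuous_comp _ _ _ (fun y => y - i%:R) clamp); last exact: clamp_continuous.
by apply: cvgB; [exact: cvg_id|exact: cvg_cst].
Qed.

Lemma weight_ge0 i y : 0 <= weight i y.
Proof. by rewrite subr_ge0; apply: clamp_le; rewrite lerDl. Qed.

Lemma weight_sum n y : \sum_(i < n) weight i y <= 1.
Proof.
suff -> : \sum_(i < n) weight i y = clamp (y + 1) - clamp (y - n%:R + 1).
  by have /andP[_ h1] := clamp_itv (y + 1); have /andP[h2 _] := clamp_itv (y - n%:R + 1); lra.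
elim: n => [|n IH]; first by rewrite big_ord0 subr0 subrr.
rewrite big_ord_recr /= IH /weight.
have -> : y - n.+1%:R + 1 = y - n%:R by rewrite -natr1; ring.
ring.
Qed.

Lemma weight_half i y : `|y - i%:R| <= 2^-1 -> 2^-1 <= weight i y.
Proof.
rewrite /weight; move: (y - i%:R) => t; rewrite ler_norml => /andP[t1 t2].
have [t0|t0] := leP 0 t.
  by rewrite clamp_ge1 ?clamp_id; lra.
by rewrite [clamp t]clamp_le0 ?clamp_id ?(ltW t0)//; lra.
Qed.

End Weights.

(** * The random series and its averages *)

Section Noise.
Context {R : realType} {k : nat}.
Hypothesis k2 : (2 <= k)%N.
Implicit Types (x y t : R) (i j n m : nat).
Local Notation tau := (@tau R).
Local Notation X := (Ck_circle R k).

(* In block j the random dilation 2 ^ (n ^ 2), n = block j + i, is picked by the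
   parameter t through the tents [weight i (block j * t)].  The squares make the
   ratios of consecutive dilations huge, and the length of a block is
   chosen so that the places that are [bad] for a given g are a small proportion of it. *)
Definition block j : nat := 2 ^ ((2 * k + 3) * j).
Definition dilation n : nat := 2 ^ (n ^ 2).
Definition freq j n : nat := 2 ^ (j + n ^ 2).
Definition amplitude j n : R := 2^-1 ^+ j * (freq j n)%:R^-1 ^+ k.
Definition mode j n : X := amplitude j n *: cos_Ck k (freq j n).
Definition noise j t : X :=
  \sum_(i < (block j).+1) weight i ((block j)%:R * t) *: mode j (block j + i).

Lemma freq_gt0 j n : (0 < freq j n)%N. Proof. by rewrite expn_gt0. Qed.
Lemma dilation_gt0 n : (0 < dilation n)%N. Proof. by rewrite expn_gt0. Qed.
Lemma block_gt0 j : (0 < block j)%N. Proof. by rewrite expn_gt0. Qed.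

Lemma freqE j n : freq j n = (dilation n * 2 ^ j)%N.
Proof. by rewrite /freq expnD mulnC. Qed.

Lemma amplitude_gt0 j n : 0 < amplitude j n.
Proof. by rewrite mulr_gt0// exprn_gt0// invr_gt0 ?ltr0n ?freq_gt0. Qed.

Lemma block_lt j' j : (j' < j)%N -> (8 * block j' <= block j)%N.
Proof.
move=> jj; rewrite /block -[8%N]/(2 ^ 3)%N -expnD leq_exp2l//.
by have := leq_mul (leqnn (2 * k + 3)) jj; rewrite mulnS; lia.
Qed.

Lemma leq_block j : (j <= block j)%N.
Proof.
apply: (@leq_trans (2 ^ j)); first by rewrite ltnW// ltn_expl.
by rewrite leq_exp2l// leq_pmull// addn_gt0 orbT.
Qed.

(** In [amplitude] the power freq^-k compensates the growth of the derivative of order k; the factor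
    2^-j makes the series converge. *)
Lemma mode_norm j n : `|mode j n| <= k.+1%:R * 2^-1 ^+ j.
Proof.
rewrite normrZ (gtr0_norm (amplitude_gt0 _ _)).
apply: (le_trans (ler_wpM2l (ltW (amplitude_gt0 j n)) (cos_Ck_norm k (freq_gt0 j n)))).
rewrite /amplitude -mulrA [_ * (k.+1%:R * _)]mulrCA -exprMn mulVf ?expr1n ?mulr1.
  by rewrite mulrC.
by rewrite pnatr_eq0 -lt0n freq_gt0.
Qed.

Lemma noise_norm j t : `|noise j t| <= k.+1%:R * 2^-1 ^+ j.
Proof.
have c0 : 0 <= k.+1%:R * (2^-1 : R) ^+ j by rewrite mulr_ge0// exprn_ge0// invr_ge0.
apply: (le_trans (ler_norm_sum _ _ _)).
apply: (@le_trans _ _ (\sum_(i < (block j).+1)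
    weight i ((block j)%:R * t) * (k.+1%:R * 2^-1 ^+ j))).
  apply: ler_sum => i _; rewrite normrZ ger0_norm ?weight_ge0//.
  by rewrite ler_wpM2l ?weight_ge0//; exact: mode_norm.
by rewrite -mulr_suml ler_piMl// weight_sum.
Qed.

Lemma modeE j n x : mode j n x = amplitude j n * cosm (freq j n) x.
Proof. by []. Qed.

Lemma Ck_sumE (I : finType) (F : I -> X) x : (\sum_i F i : X) x = \sum_i F i x.
Proof. by elim/big_rec2: _ => //= i u v _ <-. Qed.

Lemma noiseE j t x : noise j t x =
  \sum_(i < (block j).+1) weight i ((block j)%:R * t) * mode j (block j + i) x.
Proof. by rewrite /noise Ck_sumE. Qed.

Lemma average_noise q j t y : average q (noise j t) y =
  \sum_(i < (block j).+1) weight i ((block j)%:R * t) *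
    (amplitude j (block j + i) * average q (cosm (freq j (block j + i))) y).
Proof.
rewrite /average; under eq_bigr do rewrite noiseE.
rewrite exchange_big mulr_sumr; apply: eq_bigr => i _ /=.
by rewrite -mulr_sumr -mulr_sumr; ring.
Qed.

(** For a place m < n of the block, j <= block j <= m gives j + m^2 + 1 <= (m + 1)^2 <= n^2: twice
    the frequency divides the dilation, and every term averages to 0. *)
Lemma average_noise_low q j t n y : (block j + block j < n)%N -> q = dilation n ->
  average q (noise j t) y = 0.
Proof.
move=> jn ->; rewrite average_noise big1// => i _.
rewrite average_cosm_low ?mulr0 ?dilation_gt0 ?freq_gt0//.
rewrite /freq -expnS dvdn_exp2l//.
have := leq_block j; have := ltn_ord i; rewrite ltnS => h1 h2.
have h3 : (block j + i < n)%N by lia.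
have : ((block j + i).+1 ^ 2 <= n ^ 2)%N by rewrite leq_sqr.
rewrite !expnS expn0 !muln1; nia.
Qed.

Lemma amplitude_le j j' n n' : (j <= j')%N -> (n <= n')%N ->
  amplitude j' n' <= 2^-1 ^+ j' * (freq j n)%:R^-1 ^+ k.
Proof.
move=> jj nn; rewrite /amplitude ler_wpM2l ?exprn_ge0 ?invr_ge0//.
rewrite lerXn2r ?nnegrE ?invr_ge0// lef_pV2 ?posrE ?ltr0n ?freq_gt0//.
by rewrite ler_nat leq_exp2l// leq_add// leq_sqr.
Qed.

Lemma average_noise_high q j j' t n y : (0 < q)%N -> (j <= j')%N ->
  (n <= block j')%N ->
  `|average q (noise j' t) y| <= 2^-1 ^+ j' * (freq j n)%:R^-1 ^+ k.
Proof.
move=> q0 jj nj; apply: average_bound => // x; rewrite noiseE.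
apply: (le_trans (ler_norm_sum _ _ _)).
have c0 : 0 <= (2^-1 : R) ^+ j' * (freq j n)%:R^-1 ^+ k.
  by rewrite mulr_ge0// exprn_ge0// invr_ge0.
apply: (@le_trans _ _ (\sum_(i < (block j').+1)
    weight i ((block j')%:R * t) * (2^-1 ^+ j' * (freq j n)%:R^-1 ^+ k))).
  apply: ler_sum => i _; rewrite normrM (ger0_norm (weight_ge0 _ _)).
  rewrite ler_wpM2l ?weight_ge0// modeE normrM (gtr0_norm (amplitude_gt0 _ _)).
  apply: (le_trans (ler_piMr (ltW (amplitude_gt0 _ _)) (cosm_bound _ _))).
  by apply: amplitude_le => //; exact: leq_trans (leq_addr _ _).
by rewrite -mulr_suml ler_piMl// weight_sum.
Qed.

(** Inside its own block, the places before i average to 0, place i is unchanged, and the later ones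
    have at most the amplitude of place n + 1, with total weight at most 1. *)
Lemma average_noise_main j i n t y : (i <= block j)%N -> n = (block j + i)%N ->
  `|average (dilation n) (noise j t) y -
     weight i ((block j)%:R * t) * (amplitude j n * cosm (freq j n) y)|
   <= 2^-1 ^+ j * (freq j n.+1)%:R^-1 ^+ k.
Proof.
move=> ij nE; rewrite average_noise.
have il : (i < (block j).+1)%N by [].
rewrite (bigD1 (Ordinal il))//= -nE average_cosm_high ?dilation_gt0//; last first.
  by rewrite freqE dvdn_mulr.
rewrite addrAC subrr add0r; apply: (le_trans (ler_norm_sum _ _ _)).
have c0 : 0 <= (2^-1 : R) ^+ j * (freq j n.+1)%:R^-1 ^+ k.
  by rewrite mulr_ge0// exprn_ge0// invr_ge0.
apply: (@le_trans _ _ (\sum_(i' < (block j).+1 | i' != Ordinal il)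
    weight i' ((block j)%:R * t) * (2^-1 ^+ j * (freq j n.+1)%:R^-1 ^+ k))).
  apply: ler_sum => i' ii'; rewrite normrM (ger0_norm (weight_ge0 _ _)).
  rewrite ler_wpM2l ?weight_ge0// normrM (gtr0_norm (amplitude_gt0 _ _)).
  have [i'i|ii] := leqP i' i.
    have i'lt : (i' < i)%N by rewrite ltn_neqAle i'i andbT.
    rewrite average_cosm_low ?dilation_gt0 ?freq_gt0 ?normr0 ?mulr0//.
    rewrite /freq -expnS dvdn_exp2l//.
    have := leq_block j; have h3 : (block j + i' < n)%N by rewrite nE ltn_add2l.
    have : ((block j + i').+1 ^ 2 <= n ^ 2)%N by rewrite leq_sqr.
    by rewrite !expnS expn0 !muln1; nia.
  apply: (@le_trans _ _ (amplitude j (block j + i') * 1)).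
    rewrite ler_wpM2l ?(ltW (amplitude_gt0 _ _))//.
    by apply: average_bound; [exact: dilation_gt0|move=> x; exact: cosm_bound].
  by rewrite mulr1; apply: amplitude_le => //; rewrite nE -addnS leq_add2l.
rewrite -mulr_suml ler_piMl//; apply: le_trans (weight_sum (block j).+1 ((block j)%:R * t)).
by rewrite [leRHS](bigD1 (Ordinal il))//= lerDr weight_ge0.
Qed.

Lemma average_noise_sum (S : X) (C t : R) j i n y : (i <= block j)%N ->
  n = (block j + i)%N ->
  (forall m, `|S - \sum_(j < m) noise j t| <= C * 2^-1 ^+ m) ->
  `|average (dilation n) S y -
     weight i ((block j)%:R * t) * (amplitude j n * cosm (freq j n) y)|
   <= amplitude j n / 8.
Proof.
move=> ij nE SP; set main := weight _ _ * _.
have n1 : (1 <= n)%N by rewrite nE addn_gt0 block_gt0.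
pose A : R := (freq j n.+1)%:R^-1 ^+ k.
have A0 : 0 <= A by rewrite exprn_ge0// invr_ge0.
(* From n to n + 1 the frequency is multiplied by 2^(2n+1), at least 2^3, and k >= 2 makes the gain
   at least 2^6; the factor 2 sums the geometric series over the later blocks. *)
have bound : 2 * 2^-1 ^+ j * A <= amplitude j n / 16.
  have fE : (freq j n.+1)%:R^-1 = (freq j n)%:R^-1 * 2^-1 ^+ (2 * n + 1) :> R.
    rewrite /freq !natrX -!exprVn -exprD; congr (_ ^+ _).
    by rewrite !expnS expn0 !muln1; lia.
  rewrite /A fE exprMn -exprM /amplitude.
  have h : (2^-1 : R) ^+ ((2 * n + 1) * k) <= 2^-1 ^+ 6.
    have e6 : (6 <= (2 * n + 1) * k)%N by apply: (@leq_mul 3 2 (2 * n + 1) k); lia.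
    by apply: ler_wiXn2l => //; lra.
  set B := (freq j n)%:R^-1 ^+ k in h *; set J := 2^-1 ^+ j in h *.
  have B0 : 0 <= J * B by rewrite mulr_ge0// exprn_ge0// invr_ge0.
  have h6 : (2^-1 : R) ^+ 6 = 64^-1 by rewrite !exprS expr0; field.
  have := ler_wpM2l B0 h; rewrite h6; lra.
have fin m : (j < m)%N ->
    `|average (dilation n) (\sum_(j < m) noise j t : X) y - main| <= amplitude j n / 16.
  move=> jm.
  have -> : average (dilation n) (\sum_(j < m) noise j t : X) y =
      \sum_(j' < m) average (dilation n) (noise j' t) y.
    rewrite /average; under eq_bigr do rewrite Ck_sumE.
    by rewrite exchange_big mulr_sumr.
  have -> : main = \sum_(j' < m) (if j' == j :> nat then main else 0).
    by rewrite -big_mkcond (big_pred1 (Ordinal jm))//.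
  rewrite -sumrB; apply: (le_trans (ler_norm_sum _ _ _)).
  apply: (@le_trans _ _ (\sum_(j' < m) (if (j <= j')%N then 2^-1 ^+ j' * A else 0))).
    apply: ler_sum => j' _; case: (ltngtP j' j) => [jj|jj|->].
    - rewrite (@average_noise_low (dilation n) j' t n)// ?subrr ?normr0// nE.
      by have := block_lt jj; have := block_gt0 j'; lia.
    - rewrite subr0; apply: average_noise_high; rewrite ?dilation_gt0// 1?ltnW//.
      by have := block_lt jj; rewrite nE; have := block_gt0 j; lia.
    - exact: average_noise_main.
  rewrite -(big_mkord xpredT (fun j' => if (j <= j')%N then 2^-1 ^+ j' * A else 0)).
  rewrite (big_cat_nat (n := j))//= ?(ltnW jm)//.
  rewrite [X in X + _]big1_seq ?add0r; last first.
    by move=> j' /andP[_]; rewrite mem_index_iota => /andP[_ h]; rewrite leqNgt h.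
  rewrite (eq_big_nat _ _ (F2 := fun j' => 2^-1 ^+ j' * A)); last first.
    by move=> j' /andP[-> _].
  rewrite -mulr_suml; apply: le_trans bound; rewrite ler_wpM2r//.
  by apply: geometric_half; exact: ltnW.
have C0 : 0 <= C.
  by have := SP 0%N; rewrite expr0 mulr1; exact: le_trans.
have a0 := amplitude_gt0 j n.
pose m := (j + Num.bound (C / (amplitude j n / 16))).+1.
have Cm : C * 2^-1 ^+ m <= amplitude j n / 16.
  have h1 : C / (amplitude j n / 16) < (2 ^+ m : R).
    apply: (@lt_trans _ _ (Num.bound (C / (amplitude j n / 16)))%:R).
      by apply: archi_boundP; rewrite !divr_ge0// ltW.
    rewrite -natrX ltr_nat; apply: (@leq_ltn_trans m); last exact: ltn_expl.
    by rewrite /m leqW// leq_addl.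
  rewrite exprVn ler_pdivrMr ?exprn_gt0//.
  by rewrite ltr_pdivrMr in h1; [rewrite mulrC; exact: ltW|rewrite divr_gt0].
have jm : (j < m)%N by rewrite /m ltnS leq_addr.
have tail : `|average (dilation n) S y -
    average (dilation n) (\sum_(j < m) noise j t : X) y| <= amplitude j n / 16.
  rewrite -averageB; apply: average_bound; first exact: dilation_gt0.
  move=> x; apply: le_trans Cm; apply: le_trans (SP m).
  exact: (Ck_sub_bound S (\sum_(j < m) noise j t)).
have := fin m jm; have := tail.
rewrite !ler_norml => /andP[h1 h2] /andP[h3 h4]; apply/andP; split; lra.
Qed.

(** With weight at least 1/2 the main cosine reaches half its amplitude on either side of the level,
    the average of g at 0, while S and g each perturb it by at most an eighth. It has 2^j periods
    per period of the rotation, hence more than M alternations. *)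
Lemma noise_cyclicity (S g : X) (C t : R) j i M : (i <= block j)%N ->
  (forall m, `|S - \sum_(j < m) noise j t| <= C * 2^-1 ^+ m) ->
  `|(block j)%:R * t - i%:R| <= 2^-1 ->
  (forall x y, `|average (dilation (block j + i)) g x -
     average (dilation (block j + i)) g y| <= amplitude j (block j + i) / 8) ->
  (M < 2 ^ j)%N ->
  ~ (cyclicity (S + g : X)%R ((dilation (block j + i))%:R^-1)%R <= (M%:R)%:E)%E.
Proof.
move=> ij SP ti gP Mj; set n := (block j + i)%N in gP *.
have wt := weight_half ti; have a0 := amplitude_gt0 j n.
have sumE y : average (dilation n) (S + g : X) y =
    average (dilation n) S y + average (dilation n) g y.
  exact: (averageD _ S g).
have Sn y := average_noise_sum y ij (erefl n) SP.
have qm : (0 < dilation n * 2 ^ j)%N by rewrite muln_gt0 dilation_gt0 expn_gt0.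
have [sep cy cz] := @uniform_arcs R _ qm.
have wa : amplitude j n / 2 <= weight i ((block j)%:R * t) * amplitude j n.
  by rewrite mulrC ler_wpM2r// ltW.
apply: (averaged_cyclicity (c := average (dilation n) g 0) k2 (dilation_gt0 n) Mj sep).
move=> s; split; rewrite sumE.
- have := Sn (tau * s%:R / (dilation n * 2 ^ j)%:R).
  rewrite freqE cy mulr1 ler_norml => /andP[h1 _].
  have := gP (tau * s%:R / (dilation n * 2 ^ j)%:R) 0.
  by rewrite ler_norml => /andP[h2 _]; move: h1; rewrite -/n; lra.
- have := Sn (tau * s%:R / (dilation n * 2 ^ j)%:R + tau / (2 * (dilation n * 2 ^ j)%:R)).
  rewrite freqE cz mulrN1 mulrN ler_norml => /andP[_ h1].
  have := gP (tau * s%:R / (dilation n * 2 ^ j)%:R + tau / (2 * (dilation n * 2 ^ j)%:R)) 0.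
  by rewrite ler_norml => /andP[_ h2]; move: h1; rewrite -/n; lra.
Qed.

End Noise.

(** * The law of the random function does not charge finite cyclicity *)

Section UniformLaw.
Context {R : realType}.
Local Notation P := (uniform_prob (@ltr01 R)).

Lemma uniform_prob_le (A : set R) : measurable A -> (P A <= lebesgue_measure A)%E.
Proof.
move=> mA; rewrite /uniform_prob integral_uniform_pdf.
have mA1 : measurable (A `&` `[0, 1] : set R) by exact: measurableI.
rewrite (eq_integral (fun=> 1%:E)); last first.
  by move=> x /set_mem[_]; rewrite /= in_itv/= /uniform_pdf => ->; rewrite subr0 invr1.
rewrite integral_cst// mul1e; apply: le_measure; [exact: mem_set|exact: mem_set|exact: subIsetl].
Qed.

Lemma uniform_prob_outside : P (~` `[0, 1]) = 0%E.
Proof.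
by rewrite /uniform_prob integral_uniform_pdf setICl integral_set0.
Qed.

Lemma uniform_prob_bigsetU (I : finType) (B : pred I) (A : I -> set R) (d : R) :
  (forall i, measurable (A i)) -> (forall i, (P (A i) <= d%:E)%E) ->
  (P (\big[setU/set0]_(i | B i) A i) <= (#|B|%:R * d)%:E)%E.
Proof.
move=> mA PA; rewrite -sum1_card natr_sum mulr_suml -sumEFin.
have : measurable (\big[setU/set0]_(i | B i) A i) /\
    (P (\big[setU/set0]_(i | B i) A i) <= \sum_(i | B i) (1 * d)%:E)%E.
  elim/big_rec2: _ => [|i s S _ [mS PS]]; first by rewrite measure0.
  split; first exact: measurableU.
  apply: (@le_trans _ _ (P (A i) + P S)%E); first by apply: measureU2 => //; exact: mA.
  by apply: leeD => //; rewrite mul1r.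
by case.
Qed.

End UniformLaw.

(** * Bad places of a block and the parameters that select them *)

Section BadBlocks.
Context {R : realType} {k : nat}.
Local Notation tau := (@tau R).
Local Notation K := k.+2.
Local Notation X := (Ck_circle R K).
Local Notation P := (uniform_prob (@ltr01 R)).
Variable g : X.

Definition block_dilation j i : nat := dilation (@block K j + i).

(** The exponent is that of [amplitude] once the power of the dilation is removed. The 32 makes the
    term 2 c of [average_oscillation] use up half of the allowance amplitude / 8. *)
Definition threshold j : R := 2^-1 ^+ (j * K.+1) / (32 * tau ^+ K).

Definition bad j (i : 'I_(@block K j).+1) : bool :=
  (tau / (block_dilation j (@block K j).+1)%:R * threshold j) ^+ 2 <
  energy (block_dilation j (@block K j).+1) (fun x =>
     average (block_dilation j i) (top_increment g (block_dilation j) (@block K j).+1) x -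
     average (block_dilation j i.+1) (top_increment g (block_dilation j) (@block K j).+1) x).

Lemma threshold_gt0 j : 0 < threshold j.
Proof.
have tK : 0 < tau ^+ K by rewrite exprn_gt0// tau_gt0.
by apply: divr_gt0; [rewrite exprn_gt0// invr_gt0|rewrite mulr_gt0].
Qed.

Lemma block_dilation_gt0 j i : (0 < block_dilation j i)%N.
Proof. exact: dilation_gt0. Qed.

Lemma block_dilation_dvd j i : (block_dilation j i %| block_dilation j i.+1)%N.
Proof. by rewrite dvdn_exp2l// leq_sqr leq_add2l. Qed.

(** Chebyshev's inequality: every bad place takes more than its threshold from the total energy of
    the chain. *)
Lemma bad_card j : #|@bad j|%:R * threshold j ^+ 2 <= `|g| ^+ 2.
Proof.
set N := (@block K j).+1; set eta := tau / (block_dilation j N)%:R.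
have eta0 : 0 < eta by rewrite divr_gt0 ?tau_gt0// ltr0n block_dilation_gt0.
have := top_increment_energy g (block_dilation_gt0 j) (block_dilation_dvd j) N.
rewrite -/eta => h.
rewrite -(ler_pM2r (exprn_gt0 2 eta0)) -[leRHS]exprMn; apply: le_trans h.
rewrite -mulrA -exprMn -sum1_card natr_sum mulr_suml.
rewrite [leRHS](bigID (@bad j))/= -[leLHS]addr0; apply: lerD.
  by apply: ler_sum => i bi; rewrite mul1r mulrC; exact: ltW bi.
by apply: sumr_ge0 => i _; exact: energy_ge0.
Qed.

(** The other half of the allowance absorbs 5 |g| times the ratio of consecutive dilations. That
    ratio is at most 2^-(j (K + 1)) 2^-j thanks to the squares in the exponents, and 80 = 5 * 16
    gives the condition on j. *)
Lemma good_oscillation j (i : 'I_(@block K j).+1) x y :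
  80 * `|g| * tau ^+ K <= 2 ^+ j -> ~~ bad i ->
  `|average (block_dilation j i) g x - average (block_dilation j i) g y|
    <= @amplitude R K j (@block K j + i) / 8.
Proof.
move=> jbig; rewrite /bad -leNgt => good.
have t0 := @tau_gt0 R; have tK : 0 < tau ^+ K by rewrite exprn_gt0.
apply: (le_trans (average_oscillation (block_dilation_gt0 j) (block_dilation_dvd j)
  x y (ltn_ord i) (threshold_gt0 j) good)).
set n := (@block K j + i)%N.
have ampE : @amplitude R K j n = 2^-1 ^+ (j * K.+1) * (dilation n)%:R^-1 ^+ K.
  rewrite /amplitude /freq /dilation expnD natrM invfM exprMn mulrA; congr (_ * _).
  by rewrite natrX -exprVn -exprM -exprD; congr (_ ^+ _); rewrite [RHS]mulnS.
have rho : (block_dilation j i)%:R / (block_dilation j i.+1)%:R <=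
    2^-1 ^+ (j * K.+1) * 2^-1 ^+ j :> R.
  rewrite /block_dilation addnS -/n /dilation.
  have -> : (2 ^ (n.+1 ^ 2) = 2 ^ (n ^ 2) * 2 ^ (2 * n + 1))%N.
    by rewrite -expnD; congr (2 ^ _)%N; rewrite !expnS expn0 !muln1; lia.
  rewrite natrM invfM mulrA divff ?mul1r; last by rewrite pnatr_eq0 expn_eq0.
  rewrite natrX -exprVn -exprD; apply: ler_wiXn2l; rewrite ?invr_ge0//; first by lra.
  have h : ((2 * K + 3) * j <= @block K j)%N by rewrite ltnW// ltn_expl.
  by rewrite /n; move: h; nia.
rewrite ampE expr_div_n -exprVn [leRHS]mulrAC.
set q := (dilation n)%:R^-1 ^+ K.
change (tau ^+ K * q * (2 * threshold j + 5 * `|g| *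
  ((block_dilation j i)%:R / (block_dilation j i.+1)%:R)) <= 2^-1 ^+ (j * K.+1) / 8 * q).
have q0 : 0 <= q by rewrite exprn_ge0// invr_ge0.
rewrite -mulrA [_ * (q * _)]mulrCA mulrC; apply: ler_wpM2r => //.
set T := 2^-1 ^+ (j * K.+1) in rho *; have T0 : 0 < T by rewrite exprn_gt0// invr_gt0.
have thr : threshold j * tau ^+ K = T / 32.
  rewrite /threshold -/T; have fld (a b : R) : b != 0 -> a / (32 * b) * b = a / 32.
    by move=> b0; field; rewrite ?b0.
  by rewrite fld// gt_eqF.
have gT : 80 * `|g| * tau ^+ K * (T * 2^-1 ^+ j) <= T.
  apply: (@le_trans _ _ (2 ^+ j * (T * 2^-1 ^+ j))).
    by rewrite ler_wpM2r// mulr_ge0 ?exprn_ge0 ?invr_ge0// ltW.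
  by rewrite mulrCA -exprMn divff// expr1n mulr1.
have gK : 0 <= 5 * `|g| * tau ^+ K.
  by apply: mulr_ge0; [rewrite mulr_ge0|exact: ltW].
have := ler_wpM2l gK rho; move: thr gT.
move: (threshold j) (tau ^+ K) `|g| ((block_dilation j i)%:R / (block_dilation j i.+1)%:R) (2^-1 ^+ j) => a b c d e.
clear rho; clearbody T; lra.
Qed.

(** The parameters t for which a nearest place to block j * t is bad. *)
Definition badset j : set R := \big[setU/set0]_(i | @bad j i)
  `[(i%:R - 2^-1) / (@block K j)%:R, (i%:R + 2^-1) / (@block K j)%:R]%classic.

Lemma badset_measurable j : measurable (badset j).
Proof. by apply: bigsetU_measurable => i _; exact: measurable_itv. Qed.

(** One interval has length 1 / block j, and the exponent 2K + 3 of the block exceeds by one the 2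
    (K + 1) lost in the squared threshold, which leaves 2^-j. *)
Lemma badset_prob j :
  (P (badset j) <= (`|g| ^+ 2 * (32 * tau ^+ K) ^+ 2 * 2^-1 ^+ j)%:E)%E.
Proof.
have N0 : 0 < (@block K j)%:R :> R by rewrite ltr0n block_gt0.
have t0 := @tau_gt0 R.
apply: (@le_trans _ _ (#|@bad j|%:R * (@block K j)%:R^-1)%:E).
  apply: uniform_prob_bigsetU => i; first exact: measurable_itv.
  apply: (le_trans (uniform_prob_le (measurable_itv _))).
  rewrite lebesgue_measure_itv /= lte_fin ltr_pM2r ?invr_gt0//.
  case: ifP => _; last by rewrite lee_fin invr_ge0 ltW.
  rewrite -EFinB lee_fin -mulrBl opprB addrAC.
  by rewrite le_eqVlt; apply/orP; left; apply/eqP; lra.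
rewrite lee_fin.
have th0 := threshold_gt0 j.
have h : #|@bad j|%:R <= `|g| ^+ 2 / threshold j ^+ 2.
  by rewrite ler_pdivlMr ?exprn_gt0//; exact: bad_card.
apply: (@le_trans _ _ (`|g| ^+ 2 / threshold j ^+ 2 * (@block K j)%:R^-1)).
  by rewrite ler_wpM2r// invr_ge0 ltW.
rewrite le_eqVlt; apply/orP; left; apply/eqP.
have -> : (@block K j)%:R^-1 = (2^-1 ^+ (j * K.+1)) ^+ 2 * 2^-1 ^+ j :> R.
  by rewrite /block natrX -exprVn -exprM -exprD; congr (_ ^+ _); lia.
have fld (a z w e : R) : z != 0 -> w != 0 ->
    a / (z / w) ^+ 2 * (z ^+ 2 * e) = a * w ^+ 2 * e.
  by move=> z0 w0; field; rewrite z0 w0.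
by apply: fld; rewrite gt_eqF// ?exprn_gt0 ?invr_gt0// mulr_gt0// exprn_gt0.
Qed.

Lemma badset_liminf_null J : P.-negligible (\bigcap_(j in [set j | (J <= j)%N]) badset j).
Proof.
have mB : measurable (\bigcap_(j in [set j | (J <= j)%N]) badset j).
  by apply: bigcap_measurable; [exists J => /=|move=> j _; exact: badset_measurable].
apply/negligibleP => //; apply/eqP; rewrite eq_le measure_ge0 andbT.
apply/lee_addgt0Pr => e e0; rewrite add0e.
set C := `|g| ^+ 2 * (32 * tau ^+ K) ^+ 2.
have C0 : 0 <= C by rewrite mulr_ge0// sqr_ge0.
pose j := (J + Num.bound (C / e))%N.
apply: (@le_trans _ _ (P (badset j))).
  apply: le_measure; [exact: mem_set|apply: mem_set; exact: badset_measurable|].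
  by apply: bigcap_inf; rewrite /= leq_addr.
apply: (le_trans (badset_prob j)); rewrite lee_fin -/C exprVn ler_pdivrMr ?exprn_gt0//.
have h1 : C / e < 2 ^+ j.
  apply: (@lt_trans _ _ (Num.bound (C / e))%:R).
    by apply: archi_boundP; rewrite divr_ge0// ltW.
  rewrite -natrX ltr_nat; apply: (@leq_ltn_trans j); last exact: ltn_expl.
  by rewrite leq_addl.
by rewrite ltr_pdivrMr// in h1; rewrite mulrC; exact: ltW.
Qed.

(** Let M bound the cyclicity. For j beyond M and large against |g|, a good place nearest to block j
    * t would produce 2^j > M alternations, so this place is bad. *)
Lemma finite_cyclicity_badset (S : X) (C t : R) : 0 <= t <= 1 ->
  (forall m, `|S - \sum_(j < m) noise j t| <= C * 2^-1 ^+ m) ->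
  finite_infinitesimal_cyclicity (S + g : X) ->
  exists J, forall j, (J <= j)%N -> badset j t.
Proof.
move=> /andP[t0 t1] SP /finite_cyclicityP[M fM].
pose b := Num.bound (80 * `|g| * tau ^+ K).
exists (maxn M b) => j; rewrite geq_max => /andP[Mj bj].
have jbig : 80 * `|g| * tau ^+ K <= 2 ^+ j.
  apply: (@le_trans _ _ b%:R).
    have tK : 0 <= tau ^+ K by rewrite exprn_ge0// ltW// tau_gt0.
    by apply/ltW/archi_boundP; apply: mulr_ge0 => //; rewrite mulr_ge0.
  by rewrite -natrX ler_nat (leq_trans bj)// ltnW// ltn_expl.
have N0 : 0 < (@block K j)%:R :> R by rewrite ltr0n block_gt0.
pose i := Num.truncn ((@block K j)%:R * t + 2^-1).
have Nt : 0 <= (@block K j)%:R * t by rewrite mulr_ge0// ltW.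
have /truncn_itv/andP[i1 i2] : 0 <= (@block K j)%:R * t + 2^-1 by lra.
rewrite -/i in i1 i2; rewrite -[i.+1%:R]natr1 in i2.
have iN : (i <= @block K j)%N.
  rewrite -ltnS -(ltr_nat R) -natr1; apply: (le_lt_trans i1).
  by have := ler_piMr (ltW N0) t1; lra.
have ti : `|(@block K j)%:R * t - i%:R| <= 2^-1.
  by rewrite ler_norml; apply/andP; split; lra.
pose i' : 'I_(@block K j).+1 := Ordinal (iN : (i < (@block K j).+1)%N).
have bi : bad i'.
  apply: contraT => nb; exfalso.
  have Mj2 : (M < 2 ^ j)%N by apply: leq_ltn_trans Mj _; exact: ltn_expl.
  have gP x y : `|average (dilation (@block K j + i)) g x -
      average (dilation (@block K j + i)) g y| <= @amplitude R K j (@block K j + i) / 8.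
    exact: (good_oscillation x y jbig nb).
  have := @noise_cyclicity R K isT S g C t j i M iN SP ti gP Mj2.
  by apply; exact: fM.
rewrite /badset (bigD1 i')//=; left; rewrite /= in_itv /=.
rewrite ler_pdivrMr// ler_pdivlMr//.
by move: ti; rewrite ler_norml mulrC => /andP[? ?]; apply/andP; split; lra.
Qed.

End BadBlocks.

Section BorelMaps.
Context {R : realType} {X : normedModType R}.
Local Notation borel := (g_sigma_algebraType (@open X)).

Lemma continuous_borel_measurable (h : R -> X) : continuous h ->
  measurable_fun setT (h : R -> borel).
Proof.
move=> hc; apply: (@measurability _ _ R borel setT h (@open X)) => // _ [A oA <-].
rewrite setTI; apply: open_measurable.
by move/continuousP : hc; apply.
Qed.

Lemma law_of_curve (P : probability (measurableTypeR R) R) (h : R -> X) : continuous h ->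
  exists mu : probability borel R, forall A, mu A = P (h @^-1` A).
Proof.
move=> hc; pose mixin := isMeasurableFun.Build _ _ (measurableTypeR R) borel h
  (continuous_borel_measurable hc).
pose f : {mfun measurableTypeR R >-> borel} := HB.pack h mixin.
by exists (distribution P f).
Qed.

End BorelMaps.

Section RandomFunction.
Context {R : realType} {k : nat}.
Local Notation X := (Ck_circle R k).

Lemma continuous_sum (I : finType) (F : I -> R -> X) :
  (forall i, continuous (F i)) -> continuous (fun t => \sum_i F i t).
Proof.
move=> Fc; elim: (index_enum I) => [|i s IH].
  have -> : (fun t => \sum_(i <- [::]) F i t) = (fun=> 0).
    by apply/funext => t; rewrite big_nil.
  by move=> t; exact: cvg_cst.
have -> : (fun t => \sum_(j <- i :: s) F j t) = (fun t => F i t + \sum_(j <- s) F j t).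
  by apply/funext => t; rewrite big_cons.
by move=> t; apply: cvgD; [exact: Fc|exact: IH].
Qed.

Lemma noise_continuous j : continuous (@noise R k j).
Proof.
apply: continuous_sum => i.
have wc : continuous (fun t : R => weight i ((@block k j)%:R * t)).
  move=> t; apply: (@continuous_comp _ _ _ (fun t : R => (@block k j)%:R * t) (weight i)).
    by apply: cvgM; [exact: cvg_cst|exact: cvg_id].
  exact: weight_continuous.
by move=> t; apply: cvgZr_tmp; exact: wc.
Qed.

(** The same C serves all t: the partial sums converge uniformly and their continuity in t passes to
    the limit. *)
Lemma random_function : exists h : R -> X, continuous h /\
  exists C, forall t m, `|h t - \sum_(j < m) noise j t| <= C * 2^-1 ^+ m.
Proof.
pose C : R := k.+1%:R * (2 * k.+1%:R).
have [h hP] := choice (fun t => Ck_series_sum (fun j => @noise_norm R k j t)).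
exists h; split; last by exists C.
move=> t; apply/cvgrPdist_le => e e0.
have e3 : 0 < e / 3 by rewrite divr_gt0.
have C0 : 0 <= C by rewrite !mulr_ge0.
pose m := Num.bound (C / (e / 3)).
have Cm : C * 2^-1 ^+ m <= e / 3.
  have h1 : C / (e / 3) < 2 ^+ m.
    apply: (@lt_trans _ _ m%:R); first by apply: archi_boundP; rewrite divr_ge0// ltW.
    by rewrite -natrX ltr_nat ltn_expl.
  rewrite exprVn ler_pdivrMr ?exprn_gt0//.
  by rewrite ltr_pdivrMr// in h1; rewrite mulrC; exact: ltW.
have cS : continuous (fun t => \sum_(j < m) @noise R k j t).
  by apply: continuous_sum => j; exact: noise_continuous.
have /cvgrPdist_le /(_ _ e3) := cS t.
apply: filterS => s hs.
have -> : h t - h s = (h t - \sum_(j < m) noise j t) +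
   (\sum_(j < m) noise j t - \sum_(j < m) noise j s) - (h s - \sum_(j < m) noise j s).
  by rewrite opprB !addrA !subrK.
apply: (le_trans (ler_normB _ _)).
have := ler_normD (h t - \sum_(j < m) noise j t) (\sum_(j < m) noise j t - \sum_(j < m) noise j s).
have := le_trans (hP t m) Cm; have := le_trans (hP s m) Cm; move: hs; lra.
Qed.

End RandomFunction.

Theorem theorem3 (R : realType) (k : nat) (hk : (2 <= k)%N) :
  haar_prevalent (IC_infty R k).
Proof.
case: k hk => [|[|k]]// hk.
rewrite /haar_prevalent.
have -> : ~` IC_infty R k.+2 = [set f : Ck_circle R k.+2 | finite_infinitesimal_cyclicity f].
  by apply/seteqP; split=> f /=; [exact: contrapT|move=> ff; apply].
have mFC := @finite_cyclicity_borel R k.+2 hk.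
split=> //.
have [h [hc [C hC]]] := @random_function R k.+2.
have [mu muE] := law_of_curve (uniform_prob (@ltr01 R)) hc.
exists mu => x; rewrite muE.
(* The translation is moved onto the curve: h t lies in x + E exactly when h t - x lies in E, and -x
   becomes the fixed function whose bad places are avoided. *)
pose A := (fun t => h t + - x) @^-1` [set f : Ck_circle R k.+2 | finite_infinitesimal_cyclicity f].
have -> : h @^-1` [set x + e | e in [set f : Ck_circle R k.+2 | finite_infinitesimal_cyclicity f]] = A.
  apply/seteqP; split=> t /=.
    by move=> [e fe he]; rewrite /A /= -he addrC addKr.
  by move=> ft; exists (h t + - x) => //; rewrite addrCA subrr addr0.
have hcx : continuous (fun t => h t + - x).
  by move=> t; apply: cvgD; [exact: hc|exact: cvg_cst].
have mA : measurable (A : set (measurableTypeR R)).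
  by rewrite -[A]setTI; exact: (continuous_borel_measurable hcx).
pose Z : set R := (\bigcup_J \bigcap_(j in [set j | (J <= j)%N]) badset (- x) j)
  `|` ~` `[0, 1]%classic.
have AZ : A `<=` Z.
  move=> t At; have [t01|] := pselect (t \in `[0, 1]); last by right.
  left; rewrite in_itv /= in t01.
  have [J Jb] := finite_cyclicity_badset t01 (hC t) At.
  by exists J.
have nZ : (uniform_prob (@ltr01 R)).-negligible Z.
  apply: negligibleU.
    by apply: negligible_bigcup => J; exact: badset_liminf_null.
  apply/negligibleP; first by apply: measurableC; exact: measurable_itv.
  exact: uniform_prob_outside.
have nA : (uniform_prob (@ltr01 R)).-negligible A by exact: negligibleS nZ.
exact: (measure_negligible _ nA).
Qed.
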